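(* Let $k$ be a field, let $F/k$ be an algebraic function field of one variable with defining polynomial $f(t,x)\in k[t][x]$ of degree $n$ in $x$, and let $\theta\in F$ satisfy $f(t,\theta)=0$ and $F=k(t,\theta)$. Let $k_0$ be the full constant field of $F/k$ and $g$ the genus of $F$. With $A=k[t]$, $A_\infty=k[t^{-1}]_{(t^{-1})}$, $\theta_\infty=\theta/t^{C_f}$, and $\mathcal{O}_F$, $\mathcal{O}_{F,\infty}$ the integral closures of $A$ and $A_\infty$ in $F$, the genus may be computed as $$g=\frac{[k_0:k]-n-\big|[\mathcal{O}_F:A[\theta]]\big|+\big|[\mathcal{O}_{F,\infty}:A_\infty[\theta_\infty]]\big|+C_f\,n(n-1)/2}{[k_0:k]}.$$ If $[k_0:k]=1$, then $$g=1-n-\big|[\mathcal{O}_F:A[\theta]]\big|+\big|[\mathcal{O}_{F,\infty}:A_\infty[\theta_\infty]]\big|+C_f\,n(n-1)/2.$$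
   Context: Setting: $t\in F$ is transcendental over $k$, $K=k(t)$, and $F/K$ is a finite separable extension of degree $n$. The full constant field $k_0$ is the algebraic closure of $k$ in $F$. A defining polynomial of $F/k$ is a polynomial $f(t,x)=x^n+a_1(t)x^{n-1}+\dots+a_n(t)\in k[t][x]$ which is monic, irreducible and separable in $x$, such that $F$ is the quotient field of $k[t][x]/(f)$; $\theta$ is a root of $f$ in $F$. $C_f:=\max\{\lceil \deg a_i(t)/i\rceil : 1\le i\le n\}$, where the zero polynomial is given degree $0$ for this purpose. Then $\theta_\infty=\theta/t^{C_f}$ is integral over $A_\infty$, being a root of $f_\infty(1/t,x)=t^{-nC_f}f(t,t^{C_f}x)\in k[1/t][x]$. Degree function: $v_\infty(h/u)=\deg u-\deg h$ for nonzero $h,u\in A$, and $|x|:=-v_\infty(x)$ for $x\in K$. $A_\infty$ is the valuation ring of $v_\infty$ and $U_\infty$ is its unit group. Index: let $M,M'\subset F$ be two free $A$-modules (or two free $A_\infty$-modules) of rank $n$ spanning $F$ over $K$, with bases $(b_1,\dots,b_n)$ and $(b_1',\dots,b_n')$. Then $[M:M']$ is the class of $\det T$, where $T\in \mathrm{GL}_n(K)$ satisfies $(b_1\ \cdots\ b_n)T=(b_1'\ \cdots\ b_n')$; the class is taken in $K^*/k^*$ for $A$-modules and in $K^*/U_\infty$ for $A_\infty$-modules. The integer $|[M:M']|$ is the value of $|\cdot|$ on any representative. Genus: $g:=\max\{\deg_k B-\dim_k \mathcal{L}(B)+1 : B \text{ a divisor of } F\}$, where $\mathcal{L}(B)=\{a\in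 F^\times: (a)\ge -B\}\cup\{0\}$ and $\deg_k B$ is the degree over $k$.
   Formalization: In the first formula the genus is taken over the full constant field k_0 (degrees and dimensions over k_0), since with deg_k and dim_k it fails when k_0≠k (F=Q(√2)(t), f=x²−2: formula 0, maximum −1); for [k_0:k]=1 the definition over k is kept. *)

(* Defs.v *)
(* MathComp, with classical sets and finmap. *)
From HB Require Import structures.
From mathcomp Require Import all_boot all_order all_algebra all_field.
From mathcomp Require Import zify finmap boolp classical_sets.

Set Implicit Arguments.
Unset Strict Implicit.
Unset Printing Implicit Defensive.

Import Order.TTheory GRing.Theory Num.Theory.
Local Open Scope classical_set_scope.
Local Open Scope ring_scope.

(* A function field F/k together with a transcendental t such that F is a
   finite extension of k(t) is encoded as a finite extension F of the field
   of fractions of k[t]; here t is the indeterminate. *)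
Notation ratfun k := {fraction {poly k}}.

Section RationalFunctions.
Context {k : fieldType}.
Local Notation K := (ratfun k).

Definition tK : K := FracField.tofrac 'X.

(* |x| = - v_oo(x), for x != 0, where \n_ and \d_ are the numerator and the
   denominator of some representation of x as a fraction. *)
Definition degK (x : K) : int :=
  (size (\n_(repr x)))%:Z - (size (\d_(repr x)))%:Z.

Lemma degK_frac (h u : {poly k}) : h != 0 -> u != 0 ->
  degK (FracField.tofrac h / FracField.tofrac u)
  = ((size h).-1)%:Z - ((size u).-1)%:Z.
Proof.
move=> h0 u0; set x := _ / _; rewrite /degK.
set a := \n_(repr x); set b := \d_(repr x).
have b0 : b != 0 by exact: denom_ratioP.
have xE : x = FracField.tofrac a / FracField.tofrac b.
  have FE (r : {ratio {poly k}}) : \pi_K%qT r =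
      FracField.tofrac (\n_ r) / FracField.tofrac (\d_ r).
    have d0 : \d_ r != 0 by exact: denom_ratioP.
    apply: (canRL (mulfK _)); first by rewrite tofrac_eq0.
    rewrite -[LHS]/(FracField.mul _ _) !piE.
    apply/eqmodP; rewrite /= FracField.equivfE /FracField.mulf.
    by rewrite !numden_Ratio ?mulf_neq0 ?oner_eq0 //= !mulr1 mulrC.
  by rewrite -[LHS]reprK FE.
have : h * b = a * u.
  apply/eqP; rewrite -tofrac_eq !rmorphM /=.
  by rewrite -eqr_div ?tofrac_eq0 // -xE.
have a0 : a != 0.
  apply/eqP => a0; move/eqP: xE; rewrite a0 rmorph0 mul0r /x.
  by rewrite mulf_eq0 invr_eq0 !tofrac_eq0 (negPf h0) (negPf u0).
move/(congr1 (size \o polyseq)) => /=; rewrite !size_mul //.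
move: h0 u0 a0 b0; rewrite -!size_poly_gt0.
case: (size h) (size u) (size a) (size b) => [|p] [|q] [|r] [|s] //= _ _ _ _.
by move=> E; lia.
Qed.

(* A = k[t] and A_oo, the valuation ring of v_oo, as subrings of k(t). *)
Definition ringA : set K := range (@FracField.tofrac {poly k}).
Definition ringAoo : set K := [set x | x = 0 \/ degK x <= 0].

(* C_f: the coefficient a_i of x^(n-i) is f`_(n - i), and
   (a + i - 1) %/ i is the ceiling of a / i. *)
Definition Cf (f : {poly {poly k}}) : nat :=
  let n := (size f).-1 in
  let a i : {poly k} := f`_(n - i) in
  \max_(1 <= i < n.+1) ((size (a i)).-1 + i.-1) %/ i.

End RationalFunctions.

Section Lattices.
Context {k : fieldType} {F : fieldExtType (ratfun k)}.
Local Notation K := (ratfun k).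
Implicit Types (R : set K) (M : set F).

Definition integral_closure R : set F :=
  [set z | exists p : {poly K},
     [/\ p \is monic, forall i, R p`_i & root (map_poly (in_alg F) p) z]].

Definition ring_adjoin R (z : F) : set F :=
  [set (map_poly (in_alg F) q).[z] | q in [set q : {poly K} | forall i, R q`_i]].

(* b is an R-basis of M that is also a K-basis of F. *)
Definition lattice_basis R M (b : (\dim {:F}).-tuple F) : Prop :=
  basis_of {:F} b /\
  M = [set \sum_i c i *: tnth b i |
        c in [set c : 'I_(\dim {:F}) -> K | forall i, R (c i)]].

(* [M : M'] as a subset of K^*: the determinants of the base changes for all
   choices of R-bases. Another choice multiplies the determinant by an
   arbitrary unit of R, so this is a class modulo k^* for R = A and modulo
   U_oo for R = A_oo. *)
Definition lattice_index R M M' : set K :=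
  [set d | exists (b b' : (\dim {:F}).-tuple F) (T : 'M[K]_(\dim {:F})),
     [/\ lattice_basis R M b, lattice_basis R M' b', T \in unitmx,
         forall j, tnth b' j = \sum_i T i j *: tnth b i & d = \det T]].

(* The value of |.| at a representative of the class; it does not depend on
   the representative as units of A and of A_oo have degree 0. *)
Definition abs_lattice_index R M M' : int :=
  degK (xget 0 (lattice_index R M M')).

End Lattices.

Section FunctionField.
Context {k : fieldType} (F : fieldExtType (ratfun k)).

Definition kconst : k -> F := in_alg F \o @FracField.tofrac {poly k} \o polyC.

Definition base_constants : set F := range kconst.
Definition full_constants : set F := [set x | algebraicOver kconst x].

(* V / W has dimension d over C, for C-subspaces W `<=` V of F. *)
Definition has_dim (C V W : set F) (d : nat) : Prop :=
  exists b : 'I_d -> F,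
  [/\ forall i, V (b i),
      forall c : 'I_d -> F, (forall i, C (c i)) ->
        W (\sum_i c i * b i) -> forall i, c i = 0
    & forall v, V v -> exists2 c : 'I_d -> F,
        (forall i, C (c i)) & W (v - \sum_i c i * b i)].

(* 0 if V / W is infinite dimensional. *)
Definition const_dim (C V W : set F) : nat := xget 0%N [set d | has_dim C V W d].

(* A place of F/k, given by its normalized discrete valuation. The value at 0,
   which should be +oo, is set to 0 so that equal valuations are equal as
   functions to int; it is never used. *)
Record place := Place {
  val_at :> F -> int;
  val_at0 : val_at 0 = 0;
  val_atM : forall x y, x != 0 -> y != 0 -> val_at (x * y) = val_at x + val_at y;
  val_atD : forall x y, x != 0 -> y != 0 -> x + y != 0 ->
    Num.min (val_at x) (val_at y) <= val_at (x + y);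
  val_at_const : forall c : k, c != 0 -> val_at (kconst c) = 0;
  val_at_unif : exists2 x, x != 0 & val_at x = 1 }.

HB.instance Definition _ := gen_eqMixin place.
HB.instance Definition _ := gen_choiceMixin place.

Definition place_ring (P : place) : set F := [set x | x = 0 \/ 0 <= P x].
Definition place_ideal (P : place) : set F := [set x | x = 0 \/ 0 < P x].

Definition divisor := {fsfun place -> int with 0}.

Definition place_degree (C : set F) (P : place) : nat :=
  const_dim C (place_ring P) (place_ideal P).

Definition divisor_degree (C : set F) (B : divisor) : int :=
  \sum_(P <- finsupp B) B P * (place_degree C P)%:Z.

Definition riemann_roch_space (B : divisor) : set F :=
  [set a | a = 0 \/ forall P : place, - B P <= P a].

(* deg_C B - dim_C L(B) + 1 *)
Definition genus_defect (C : set F) (B : divisor) : int :=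
  divisor_degree C B - (const_dim C (riemann_roch_space B) [set 0])%:Z + 1.

(* g is the maximum of the deg_C B - dim_C L(B) + 1, where degrees and
   dimensions are taken over the field of constants C. The genus of F is the
   case where C is the full constant field: for a smaller C the maximum is
   [k0 : C] (g - 1) + 1, which may be negative. *)
Definition is_genus (C : set F) (g : int) : Prop :=
  (exists B, genus_defect C B = g) /\ forall B, genus_defect C B <= g.

Definition constant_degree : nat :=
  const_dim base_constants full_constants [set 0].

(* As f is a polynomial in x over k[t], irreducible_poly and separable_poly
   disregard nonzero factors in k[t], i.e., they bear on f over k(t). For the
   monic f this is irreducibility in k[t][x], by Gauss' lemma. *)
Definition defining_polynomial (f : {poly {poly k}}) (theta : F) : Prop :=
  [/\ f \is monic, irreducible_poly f, separable_poly f,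
      root (map_poly (in_alg F \o @FracField.tofrac {poly k}) f) theta
    & <<1; theta>>%VS = {:F}%VS].

End FunctionField.

Arguments base_constants {k F}.
Arguments full_constants {k F}.

(* Main.v *)
(* For a divisor B, let l(B) and deg B be taken over k. Adding a place to B
   increases l(B) by at most its degree, so deg B - l(B) is nondecreasing. Let D
   be the divisor of poles of t. Every B is at most m D + (a)_0 for some m and
   some nonzero a in k[t]; multiplication by a identifies L(m D + (a)_0) with
   L((m + deg a) D), and deg (a)_0 <= n deg a. So deg B - l(B) is maximal for
   B = m D with m large. Now L(m D) is the intersection of O_F and t^m O_F,oo.
   It contains the intersection of A[theta] and t^m A_oo[theta_oo], of dimension
   n (m + 1) - C_f n (n - 1) / 2. As F = A[theta] + t^m A_oo[theta_oo], the
   quotient has the dimension of O_F / A[theta] plus that of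
   O_F,oo / A_oo[theta_oo]. These are the absolute values of the two indices.
   Passing to the full constant field divides all degrees and dimensions by
   [k_0 : k]. That O_F and O_F,oo are intersections of valuation rings follows
   from Chevalley's extension argument; that they are lattices follows from the
   finiteness of l(m D). *)
Require Import Defs.
From HB Require Import structures.
From mathcomp Require Import all_boot all_order all_algebra all_field.
From mathcomp Require Import zify ring.
From mathcomp Require Import finmap boolp classical_sets.

Set Implicit Arguments.
Unset Strict Implicit.
Unset Printing Implicit Defensive.

Import Order.TTheory GRing.Theory Num.Theory.
Local Open Scope ring_scope.

(** * Dimensions over a subfield *)

Section Dimension.
Variable F : fieldType.
Implicit Types (C V W U : set F) (I J : finType).

(** A growth argument gives only an inequality: the zeros of h / u, for polynomials h and u of
    degree at most d, have total degree at most n d. The finiteness of residue fields, of sets of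
    zeros and of l(B) rests on this bound. The equality comes out at the end: l(m D) = n m + x for
    large m, with x independent of m, and this is compatible with the monotonicity of deg B - l(B)
    only if deg D = n. The indices become dimensions through a triangular basis, adapted to the
    filtration of a quotient by coordinates; this basis also proves freeness. Signs differ at the
    two ends: an overmodule of A is generated by some 1/a, one of A_oo by an element of positive
    degree. So |[O_F,oo : A_oo[theta_oo]]| is minus the dimension of the quotient, which explains
    its sign in the formula. Chevalley's argument yields a valuation ring only. It is discrete
    because x^N, with N = n!, is for every nonzero x a unit times a power of one element of k(t). *)

Record subfield C : Prop := Subfield {
  subfield1 : C 1;
  subfieldB : forall x y, C x -> C y -> C (x - y);
  subfieldM : forall x y, C x -> C y -> C (x * y);
  subfieldV : forall x, C x -> C x^-1 }.

Record submodule C W : Prop := Submodule {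
  submod0 : W 0;
  submodD : forall x y, W x -> W y -> W (x + y);
  submodM : forall c x, C c -> W x -> W (c * x) }.

(** Quotient spaces are never formed: independence and spanning in V / W are stated for families in
    F, with scalars from a subset C of F. Arbitrary finite index types allow sums and products of
    families. *)
Definition free_mod C W I (b : I -> F) :=
  forall c : I -> F, (forall i, C (c i)) -> W (\sum_i c i * b i) ->
    forall i, c i = 0.

Definition span_mod C V W I (b : I -> F) :=
  forall v, V v -> exists2 c : I -> F,
    (forall i, C (c i)) & W (v - \sum_i c i * b i).

Definition basis_mod C V W I (b : I -> F) :=
  [/\ forall i, V (b i), free_mod C W b & span_mod C V W b].

Lemma subfield0 C : subfield C -> C 0.
Proof. by move=> fC; rewrite -(subrr 1); apply: (subfieldB fC) => //;
  apply: (subfield1 fC). Qed.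

Lemma subfieldN C x : subfield C -> C x -> C (- x).
Proof. by move=> fC Cx; rewrite -sub0r; apply: (subfieldB fC) => //;
  apply: (subfield0 fC). Qed.

Lemma subfieldD C x y : subfield C -> C x -> C y -> C (x + y).
Proof.
by move=> fC Cx Cy; rewrite -(opprK y); apply: (subfieldB fC) => //;
  apply: (subfieldN fC).
Qed.

Lemma subfield_sum C I (P : pred I) (c : I -> F) :
  subfield C -> (forall i, P i -> C (c i)) -> C (\sum_(i | P i) c i).
Proof.
move=> fC Cc; elim/big_ind: _ => //; first exact: (subfield0 fC).
by move=> x y; apply: (subfieldD fC).
Qed.

Lemma submodN C W x : subfield C -> submodule C W -> W x -> W (- x).
Proof.
move=> fC sW Wx; rewrite -mulN1r; apply: (submodM sW) => //.
exact: subfieldN (subfield1 fC).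
Qed.

Lemma submodB C W x y : subfield C -> submodule C W -> W x -> W y -> W (x - y).
Proof. by move=> fC sW Wx Wy; apply: (submodD sW) => //;
  apply: (submodN fC sW). Qed.

Lemma submod_sum C W I (P : pred I) (x : I -> F) :
  submodule C W -> (forall i, P i -> W (x i)) -> W (\sum_(i | P i) x i).
Proof.
move=> sW Wx; elim/big_ind: _ => //; first exact: submod0 sW.
by move=> a b; apply: (submodD sW).
Qed.

Lemma submod_comb C W I (c b : I -> F) : submodule C W ->
  (forall i, C (c i)) -> (forall i, W (b i)) -> W (\sum_i c i * b i).
Proof. by move=> sW Cc Wb; apply: (submod_sum sW) => i _; apply: (submodM sW).
  Qed.

Lemma submodule0 C : submodule C [set 0].
Proof.
by split=> // [x y|c x _] /= ->; rewrite ?mulr0 // => ->; rewrite addr0.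
Qed.

Lemma submodule_sub C C' W :
  (C `<=` C')%classic -> submodule C' W -> submodule C W.
Proof. by move=> CC' [W0 WD WM]; split=> // c x /CC'; apply: WM. Qed.

(** Gaussian elimination on the d columns: a zero first column is dropped, and otherwise a pivot row
    clears it, leaving one row and one column less. *)
Lemma linear_relation_ord C (d e : nat) (a : 'I_e -> 'I_d -> F) :
  subfield C -> (d < e)%N -> (forall i j, C (a i j)) ->
  exists c : 'I_e -> F, [/\ forall i, C (c i), exists i, c i != 0
    & forall j, \sum_i c i * a i j = 0].
Proof.
move=> fC; elim: d e a => [|d IH] [//|e] a de Ca.
  exists (fun=> 1); split=> [i||[]//]; first exact: (subfield1 fC).
  by exists ord0; rewrite oner_eq0.
have [/existsP[i0 ai0]|/existsPn a0] := boolP [exists i, a i ord0 != 0];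
  last first.
  have [c [Cc c0 ca]] := IH e.+1 (fun i j => a i (lift ord0 j)) (ltnW de)
    (fun i j => Ca _ _).
  exists c; split=> // j; case: (unliftP ord0 j) => [j'|] -> //.
  by rewrite big1 // => i _; have /negPn/eqP-> := a0 i; rewrite mulr0.
pose r i := a (lift i0 i) ord0 / a i0 ord0.
have rE i : r i * a i0 ord0 = a (lift i0 i) ord0 by rewrite divfK.
have Cr i : C (r i) by apply: (subfieldM fC) => //; apply: (subfieldV fC).
clearbody r.
have [c [Cc [i1 c0] ca]] := IH e (fun i j =>
    a (lift i0 i) (lift ord0 j) - r i * a i0 (lift ord0 j)) de
  (fun i j => subfieldB fC (Ca _ _) (subfieldM fC (Cr i) (Ca _ _))).
(* The coefficient of the pivot row collects the multiples [r i] of it that were subtracted from the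
   other rows. *)
pose c' i := if unlift i0 i is Some i' then c i' else - \sum_i' c i' * r i'.
exists c'; split.
- move=> i; rewrite /c'; case: (unlift i0 i) => [i'|//]; first exact: Cc.
  by apply: (subfieldN fC) => //; apply: (subfield_sum fC) => // i' _;
    apply: (subfieldM fC).
- by exists (lift i0 i1); rewrite /c' liftK.
move=> j; rewrite (bigD1_ord i0) //= {1}/c' unlift_none mulNr mulr_suml.
under [X in _ + X]eq_bigr => i _ do rewrite /c' liftK.
rewrite addrC -sumrB; case: (unliftP ord0 j) => [j'|] ->.
  by rewrite -[RHS](ca j'); apply: eq_bigr => i _; rewrite mulrBr mulrA.
by apply: big1 => i _; rewrite -mulrA rE subrr.
Qed.

Lemma linear_relation C I J (a : I -> J -> F) :
  subfield C -> (#|J| < #|I|)%N -> (forall i j, C (a i j)) ->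
  exists c : I -> F, [/\ forall i, C (c i), exists i, c i != 0
    & forall j, \sum_i c i * a i j = 0].
Proof.
move=> fC IJ Ca.
have [c [Cc [i c0] ca]] := linear_relation_ord fC IJ
  (fun i j => Ca (enum_val i) (enum_val j)).
exists (c \o enum_rank); split=> [i'||j]; first exact: Cc.
  by exists (enum_val i); rewrite /= enum_valK.
rewrite -[RHS](ca (enum_rank j)) enum_rankK.
rewrite (reindex (@enum_val I I)) /=; last exact: onW_bij (@enum_val_bij I).
by apply: eq_bigr => i' _; rewrite enum_valK.
Qed.

(** Write the [b i] modulo W in terms of the [s j]. If there are more of the former, a relation
    among the coefficient rows makes a nontrivial combination of the [b i] fall into W. *)
Lemma leq_free_span C V W I J (b : I -> F) (s : J -> F) :
  subfield C -> submodule C W -> (forall i, V (b i)) ->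
  free_mod C W b -> span_mod C V W s -> (#|I| <= #|J|)%N.
Proof.
move=> fC sW Vb fb ss; rewrite leqNgt; apply/negP => JI.
have /choice[a Ha] i : exists a : J -> F,
    (forall j, C (a j)) /\ W (b i - \sum_j a j * s j).
  by have [a] := ss _ (Vb i); exists a.
have [c [Cc [i c0] ca]] := linear_relation fC JI (fun i => (Ha i).1).
have /fb : W (\sum_i c i * b i).
  have -> : \sum_i c i * b i = \sum_i c i * (b i - \sum_j a i j * s j).
    under [RHS]eq_bigr => i' _ do rewrite mulrBr mulr_sumr.
    rewrite sumrB exchange_big /= [X in _ - X]big1 ?subr0 // => j _.
    under eq_bigr => i' _ do rewrite mulrA.
    by rewrite -mulr_suml ca mul0r.
  by apply: (submod_comb sW) => // i'; case: (Ha i').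
by move/(_ Cc i)/eqP; rewrite (negPf c0).
Qed.

Lemma free_mod_reindex C W I J (f : J -> I) (b : I -> F) :
  bijective f -> free_mod C W b -> free_mod C W (b \o f).
Proof.
move=> [g fK gK] fb c Cc Wc j.
rewrite -[j]fK; apply: (fb (c \o g)) => [i|]; first exact: Cc.
rewrite (reindex f); last by exists g => x _.
by under eq_bigr => j' _ do rewrite /= fK.
Qed.

Lemma span_mod_reindex C V W I J (f : J -> I) (b : I -> F) :
  bijective f -> span_mod C V W b -> span_mod C V W (b \o f).
Proof.
move=> [g fK gK] sb v /sb[c Cc Wv]; exists (c \o f) => [j|]; first exact: Cc.
by move: Wv; rewrite (reindex f) //; exists g => x _.
Qed.

Lemma basis_mod_reindex C V W I J (f : J -> I) (b : I -> F) :
  bijective f -> basis_mod C V W b -> basis_mod C V W (b \o f).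
Proof.
move=> bf [Vb fb sb]; split=> [j||]; first exact: Vb.
  exact: free_mod_reindex.
exact: span_mod_reindex.
Qed.

(** A free family of greatest length spans, since a vector outside its span could be added to it.
    Finiteness of a dimension is usually obtained in this way, from a bound on free families. *)
Lemma basis_mod_exists C V W N :
  subfield C -> submodule C V -> submodule C W ->
  (forall d (b : 'I_d -> F), (forall i, V (b i)) -> free_mod C W b ->
    (d <= N)%N) ->
  exists d (b : 'I_d -> F), basis_mod C V W b.
Proof.
move=> fC sV sW bd.
pose Q d := `[< exists b : 'I_d -> F, (forall i, V (b i)) /\ free_mod C W b >].
have exQ : exists d, Q d.
  exists 0; apply/asboolP; exists (fun=> 0); split=> [[]//|c _ _ []//].
have leQ d : Q d -> (d <= N)%N by move=> /asboolP[b [Vb fb]]; apply: (bd d b).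
case: (ex_maxnP exQ leQ) => d /asboolP[b [Vb fb]] dmax.
exists d, b; split=> // v Vv; apply: contrapT => nv.
suff /dmax : Q d.+1 by rewrite ltnn.
apply/asboolP; exists (fun i => if unlift ord0 i is Some j then b j else v).
split=> [i|c Cc]; first by case: (unlift ord0 i).
rewrite (bigD1_ord ord0) //= unlift_none.
under eq_bigr => j _ do rewrite liftK.
have [c0|c0] := eqVneq (c ord0) 0.
  rewrite c0 mul0r add0r => /fb cl i.
  by case: (unliftP ord0 i) => [j ->|-> //]; apply: (cl (fun=> Cc _)).
move=> Wc; case: nv; exists (fun j => - ((c ord0)^-1 * c (lift ord0 j))).
  by move=> j; apply: (subfieldN fC) => //; apply: (subfieldM fC) => //;
    apply: (subfieldV fC).
have -> : v - \sum_j - ((c ord0)^-1 * c (lift ord0 j)) * b j =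
    (c ord0)^-1 * (c ord0 * v + \sum_j c (lift ord0 j) * b j).
  rewrite mulrDr mulKf // mulr_sumr -sumrN; congr (_ + _).
  by apply: eq_bigr => j _; rewrite mulNr opprK mulrA.
by apply: (submodM sW) => //; apply: (subfieldV fC).
Qed.

Lemma free_mod_sum C W U I J (b : I -> F) (s : J -> F) :
  subfield C -> (U `<=` W)%classic -> submodule C W ->
  free_mod C W b -> (forall j, W (s j)) -> free_mod C U s ->
  free_mod C U (fun x : I + J => match x with inl i => b i | inr j => s j end).
Proof.
move=> fC UW sW fb Ws fs c Cc; rewrite big_sumType /= => Uc.
have c1 : forall i, c (inl i) = 0.
  apply: fb => [i|]; first exact: Cc.
  rewrite -[X in W X](addrK (\sum_j c (inr j) * s j)).
  apply: (submodB fC sW); first exact: UW.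
  by apply: (submod_comb sW) => // j; apply: Cc.
have c2 : forall j, c (inr j) = 0.
  apply: fs => [j|]; first exact: Cc.
  by move: Uc; rewrite big1 ?add0r // => i _; rewrite c1 mul0r.
by case.
Qed.

Lemma basis_mod_sum C V W U I J (b : I -> F) (s : J -> F) :
  subfield C -> (U `<=` W)%classic -> (W `<=` V)%classic -> submodule C W ->
  basis_mod C V W b -> basis_mod C W U s ->
  basis_mod C V U
    (fun x : I + J => match x with inl i => b i | inr j => s j end).
Proof.
move=> fC UW WV sW [Vb fb sb] [Ws fs ss]; split.
- by move=> [i //|j]; apply: WV.
- exact: free_mod_sum fC UW sW fb Ws fs.
- move=> v /sb[c Cc /ss[e Ce Ue]].
  exists (fun x => match x with inl i => c i | inr j => e j end) => [[]//|].
  by rewrite big_sumType /= opprD addrA.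
Qed.

Lemma basis_mod_tower C C' V W I J (b : I -> F) (s : J -> F) :
  subfield C -> subfield C' -> (C `<=` C')%classic -> submodule C' V ->
  submodule C' W -> basis_mod C C' [set 0] s -> basis_mod C' V W b ->
  basis_mod C V W (fun x : I * J => s x.2 * b x.1).
Proof.
move=> fC fC' CC' sV sW [Cs fs ss] [Vb fb sb].
have E (c : I * J -> F) : \sum_x c x * (s x.2 * b x.1) =
    \sum_i (\sum_j c (i, j) * s j) * b i.
  rewrite (reindex (fun x : I * J => x)) /=; last by exists id.
  under [RHS]eq_bigr => i _ do rewrite mulr_suml.
  rewrite pair_big /=; apply: eq_bigr => -[i j] _ /=; by rewrite mulrA.
split.
- by move=> [i j]; apply: (submodM sV).
- move=> c Cc; rewrite E => /fb c0 [i j].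
  have c0i : \sum_j c (i, j) * s j = 0.
    apply: c0 => i'.
    by apply: (subfield_sum fC') => // j' _; apply: (subfieldM fC') => //;
      apply: CC'.
  by apply: (fs (fun j => c (i, j))) => [j'|]; first exact: Cc.
- move=> v /sb[c Cc Wv].
  have /choice[e He] i : exists e : J -> F, (forall j, C (e j)) /\
      c i = \sum_j e j * s j.
    by have [e Ce /eqP] := ss _ (Cc i); rewrite subr_eq0 => /eqP; exists e.
  exists (fun x => e x.1 x.2) => [[i j]|]; first by case: (He i).
  by rewrite E /=; under eq_bigr => i _ do rewrite -(He i).2.
Qed.

Definition linear_over C (phi : F -> F) :=
  (forall x y, phi (x + y) = phi x + phi y) /\
  (forall c x, C c -> phi (c * x) = c * phi x).

Lemma linear_over_sum C phi I (c b : I -> F) : linear_over C phi ->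
  (forall i, C (c i)) -> phi (\sum_i c i * b i) = \sum_i c i * phi (b i).
Proof.
move=> [phiD phiZ] Cc; rewrite (big_morph phi (id1 := 0) (op1 := +%R)) //.
  by apply: eq_bigr => i _; rewrite phiZ.
by apply/(addIr (phi 0)); rewrite -phiD !add0r.
Qed.

Lemma linear_over_mul C u : linear_over C ( *%R^~ u).
Proof. by split=> *; rewrite ?mulrDl ?mulrA. Qed.

Lemma free_mod_in C V W W' phi I (b : I -> F) :
  linear_over C phi -> submodule C V -> (forall i, V (b i)) ->
  (forall x, V x -> W' (phi x) -> W x) ->
  free_mod C W b -> free_mod C W' (phi \o b).
Proof.
move=> lphi sV Vb WW fb c Cc; rewrite -(linear_over_sum _ lphi) // => Wc.
by apply: fb => //; apply: WW => //; apply: (submod_comb sV).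
Qed.

End Dimension.

(** * Dimensions of subquotients of F *)

Section HasDim.
Context {k : fieldType} {F : fieldExtType (ratfun k)}.
Implicit Types (C V W U : set F) (I J : finType).

Lemma basis_mod_has_dim C V W I (b : I -> F) :
  basis_mod C V W b -> has_dim C V W #|I|.
Proof.
move=> bb; exists (b \o enum_val).
exact: basis_mod_reindex (@enum_val_bij I) bb.
Qed.

Lemma has_dim_uniq C V W d e : subfield C -> submodule C W ->
  has_dim C V W d -> has_dim C V W e -> d = e.
Proof.
move=> fC sW [b [Vb fb sb]] [s [Vs fs ss]]; apply/eqP; rewrite eqn_leq.
have:= leq_free_span fC sW Vb fb ss; have:= leq_free_span fC sW Vs fs sb.
by rewrite !card_ord => -> ->.
Qed.

Lemma const_dimE C V W d : subfield C -> submodule C W ->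
  has_dim C V W d -> const_dim C V W = d.
Proof.
move=> fC sW dd; apply: xget_unique => // e ee; exact: has_dim_uniq ee dd.
Qed.

Lemma has_dim_free_le C V W d I (b : I -> F) : subfield C -> submodule C W ->
  has_dim C V W d -> (forall i, V (b i)) -> free_mod C W b -> (#|I| <= d)%N.
Proof.
move=> fC sW [s [_ _ ss]] Vb fb.
by rewrite (leq_trans (leq_free_span fC sW Vb fb ss)) ?card_ord.
Qed.

Lemma has_dim_bound C V W N :
  subfield C -> submodule C V -> submodule C W ->
  (forall d (b : 'I_d -> F), (forall i, V (b i)) -> free_mod C W b ->
    (d <= N)%N) ->
  exists2 d, has_dim C V W d & (d <= N)%N.
Proof.
move=> fC sV sW bd; have [d [b bb]] := basis_mod_exists fC sV sW bd.
by exists d; [exists b|case: bb => Vb fb _; apply: bd fb].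
Qed.

Lemma has_dim_add C V W U d e :
  subfield C -> (U `<=` W)%classic -> (W `<=` V)%classic ->
  submodule C W -> has_dim C V W d -> has_dim C W U e -> has_dim C V U (d + e).
Proof.
move=> fC UW WV sW [b bb] [s bs].
by have /basis_mod_has_dim := basis_mod_sum fC UW WV sW bb bs;
  rewrite card_sum !card_ord.
Qed.

Lemma has_dim_tower C C' V W m d :
  subfield C -> subfield C' -> (C `<=` C')%classic -> submodule C' V ->
  submodule C' W -> has_dim C C' [set 0] m -> has_dim C' V W d ->
  has_dim C V W (d * m).
Proof.
move=> fC fC' CC' sV sW [s bs] [b bb].
by have /basis_mod_has_dim := basis_mod_tower fC fC' CC' sV sW bs bb;
  rewrite card_prod !card_ord.
Qed.

Lemma has_dim_inj C V W V' W' d (phi : F -> F) :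
  subfield C -> submodule C V -> submodule C W -> submodule C W' ->
  linear_over C phi -> (forall x, V x -> V' (phi x)) ->
  (forall x, V x -> W' (phi x) -> W x) -> has_dim C V' W' d ->
  exists2 e, has_dim C V W e & (e <= d)%N.
Proof.
move=> fC sV sW sW' lphi VV' WW' dd; apply: has_dim_bound => // e b Vb fb.
have := has_dim_free_le (b := phi \o b) fC sW' dd.
rewrite card_ord; apply=> [i|]; first exact: VV'.
exact: (free_mod_in lphi sV Vb WW' fb).
Qed.

(** The hypotheses say that [phi] induces an isomorphism from V / W onto V' / W'. *)
Lemma has_dim_image C V W V' W' d (phi : F -> F) :
  subfield C -> submodule C V -> submodule C W' -> linear_over C phi ->
  (forall x, V x -> V' (phi x)) ->
  (forall x, V x -> W' (phi x) -> W x) -> (forall x, V x -> W x ->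
    W' (phi x)) ->
  (forall y, V' y -> exists2 x, V x & W' (y - phi x)) ->
  has_dim C V W d -> has_dim C V' W' d.
Proof.
move=> fC sV sW' lphi VV' W1 W2 sur [b [Vb fb sb]].
exists (phi \o b); split.
- by move=> i; apply: VV'.
- exact: (free_mod_in lphi sV Vb W1 fb).
move=> y /sur[x Vx Wx]; have [c Cc Wc] := sb _ Vx; exists c => //.
rewrite -(linear_over_sum _ lphi) //.
have sVB : V (x - \sum_i c i * b i).
  by apply: (submodB fC sV) => //; apply: (submod_comb sV).
have := submodD sW' Wx (W2 _ sVB Wc).
suff -> : y - phi x + phi (x - \sum_i c i * b i) = y - phi (\sum_i c i * b i)
  by [].
have CN : C (- 1) by apply: (subfieldN fC); apply: (subfield1 fC).
case: lphi => phiD phiZ.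
by rewrite phiD -(mulN1r (\sum_i _)) phiZ // mulN1r addrA subrK.
Qed.

Lemma has_dim_const C V W d : subfield C -> submodule C W ->
  has_dim C V W d -> has_dim C V W (const_dim C V W).
Proof. by move=> fC sW dd; rewrite (const_dimE fC sW dd). Qed.

End HasDim.

(** * Discrete valuation rings containing the constants *)

Section ValuationRing.
Context {k : fieldType} {F : fieldExtType (ratfun k)}.
Local Notation K := (ratfun k).
Local Notation kconst := (@kconst k F).

Definition polyF : {poly k} -> F := in_alg F \o @FracField.tofrac {poly k}.
HB.instance Definition _ := GRing.RMorphism.on polyF.

Lemma polyFC c : polyF c%:P = kconst c. Proof. by []. Qed.

Lemma polyF_eq0 a : (polyF a == 0) = (a == 0).
Proof. by rewrite /polyF /= scaler_eq0 oner_eq0 orbF tofrac_eq0. Qed.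

Lemma polyF_sum a : polyF a = \sum_(i < size a) kconst a`_i * polyF 'X ^+ i.
Proof.
rewrite -{1}[a]coefK poly_def rmorph_sum /=; apply: eq_bigr => i _.
by rewrite -mul_polyC rmorphM rmorphXn.
Qed.

Lemma ratfun_frac (x : K) : exists a b : {poly k},
  b != 0 /\ x = FracField.tofrac a / FracField.tofrac b.
Proof.
exists \n_(repr x), \d_(repr x).
have FE (r : {ratio {poly k}}) : \pi_K%qT r =
    FracField.tofrac (\n_ r) / FracField.tofrac (\d_ r).
  have d0 : \d_ r != 0 by exact: denom_ratioP.
  apply: (canRL (mulfK _)); first by rewrite tofrac_eq0.
  rewrite -[LHS]/(FracField.mul _ _) !piE.
  apply/eqmodP; rewrite /= FracField.equivfE /FracField.mulf.
  by rewrite !numden_Ratio ?mulf_neq0 ?oner_eq0 //= !mulr1 mulrC.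
by split; [exact: denom_ratioP|rewrite -[LHS]reprK FE].
Qed.

Record subring (S : set F) : Prop := Subring {
  subring1 : S 1;
  subringB : forall x y, S x -> S y -> S (x - y);
  subringM : forall x y, S x -> S y -> S (x * y) }.

Section SubringTheory.
Variables (S : set F) (rS : subring S).

Lemma subring0 : S 0.
Proof. by rewrite -(subrr 1); apply: (subringB rS); apply: (subring1 rS). Qed.

Lemma subringN x : S x -> S (- x).
Proof. by move=> Sx; rewrite -sub0r; apply: (subringB rS) => //;
  apply: subring0. Qed.

Lemma subringD x y : S x -> S y -> S (x + y).
Proof. by move=> Sx Sy; rewrite -[y]opprK; apply: (subringB rS) => //;
  apply: subringN. Qed.

Lemma subringX x n : S x -> S (x ^+ n).
Proof.
move=> Sx; elim: n => [|n IH]; first exact: (subring1 rS).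
by rewrite exprS; apply: (subringM rS).
Qed.

Lemma subring_sum I (r : seq I) (P : pred I) (c : I -> F) :
  (forall i, P i -> S (c i)) -> S (\sum_(i <- r | P i) c i).
Proof.
move=> Sc; elim/big_ind: _ => //; first exact: subring0.
by move=> x y; apply: subringD.
Qed.

End SubringTheory.

Definition integral_over (S : set F) z :=
  exists2 p : {poly F}, p \is monic & (forall i, S p`_i) /\ p.[z] = 0.

(** Dividing a monic equation of degree m + 1 by z^m writes z as a polynomial in z^-1 over S. *)
Lemma integral_inv_mem (S : set F) z :
  subring S -> S z^-1 -> integral_over S z -> S z.
Proof.
move=> rS Szi [p mp [Sp pz]].
have [->|z0] := eqVneq z 0; first exact: subring0.
have p0 := monic_neq0 mp; move: pz; rewrite horner_coef.
move: mp; rewrite monicE lead_coefE; move: (size p) (size_poly_gt0 p) => m.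
rewrite p0; case: m => //= m _ /eqP pm.
rewrite big_ord_recr /= pm mul1r; case: m pm => [|m] pm.
  by rewrite big_ord0 add0r expr0 => /eqP; rewrite oner_eq0.
move/eqP; rewrite addr_eq0 => /eqP E.
have -> : z = - (\sum_(i < m.+1) p`_i * (z^-1) ^+ (m - i)).
  apply: (mulfI (expf_neq0 m z0));
    rewrite -exprSr -[LHS]opprK -E mulrN mulr_sumr.
  congr (- _); apply: eq_bigr => i _.
  have im : (i <= m)%N by rewrite -ltnS.
  have zm : z ^+ m = z ^+ i * z ^+ (m - i) by rewrite -exprD subnKC.
  by rewrite mulrCA exprVn zm mulfK ?expf_neq0.
apply: (subringN rS) => //; apply: (subring_sum rS) => // i _.
by apply: (subringM rS) => //; apply: subringX.
Qed.

(** * Valuation rings of F containing the constants are discrete *)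

Section Discrete.
Variables (S : set F) (rS : subring S) (kS : forall c, S (kconst c)).
Hypothesis valS : forall x, S x \/ S x^-1.
Hypothesis properS : exists z, ~ S z.

(** This is the maximal ideal of S: by [valS], a nonzero x with x^-1 outside S lies in S. *)
Let nonunit (x : F) := x = 0 \/ ~ S x^-1.
Let vunit (x : F) := [/\ x != 0, S x & S x^-1].

Lemma nonunit_mem x : nonunit x -> S x.
Proof. by move=> [->|]; [apply: subring0|case: (valS x)]. Qed.

Lemma nonunitM x y : nonunit x -> S y -> nonunit (x * y).
Proof.
have [->|y0] := eqVneq y 0; first by left; rewrite mulr0.
move=> [->|nx] Sy; first by left; rewrite mul0r.
right=> Sxy; apply: nx; have := subringM rS Sxy Sy.
by rewrite invfM divfK.
Qed.

Lemma nonunitD x y : nonunit x -> nonunit y -> nonunit (x + y).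
Proof.
wlog yx : x y / S (y / x).
  move=> H mx my; have [/H|] := valS (y / x); first by apply.
  by rewrite invf_div addrC => /H; apply.
have [->|x0] := eqVneq x 0; first by rewrite add0r.
move=> mx my; have -> : x + y = x * (1 + y / x).
  by rewrite mulrDr mulr1 mulrCA divff // mulr1.
by apply: nonunitM => //; apply: (subringD rS) => //; apply: (subring1 rS).
Qed.

Lemma nonunit_sum I (r : seq I) (P : pred I) (c : I -> F) :
  (forall i, P i -> nonunit (c i)) -> nonunit (\sum_(i <- r | P i) c i).
Proof.
move=> Sc; elim/big_ind: _ => //; first by left.
by move=> x y; apply: nonunitD.
Qed.

Lemma nonunitN x : nonunit x -> nonunit (- x).
Proof.
by move=> nx; rewrite -mulrN1; apply: nonunitM => //; apply: (subringN rS);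
  apply: (subring1 rS).
Qed.

Lemma vunit_inv x : vunit x -> vunit x^-1.
Proof. by case=> x0 Sx Sxi; split; rewrite ?invrK ?invr_eq0. Qed.

Lemma vunitM x y : vunit x -> vunit y -> vunit (x * y).
Proof.
move=> [x0 Sx Sxi] [y0 Sy Syi]; split; first by rewrite mulf_neq0.
  exact: (subringM rS).
by rewrite invfM; apply: (subringM rS).
Qed.

Lemma vunitX x n : vunit x -> vunit (x ^+ n).
Proof.
move=> ux; elim: n => [|n IH]; last by rewrite exprS; apply: vunitM.
by split; rewrite ?invr1 ?oner_eq0 //; apply: (subring1 rS).
Qed.

Lemma vunit_const c : c != 0 -> vunit (kconst c).
Proof.
move=> c0; have E : (kconst c)^-1 = kconst c^-1.
  apply: (mulfI (x := kconst c)); first by rewrite -polyFC polyF_eq0 polyC_eq0.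
  rewrite mulfV; last by rewrite -polyFC polyF_eq0 polyC_eq0.
  by rewrite -!polyFC -rmorphM -polyCM mulfV // rmorph1.
by split; rewrite ?E // -polyFC polyF_eq0 polyC_eq0.
Qed.

Lemma vunit_nonunit x : vunit x -> nonunit x -> False.
Proof. by move=> [x0 _ Sxi] [x1|//]; rewrite x1 eqxx in x0. Qed.

Lemma vunit_or x : S x -> vunit x \/ nonunit x.
Proof.
move=> Sx; have [->|x0] := eqVneq x 0; first by right; left.
by have [?|?] := EM (S x^-1); [left|right; right].
Qed.

Lemma field_elem_integral (x : F) :
  integral_over (range (in_alg F)) x.
Proof.
exists (minPoly 1%VS x); first exact: monic_minPoly.
split=> [i|]; last by apply/eqP; apply: root_minPoly.
have /polyOverP/(_ i)/vlineP[c ->] := minPolyOver 1%VS x.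
by exists c.
Qed.

Lemma integral_overS (R R' : set F) x :
  (R `<=` R')%classic -> integral_over R x -> integral_over R' x.
Proof. by move=> RR [p mp [Rp px]]; exists p => //; split=> // i; apply: RR.
  Qed.

(** Otherwise S contains k(t), over which F is integral; as a valuation ring is integrally closed, S
    would be all of F. *)
Lemma nonunit_poly_exists : (forall a, S (polyF a)) ->
  exists2 a : {poly k}, a != 0 & nonunit (polyF a).
Proof.
move=> SA; apply: contrapT => H; have [z] := properS; apply.
have Sinv a : S (polyF a)^-1.
  have [->|a0] := eqVneq a 0; first by rewrite rmorph0 invr0; apply: subring0.
  by have [[//]|na] := vunit_or (SA a); case: H; exists a.
have [//|Sz] := valS z; apply: integral_inv_mem => //.
apply: integral_overS (field_elem_integral z) => _ [x _ <-].
have [a [b [b0 ->]]] := ratfun_frac x; rewrite rmorphM fmorphV.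
by apply: (subringM rS); [apply: SA|apply: Sinv].
Qed.

Lemma S_polyF : S (polyF 'X) -> forall a, S (polyF a).
Proof.
move=> SX; elim/poly_ind => [|a c IH]; first by rewrite rmorph0;
  apply: subring0.
rewrite rmorphD rmorphM; apply: (subringD rS) => //; last exact: kS.
exact: (subringM rS).
Qed.

(** The two cases are those of the valuations of k(t): the one at infinity, with uniformizer 1/t, if
    t is outside S, and otherwise one given by a polynomial. *)
Lemma poly_uniformizer : exists2 pi, [/\ pi != 0, S pi & ~ S pi^-1] &
  forall a : {poly k}, a != 0 -> exists m : int, vunit (polyF a * pi ^ m).
Proof.
have [SX|nSX] := EM (S (polyF 'X)); last first.
  have SXi : S (polyF 'X)^-1 by have [] := valS (polyF 'X).
  have X0 : polyF 'X != 0 by rewrite polyF_eq0 polyX_eq0.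
  exists (polyF 'X)^-1; first by rewrite invr_eq0 invrK.
  move=> a a0; exists (size a).-1.
  set pi := _^-1.
  have npi : nonunit pi by right; rewrite invrK.
  (* With d = deg a, the quotient a / t^d is the leading coefficient plus terms divisible by 1/t,
     hence a unit. *)
  have -> : polyF a * pi ^ (size a).-1 = kconst (lead_coef a) +
      \sum_(i < (size a).-1) kconst a`_i * pi ^+ ((size a).-1 - i).
    rewrite {1}polyF_sum -exprnP lead_coefE; move: a0; rewrite -size_poly_gt0.
    case: (size a) => //= d _; rewrite big_ord_recr /= mulrDl addrC;
      congr (_ + _).
      by rewrite -mulrA -exprMn mulfV // expr1n mulr1.
    rewrite mulr_suml; apply: eq_bigr => i _; rewrite -mulrA; congr (_ * _).
    have id := ltnW (ltn_ord i).
    have -> : pi ^+ d = pi ^+ i * pi ^+ (d - i) by rewrite -exprD subnKC.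
    by rewrite mulrA -exprMn mulfV // expr1n mul1r.
  set s := \sum_(i < _) _; have ns : nonunit s.
    apply: nonunit_sum => i _; rewrite mulrC; apply: nonunitM => //.
    have := ltn_ord i; rewrite -subn_gt0; case: (_ - _)%N => // j _.
    by rewrite exprS; apply: nonunitM => //; apply: subringX.
  have [//|nu] := vunit_or (subringD rS (kS (lead_coef a)) (nonunit_mem ns)).
  have := nonunitD nu (nonunitN ns); rewrite addrK.
  by move/(vunit_nonunit (vunit_const _)); rewrite lead_coef_eq0 => /(_ a0).
have SA := S_polyF SX.
have [a1 a10 na1] := nonunit_poly_exists SA.
(* A polynomial of least degree in the maximal ideal generates the prime ideal of k[t] below S. *)
pose Q n := `[< exists a : {poly k}, [/\ a != 0,
  nonunit (polyF a) & size a = n] >].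
have exQ : exists n, Q n by exists (size a1); apply/asboolP; exists a1.
case: (ex_minnP exQ) => n /asboolP[a [a0 na san]] amin.
have nsz (b : {poly k}) : b != 0 -> (size b < size a)%N -> vunit (polyF b).
  move=> b0; rewrite san => ba; have [//|nb] := vunit_or (SA b).
  by move: ba; rewrite ltnNge amin //; apply/asboolP; exists b.
have pi0 : polyF a != 0 by rewrite polyF_eq0.
exists (polyF a).
  by split=> //; case: na => // /eqP; rewrite (negPf pi0).
have sa : (1 < size a)%N.
  rewrite ltnNge; apply/negP => /size1_polyC aC; move: na; rewrite aC.
  apply: vunit_nonunit; apply: vunit_const; apply: contraNneq a0 => c0.
  by rewrite aC c0.
move=> b; have [m] := ubnP (size b); elim: m b => // m IH b bm b0.
have [ub|nb] := vunit_or (SA b); first by exists 0; rewrite expr0z mulr1.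
have bE := divp_eq b a.
(* A nonzero remainder would be a unit by minimality of a, yet it lies in the maximal ideal together
   with a and b. *)
have r0 : b %% a = 0.
  apply/eqP/negPn/negP => r0.
  have nr : nonunit (polyF (b %% a)).
    have -> : polyF (b %% a) = polyF b - polyF a * polyF (b %/ a).
      by rewrite {2}bE rmorphD rmorphM addrAC [_ * polyF a]mulrC subrr add0r.
    by apply: nonunitD => //; apply: nonunitN; apply: nonunitM.
  by apply: vunit_nonunit nr; apply: nsz => //; rewrite ltn_modp.
rewrite r0 addr0 in bE.
have q0 : b %/ a != 0 by apply: contraNneq b0 => q0; rewrite bE q0 mul0r.
have sq : (size (b %/ a)%R < m)%N.
  rewrite ltnS in bm; apply: leq_trans bm.
  by rewrite size_divp // ltn_subrL size_poly_gt0 b0 -subn1 subn_gt0 sa.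
have [j uj] := IH _ sq q0; exists (j - 1).
by rewrite {1}bE rmorphM -mulrA expfzDr // exprN1 (mulrCA (polyF a))
  mulfV // mulr1.
Qed.

Lemma dominant_term (r : seq F) : (exists2 x, x \in r & x != 0) ->
  exists x0, [/\ x0 \in r, x0 != 0 & forall x, x \in r -> S (x / x0)].
Proof.
elim: r => [[x]//|y r IH] [x]; rewrite inE => /predU1P xyr x0.
have [[z zr z0]|nr] := EM (exists2 x, x \in r & x != 0); last first.
  case: xyr => [xy|xr]; last by case: nr; exists x.
  rewrite {x}xy in x0.
  exists y; rewrite inE eqxx x0; split=> // w; rewrite inE => /predU1P[->|wr].
    by rewrite mulfV //; apply: (subring1 rS).
  have [->|w0] := eqVneq w 0; first by rewrite mul0r; apply: subring0.
  by case: nr; exists w.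
have [w [wr w0 wS]] := IH (ex_intro2 _ _ z zr z0).
have [Syw|Swy] := valS (y / w).
  exists w; rewrite inE wr orbT; split=> // v; rewrite inE => /predU1P[->//|].
  exact: wS.
have [y0|y0] := eqVneq y 0.
  exists w; rewrite inE wr orbT; split=> // v; rewrite inE => /predU1P[->|].
    by rewrite y0 mul0r; apply: subring0.
  exact: wS.
exists y; rewrite inE eqxx; split=> // v; rewrite inE => /predU1P[->|vr].
  by rewrite mulfV //; apply: (subring1 rS).
have -> : v / y = v / w * (y / w)^-1 by rewrite invf_div mulrA divfK.
by apply: (subringM rS) => //; apply: wS.
Qed.

(** The least value in a vanishing sum is attained twice: dividing by a single term of least value
    would put 1 into the maximal ideal. *)
Lemma associated_terms (I : finType) (y : I -> F) : \sum_i y i = 0 ->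
  (exists i, y i != 0) ->
  exists i j, [/\ i != j, y i != 0, y j != 0 & vunit (y i / y j)].
Proof.
move=> sy [i1 y1].
have [|x0 [/mapP[i0 _ xE] x00 Sx]] := @dominant_term [seq y i | i <- enum I].
  by exists (y i1); rewrite // map_f // mem_enum.
rewrite {}xE in x00 Sx.
have {}Sx i : S (y i / y i0) by apply: Sx; rewrite map_f // mem_enum.
apply: contrapT => H.
have nu i : i != i0 -> nonunit (y i / y i0).
  move=> ii0; have [u|//] := vunit_or (Sx i); case: H; exists i, i0; split=> //.
  by apply: contraTneq isT => yi; case: u; rewrite yi mul0r eqxx.
have : nonunit (\sum_(i | i != i0) y i / y i0) by apply: nonunit_sum.
move: sy; rewrite (bigD1 i0) //= addrC => /eqP; rewrite addr_eq0 => /eqP E.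
rewrite -mulr_suml E mulNr mulfV // => /nonunitN; rewrite opprK.
case=> [/eqP|]; first by rewrite oner_eq0.
by rewrite invr1; apply; apply: (subring1 rS).
Qed.

(** Two terms of the minimal polynomial of x over k(t) are associated. With i the difference of
    their exponents, x^i is therefore associated to an element of k(t). *)
Lemma power_associated (x : F) : x != 0 -> exists i (c : K),
  [/\ (0 < i <= \dim {:F})%N, c != 0 & vunit (x ^+ i * in_alg F c)].
Proof.
move=> x0; pose p := minPoly 1%VS x.
have szp : size p = (adjoin_degree 1%VS x).+1 by rewrite size_minPoly.
have deg : (adjoin_degree 1%VS x <= \dim {:F})%N.
  rewrite adjoin_degreeE dimv1 divn1; exact: dimvS (subvf _).
have /rootP : root p x by apply: root_minPoly.
rewrite horner_coef => /associated_terms[].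
  have pn : ((size p).-1 < size p)%N by rewrite szp.
  exists (Ordinal pn); rewrite /= mulf_neq0 ?expf_neq0 //.
  by rewrite -lead_coefE (eqP (monic_minPoly _ _)) oner_eq0.
have pc i : exists c : K, p`_i = in_alg F c.
  by have /polyOverP/(_ i)/vlineP[c ->] := minPolyOver 1%VS x; exists c.
have key (i j : 'I_(size p)) : (j < i)%N -> p`_i * x ^+ i != 0 ->
    p`_j * x ^+ j != 0 -> vunit (p`_i * x ^+ i / (p`_j * x ^+ j)) ->
    exists i (c : K),
  [/\ (0 < i <= \dim {:F})%N, c != 0 & vunit (x ^+ i * in_alg F c)].
  move=> ji pi pj u; have [ci ciE] := pc i; have [cj cjE] := pc j.
  rewrite ciE in pi u; rewrite cjE in pj u.
  have ci0 : ci != 0.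
    by apply: contraNneq pi => ->; rewrite rmorph0 mul0r.
  have cj0 : cj != 0.
    by apply: contraNneq pj => ->; rewrite rmorph0 mul0r.
  exists (i - j)%N, (ci / cj); split; last 1 first.
  - suff <- : in_alg F ci * x ^+ i / (in_alg F cj * x ^+ j) =
        x ^+ (i - j) * in_alg F (ci / cj) by [].
    rewrite -[in x ^+ i](subnK (ltnW ji)) exprD rmorphM fmorphV.
    by rewrite -mulf_div mulfK ?expf_neq0 // mulrC.
  - rewrite subn_gt0 ji; apply: leq_trans (leq_subr _ _) _.
    by rewrite -ltnS; apply: leq_trans (ltn_ord i) _; rewrite szp ltnS.
  - exact: mulf_neq0 ci0 (invr_neq0 cj0).
move=> i [j [ij pi pj u]]; case: (ltngtP i j) => [ltij|ltji|/val_inj eij].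
- by apply: (key j i) => //; rewrite -invf_div; apply: vunit_inv.
- exact: (key i j).
- by rewrite eij eqxx in ij.
Qed.

Lemma discrete_valuation : exists P : place F, forall x,
  S x <-> x = 0 \/ 0 <= P x.
Proof.
have [pi [pi0 Spi nSpi] piP] := poly_uniformizer.
have ratP (c : K) : c != 0 -> exists m : int, vunit (in_alg F c * pi ^ m).
  have [a [b [b0 ->]]] := ratfun_frac c => c0.
  have a0 : a != 0 by apply: contraNneq c0 => ->; rewrite rmorph0 mul0r.
  have [ma ua] := piP a a0; have [mb ub] := piP b b0.
  exists (ma - mb).
  rewrite rmorphM fmorphV expfzDr // -invr_expz mulrACA -invfM.
  by apply: vunitM => //; apply: vunit_inv.
(* N is a multiple of every exponent i <= n provided by [power_associated], so that x^N is
   associated to a power of [pi] for all nonzero x at once. *)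
pose N := (\dim {:F})`!.
have powP (x : F) : x != 0 -> exists m : int, vunit (x ^+ N * pi ^ m).
  move=> x0; have [i [c [/andP[i0 iF] c0 u]]] := power_associated x0.
  have /dvdnP[e eN] : (i %| N)%N by rewrite dvdn_fact // i0.
  have [m um] := ratP _ c0; exists (- m * e).
  have -> : x ^+ N * pi ^ (- m * e) =
      (x ^+ i * in_alg F c) ^+ e / (in_alg F c * pi ^ m) ^+ e.
    have c0' : in_alg F c != 0 by rewrite fmorph_eq0.
    rewrite !exprMn invfM mulrA mulfK ?expf_neq0 // -exprM mulnC -eN;
      congr (_ * _).
    by rewrite -exprz_exp -(invr_expz pi m) -exprnP exprVn.
  by apply: vunitM; [|apply: vunit_inv]; apply: vunitX.
have piu (m : int) : vunit (pi ^ m) -> m = 0.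
  have H (n : nat) : vunit (pi ^+ n) -> n = 0%N.
    case: n => // n [_ _]; rewrite exprS invfM => Su; case: nSpi.
    have := subringM rS Su (subringX rS n Spi).
    by rewrite mulfVK ?expf_neq0.
  case: m => n; first by move/H->.
  by rewrite NegzE -exprnN => /vunit_inv; rewrite invrK => /H.
have vex (x : F) : exists m : int, x != 0 -> vunit (x ^+ N * pi ^ (- m)).
  have [->|x0] := eqVneq x 0; first by exists 0.
  by have [m um] := powP x x0; exists (- m); rewrite opprK.
have [v vP] := choice vex.
have vuniq x m : x != 0 -> vunit (x ^+ N * pi ^ (- m)) -> v x = m.
  move=> x0 um; apply/eqP; rewrite -subr_eq0; apply/eqP/piu.
  have -> : pi ^ (v x - m) = (x ^+ N * pi ^ (- m)) / (x ^+ N * pi ^ (- v x)).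
    rewrite invfM mulrA [x ^+ N * _]mulrC mulfK ?expf_neq0 // invr_expz opprK.
    by rewrite -expfzDr // addrC.
  by apply: vunitM => //; apply: vunit_inv; apply: vP.
have vM x y : x != 0 -> y != 0 -> v (x * y) = v x + v y.
  move=> x0 y0; apply: vuniq; first by rewrite mulf_neq0.
  by rewrite exprMn opprD expfzDr // mulrACA; apply: vunitM; apply: vP.
have N0 : (0 < N)%N by rewrite fact_gt0.
have vS x : x != 0 -> S x <-> 0 <= v x.
  move=> x0; have [y0 Sy Syi] := vP x x0; split=> [Sx|vx].
    rewrite leNgt; apply/negP; move: Syi.
    case: (v x) => // n; rewrite NegzE opprK => Syi _; apply: nSpi.
    have := subringM rS (subringM rS Syi (subringX rS N Sx))
      (subringX rS n Spi).
    rewrite exprSz invfM (mulrAC _ _ (x ^+ N)) mulVf ?expf_neq0 // mul1r.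
    by rewrite invfM mulfVK // expf_neq0.
  have SxN : S (x ^+ N).
    have := subringM rS Sy (subringX rS `|v x|%N Spi).
    by rewrite (exprnP pi) gez0_abs // -mulrA -expfzDr // addNr expr0z mulr1.
  have [//|Sxi] := valS x.
  have -> : x = x ^+ N * x^-1 ^+ N.-1.
    rewrite -{1}(prednK N0) exprS -mulrA -exprMn mulfV // expr1n mulr1 //.
  by apply: (subringM rS) => //; apply: subringX.
have v1 : v 1 = 0 by apply: (@addrI _ (v 1));
  rewrite -vM ?oner_eq0 // mulr1 addr0.
have vV x : x != 0 -> v x^-1 = - v x.
  move=> x0; apply: (@addrI _ (v x)).
  by rewrite -vM ?invr_eq0 // mulfV // v1 subrr.
have vpi : v pi = N.
  apply: vuniq => //; rewrite exprnP -expfzDr // subrr expr0z.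
  by split; rewrite ?oner_eq0 ?invr1 //; apply: (subring1 rS).
(* The valuation v need not be normalized. Its values are the multiples of the least positive one,
   g, which exists because v pi = N is positive; dividing by g normalizes v. *)
pose Q n := `[< exists x : F, [/\ x != 0, (0 < n)%N & v x = n%:Z] >].
have exQ : exists n, Q n by exists N; apply/asboolP; exists pi.
case: (ex_minnP exQ) => g /asboolP[x1 [x10 g0 vx1]] gmin.
have vX x (m : int) : x != 0 -> v (x ^ m) = v x * m.
  move=> x0; have H (n : nat) : v (x ^+ n) = v x * n%:Z.
    elim: n => [|n IH]; first by rewrite expr0 v1 mulr0.
    by rewrite exprS vM ?expf_neq0 // IH intS mulrDr mulr1.
  case: m => n; first exact: H.
  by rewrite NegzE -exprnN vV ?expf_neq0 // H mulrN.
have gv x : x != 0 -> exists q : int, v x = q * g.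
  move=> x0; exists (v x %/ g)%Z; apply/eqP; rewrite -subr_eq0.
  have -> : v x - (v x %/ g)%Z * g = (v x %% g)%Z by rewrite {1}(divz_eq (v x)
    g); ring.
  have : v (x / x1 ^ (v x %/ g)%Z) = (v x %% g)%Z.
    rewrite vM ?invr_eq0 ?expfz_neq0 // vV ?expfz_neq0 // vX // vx1.
    by rewrite {1}(divz_eq (v x) g); ring.
  have : (0 <= (v x %% g)%Z) by rewrite modz_ge0 // eqz_nat -lt0n.
  have : ((v x %% g)%Z < g%:Z) by rewrite ltz_pmod.
  case: (v x %% g)%Z => // n; rewrite ltz_nat => ng _ vn.
  apply: contraTT ng; rewrite -leqNgt eqz_nat -lt0n => n0; apply: gmin.
  apply/asboolP; exists (x / x1 ^ (v x %/ g)%Z); split=> //.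
  by rewrite mulf_neq0 ?invr_eq0 ?expfz_neq0.
pose w (x : F) : int := if x == 0 then 0 else (v x %/ g)%Z.
have wE x : x != 0 -> v x = w x * g%:Z.
  move=> x0; have [q qE] := gv x x0.
  by rewrite /w (negPf x0) qE mulzK // eqz_nat -lt0n.
have gI : injective (fun q : int => q * g%:Z).
  by apply: mulIf; rewrite eqz_nat -lt0n.
have wS x : x != 0 -> S x <-> 0 <= w x.
  by move=> x0; rewrite (vS x x0) wE // pmulr_lge0 // ltz_nat.
have wM x y : x != 0 -> y != 0 -> w (x * y) = w x + w y.
  move=> x0 y0; apply: gI; rewrite /= mulrDl -!wE ?mulf_neq0 //; exact: vM.
have wV x : x != 0 -> w x^-1 = - w x.
  by move=> x0; apply: gI; rewrite /= mulNr -!wE ?invr_eq0 //; apply: vV.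
have w0 : w 0 = 0 by rewrite /w eqxx.
have wD x y : x != 0 -> y != 0 -> x + y != 0 ->
  Num.min (w x) (w y) <= w (x + y).
  wlog xy : x y / w x <= w y.
    move=> H x0 y0 xy0; case: (leP (w x) (w y)) => [xy|/ltW yx].
      by have := H x y xy x0 y0 xy0; rewrite min_l.
    by have := H y x yx y0 x0; rewrite min_l // addrC => /(_ xy0).
  move=> x0 y0 xy0; rewrite min_l // -subr_ge0 -wV // -wM ?invr_eq0 //.
  apply/(wS _ _); first by rewrite mulf_neq0 ?invr_eq0.
  rewrite mulrDl mulfV //; apply: subringD => //; first exact: (subring1 rS).
  apply/(wS _ _); first by rewrite mulf_neq0 ?invr_eq0.
  by rewrite wM ?invr_eq0 // wV // subr_ge0.
have wC (c : k) : c != 0 -> w (kconst c) = 0.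
  move=> c0; have [c1 Sc Sci] := vunit_const c0; apply/eqP.
  rewrite eq_le; apply/andP; split; last exact/(wS _ c1).
  by rewrite -oppr_ge0 -wV //; apply/wS; rewrite ?invr_eq0.
have wU : exists2 x, x != 0 & w x = 1.
  by exists x1 => //; apply: gI; rewrite /= -wE // mul1r.
exists (Place w0 wM wD wC wU) => x /=; have [->|x0] := eqVneq x 0.
  by split=> [|_]; [left|apply: subring0].
split=> [/(wS _ x0)|[/eqP|/(wS _ x0)//]]; first by right.
by rewrite (negPf x0).
Qed.

End Discrete.
End ValuationRing.

(** * Existence of places *)

Section Chevalley.
Context {k : fieldType} {F : fieldExtType (ratfun k)}.
Local Notation kconst := (@kconst k F).
Implicit Types (R S : set F).

Definition adjoin S (x : F) : set F :=
  [set y | exists2 p : {poly F}, (forall i, S p`_i) & y = p.[x]].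

Lemma subring_natr S (b : bool) : subring S -> S b%:R.
Proof. by move=> rS; case: b; [apply: (subring1 rS)|apply: (subring0 rS)]. Qed.

Lemma adjoin_subring S x : subring S -> subring (adjoin S x).
Proof.
move=> rS; split=> [|y z [p Sp ->] [q Sq ->]|y z [p Sp ->] [q Sq ->]].
- by exists 1; rewrite ?hornerC // => i; rewrite coef1; apply: subring_natr.
- exists (p - q); last by rewrite !hornerE.
  by move=> i; rewrite coefB; apply: (subringB rS).
- exists (p * q); last by rewrite hornerM.
  move=> i; rewrite coefM; apply: (subring_sum rS) => j _.
  exact: (subringM rS).
Qed.

Lemma adjoin_mem S x y : subring S -> S y -> adjoin S x y.
Proof.
move=> rS Sy; exists y%:P; last by rewrite hornerC.
by move=> i; rewrite coefC; case: ifP => // _; apply: (subring0 rS).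
Qed.

Lemma adjoin_gen S x : subring S -> adjoin S x x.
Proof.
move=> rS; exists 'X; last by rewrite hornerX.
by move=> i; rewrite coefX; apply: subring_natr.
Qed.

(** Multiplying z = p(1/z) by z^m, with m the size of p, gives a monic equation of degree m + 1. *)
Lemma integral_of_adjoin_inv S (z : F) : subring S -> z != 0 ->
  adjoin S z^-1 z -> integral_over S z.
Proof.
move=> rS z0 [p Sp zp]; set m := size p.
pose r := \sum_(i < m) p`_i *: 'X^(m - i) : {poly F}.
have sr : (size r <= m.+1)%N.
  apply: leq_trans (size_sum _ _ _) _; apply/bigmax_leqP => i _.
  apply: leq_trans (size_scale_leq _ _) _.
  by rewrite size_polyXn ltnS leq_subr.
exists ('X^(m.+1) - r).
  rewrite monicE lead_coefDl ?lead_coefXn // size_polyN size_polyXn.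
  by rewrite ltnS.
split=> [i|].
  rewrite coefB coefXn coef_sum; apply: (subringB rS);
    first exact: subring_natr.
  apply: (subring_sum rS) => j _; rewrite coefZ coefXn.
  by apply: (subringM rS) => //; apply: subring_natr.
rewrite !hornerE horner_sum; apply/eqP; rewrite subr_eq0; apply/eqP.
rewrite exprSr {2}zp horner_coef mulr_sumr; apply: eq_bigr => i _.
rewrite hornerZ hornerXn exprVn mulrCA; congr (_ * _).
have zm : z ^+ m = z ^+ (m - i) * z ^+ i by rewrite -exprD subnK // ltnW.
by rewrite zm mulfK ?expf_neq0.
Qed.

(* Chevalley's argument: in a maximal subring avoiding z, relations expressing
   z as polynomials in x and in 1/x can be played against each other to
   decrease their degrees. *)
Lemma reduce_relation S (z x : F) (p q : {poly F}) :
  subring S -> S z^-1 -> ~ S z ->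
  (forall s, S s -> S (1 - z^-1 * s)^-1) ->
  (forall i, S p`_i) -> (forall i, S q`_i) -> x != 0 ->
  p.[x] = z -> q.[x^-1] = z -> (size q <= size p)%N ->
  exists p' : {poly F}, [/\ forall i, S p'`_i,
    p'.[x] = z & (size p' < size p)%N].
Proof.
move=> rS Szi nSz unitS Sp Sq x0 px qx qp.
have z0 : z != 0 by apply: contra_notN nSz => /eqP->; apply: (subring0 rS).
(* Divided by z, the relation z = q(1/x) says that u is the sum of the (q_i / z) x^-i over i > 0,
   and u is invertible in S by [unitS]. *)
pose u := 1 - z^-1 * q`_0.
have u0 : u != 0.
  apply: contra_notN nSz; rewrite subr_eq0 => /eqP E.
  by rewrite -[z]mulr1 E mulVKf.
have qpos : (0 < size q)%N.
  rewrite size_poly_gt0; apply: contraNneq z0 => q0.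
  by rewrite -qx q0 horner0.
have p1 : (1 < size p)%N.
  rewrite ltnNge; apply/negP => /size1_polyC pC; apply: nSz.
  by rewrite -px pC hornerC.
pose m := (size p).-1; have mE : size p = m.+1 by rewrite prednK // ltnW.
(* x^m = (1/u) sum_(0 < i) (q_i / z) x^(m - i) *)
have xm : x ^+ m = \sum_(i < (size q).-1) u^-1 * z^-1 * q`_i.+1 *
  x ^+ (m - i.+1).
  apply: (mulfI u0); rewrite mulr_sumr.
  transitivity (\sum_(i < (size q).-1) z^-1 * q`_i.+1 * (x^-1) ^+ i.+1 *
    x ^+ m).
    rewrite -mulr_suml; congr (_ * _).
    have : z^-1 * q.[x^-1] = 1 by rewrite qx mulVf.
    rewrite horner_coef; case: (size q) qpos => //= d _.
    rewrite big_ord_recl /= expr0 mulr1 mulrDr => E.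
    have -> : u = z^-1 * \sum_(i < d) q`_i.+1 * x^-1 ^+ i.+1.
      by rewrite /u -E addrAC subrr add0r.
    by rewrite mulr_sumr; apply: eq_bigr => i _; rewrite mulrA.
  apply: eq_bigr => i _; rewrite !mulrA mulfV // mul1r -!mulrA;
    congr (_ * (_ * _)).
  have im : (i.+1 <= m)%N.
    by apply: leq_trans (ltn_ord i) _; rewrite -ltnS -mE prednK.
  have -> : x ^+ m = x ^+ i.+1 * x ^+ (m - i.+1) by rewrite -exprD subnKC.
  by rewrite mulrA -exprMn mulVf // expr1n mul1r.
(* The leading term p_m x^m is replaced by a combination of lower powers of x, which is [s]; [r] is
   the rest of p. *)
pose r := \sum_(i < m) p`_i *: 'X^i : {poly F}.
pose s := \sum_(i < (size q).-1) (p`_m * (u^-1 * z^-1 * q`_i.+1))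
  *: 'X^(m - i.+1) : {poly F}.
have Sui : S u^-1 by apply: unitS.
exists (r + s); split.
- move=> i; rewrite coefD !coef_sum; apply: (subringD rS);
  apply: (subring_sum rS) => j _; rewrite coefZ coefXn;
  (apply: (subringM rS); last exact: subring_natr) => //.
  by do ?[exact: Sq|apply: (subringM rS)|].
- rewrite -[RHS]px hornerD !horner_sum horner_coef mE big_ord_recr /=.
  congr (_ + _); first by apply: eq_bigr => i _; rewrite !hornerE.
  rewrite xm mulr_sumr; apply: eq_bigr => i _.
  by rewrite hornerZ hornerXn !mulrA.
- rewrite mE ltnS (leq_trans (size_polyD _ _)) // geq_max; apply/andP; split;
  (apply: leq_trans (size_sum _ _ _) _; apply/bigmax_leqP => i _;
  apply: leq_trans (size_scale_leq _ _) _; rewrite size_polyXn) => //.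
  rewrite -subSn; last first.
    by apply: leq_trans (ltn_ord i) _; rewrite -ltnS -mE prednK.
  by rewrite subSS leq_subr.
Qed.

(** By maximality, z is a polynomial over S in any element outside S. If x and 1/x were both
    outside, the two resulting expressions for z would reduce each other forever. *)
Lemma maximal_avoiding_valuation S (z : F) : subring S -> S z^-1 -> ~ S z ->
  (forall S', subring S' -> (S `<=` S')%classic -> ~ S' z ->
    (S' `<=` S)%classic) ->
  forall x, S x \/ S x^-1.
Proof.
move=> rS Szi nSz maxS x.
have z0 : z != 0 by apply: contra_notN nSz => /eqP->; apply: (subring0 rS).
have adjS y : ~ S y -> adjoin S y z.
  move=> nSy; apply: contrapT => nz; apply: nSy.
  apply: (maxS (adjoin S y)) => //; first exact: adjoin_subring.
    by move=> t; apply: adjoin_mem.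
  exact: adjoin_gen.
(* If u^-1 were outside S, then z would be a polynomial in u^-1, so z u^m would lie in S for some m.
   As z u = z - s, the elements z and z u^m agree modulo S, which would put z into S. *)
have unitS s : S s -> S (1 - z^-1 * s)^-1.
  move=> Ss; set u := 1 - _; apply: contrapT => /adjS[p Sp zp].
  have Su : S u.
    by apply: (subringB rS); [apply: (subring1 rS)|apply: (subringM rS)].
  have u0 : u != 0.
    apply: contra_notN nSz; rewrite subr_eq0 => /eqP E.
    by rewrite -[z]mulr1 E mulVKf.
  pose m := size p.
  have Sz : S (z * u ^+ m).
    rewrite zp horner_coef mulr_suml; apply: (subring_sum rS) => i _.
    have -> : u ^+ m = u ^+ i * u ^+ (m - i) by rewrite -exprD subnKC // ltnW.
    rewrite -mulrA; apply: (subringM rS) => //.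
    by rewrite mulrA -exprMn mulVf // expr1n mul1r; apply: (subringX rS).
  have [t St zE] : exists2 t, S t & z = z * u ^+ m + t.
    elim: (m) => [|j [t St tE]]; first by exists 0; rewrite ?mulr1 ?addr0 //;
      apply: (subring0 rS).
    exists (t + s * u ^+ j).
      by apply: (subringD rS) => //; apply: (subringM rS) => //;
        apply: (subringX rS).
    have zu : z * u = z - s by rewrite mulrBr mulr1 mulVKf.
    by rewrite {1}tE exprS mulrA zu; ring.
  by apply: nSz; rewrite zE; apply: (subringD rS).
apply: contrapT => /not_orP[nSx nSxi].
have x0 : x != 0 by apply: contra_notN nSx => /eqP->; apply: (subring0 rS).
have [p Sp px] := adjS _ nSx; have [q Sq qx] := adjS _ nSxi.
have [n] := ubnP (size p + size q)%N.
elim: n p q Sp px Sq qx => // n IH p q Sp px Sq qx pqn.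
have [qp|/ltnW pq] := leqP (size q) (size p).
  have [p' [Sp' px' p'p]] :=
    reduce_relation rS Szi nSz unitS Sp Sq x0 (esym px) (esym qx) qp.
  by apply: (IH p' q) => //; lia.
have [|q' [Sq' qx' q'q]] :=
  reduce_relation rS Szi nSz unitS Sq Sp (invr_neq0 x0) (esym qx) _ pq.
  by rewrite invrK.
by apply: (IH p q') => //; lia.
Qed.

(** Since z is not integral, R[1/z] does not contain z. A maximal subring that contains R and 1/z
    but avoids z is a valuation ring, to which [discrete_valuation] applies. *)
Theorem place_exists R (z : F) : subring R -> (forall c, R (kconst c)) ->
  ~ integral_over R z ->
  exists P : place F, (forall x, R x -> x = 0 \/ 0 <= P x) /\ P z < 0.
Proof.
move=> rR kR nz.
have z0 : z != 0.
  apply: contra_notN nz => /eqP->; exists 'X; rewrite ?monicX // hornerX;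
    split=> // i.
  by rewrite coefX; apply: subring_natr.
pose good S := [/\ subring S, (R `<=` S)%classic, S z^-1 & ~ S z].
have [|A [PA Amax]] := @Zorn_bigcup F [set S | S = set0 \/ good S]%classic.
  move=> C CP totC; have [[S0 CS0 gS0]|nC] := EM (exists2 S, C S & good S);
    last first.
    left; rewrite -subset0 => x [S CS Sx].
    by have [S0|gS] := CP S CS; [rewrite -S0|case: nC; exists S].
  right; have [rS0 RS0 Sz0 nS0] := gS0.
  have gS S x : C S -> S x -> good S.
    by move=> CS Sx; have [S00|//] := CP S CS; rewrite S00 in Sx.
  have both x y : (\bigcup_(X in C) X)%classic x ->
    (\bigcup_(X in C) X)%classic y ->
    exists2 S, C S & [/\ good S, S x & S y].
    move=> [S CS Sx] [T CT Ty]; have [ST|TS] := totC _ _ CS CT.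
      by exists T => //; split=> //; [apply: gS Ty|apply: ST].
    by exists S => //; split=> //; [apply: gS Sx|apply: TS].
  split.
  - split; first by exists S0 => //; apply: (subring1 rS0).
      move=> x y /both H /H[S CS [[rS _ _ _] Sx Sy]]; exists S => //.
      exact: (subringB rS).
    move=> x y /both H /H[S CS [[rS _ _ _] Sx Sy]]; exists S => //.
    exact: (subringM rS).
  - by move=> x Rx; exists S0 => //; apply: RS0.
  - by exists S0.
  - by move=> [S CS Sz]; have [_ _ _] := gS S z CS Sz.
have gR : good (adjoin R z^-1).
  split; [exact: adjoin_subring|by move=> x;
    apply: adjoin_mem|exact: adjoin_gen|].
  by move=> /integral_of_adjoin_inv; apply: contra_not nz => H; apply: H.
have gA : good A.
  case: PA => // A0; have [] := Amax (adjoin R z^-1); last by right.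
  rewrite A0; split=> // /(_ z^-1); apply; exact: adjoin_gen.
have [rA RA Azi nAz] := gA.
have maxA S' : subring S' -> (A `<=` S')%classic -> ~ S' z ->
  (S' `<=` A)%classic.
  move=> rS' AS' nz'; apply: contrapT => nS'A; apply: (Amax S'); first by split.
  by right; split=> //; [apply: subset_trans AS'|apply: AS'].
have valA := maximal_avoiding_valuation rA Azi nAz maxA.
have [P PA'] := discrete_valuation rA (fun c => RA _ (kR c))
  valA (ex_intro _ z nAz).
exists P; split=> [x /RA /PA'//|].
by rewrite ltNge; apply/negP => Pz; apply: nAz; apply/PA'; right.
Qed.

End Chevalley.

(** * Places *)

Section Places.
Context {k : fieldType} {F : fieldExtType (ratfun k)}.
Local Notation kconst := (@kconst k F).
Implicit Types (P Q : place F) (x y : F).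

HB.instance Definition _ := GRing.RMorphism.copy kconst
  ((in_alg F \o @FracField.tofrac {poly k}) \o polyC).

(* P x >= m, with the convention P 0 = +oo. *)
Definition vge P (m : int) : set F := [set x | x = 0 \/ m <= P x].

Lemma vgeE P m x : x != 0 -> vge P m x <-> m <= P x.
Proof. by move=> x0; split=> [[/eqP|//]|]; [rewrite (negPf x0)|right]. Qed.

Lemma vge0 P m : vge P m 0. Proof. by left. Qed.

Lemma vgeD P m x y : vge P m x -> vge P m y -> vge P m (x + y).
Proof.
have [->|x0] := eqVneq x 0; first by rewrite add0r.
have [->|y0] := eqVneq y 0; first by rewrite addr0.
move=> /(vgeE _ _ x0) mx /(vgeE _ _ y0) my.
have [->|xy0] := eqVneq (x + y) 0; first exact: vge0.
right; apply: le_trans (val_atD P x0 y0 xy0).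
by rewrite le_min mx my.
Qed.

Lemma vgeM P m n x y : vge P m x -> vge P n y -> vge P (m + n) (x * y).
Proof.
have [->|x0] := eqVneq x 0; first by rewrite mul0r; left.
have [->|y0] := eqVneq y 0; first by rewrite mulr0; left.
move=> /(vgeE _ _ x0) mx /(vgeE _ _ y0) my.
by right; rewrite val_atM // lerD.
Qed.

Lemma vge_le P m n x : n <= m -> vge P m x -> vge P n x.
Proof. by move=> nm [->|mx]; [left|right; apply: le_trans mx]. Qed.

Lemma val_at1 P : P 1 = 0.
Proof. by apply: (@addrI _ (P 1)); rewrite -val_atM ?oner_eq0 // mulr1 addr0.
  Qed.

Lemma val_atV P x : P x^-1 = - P x.
Proof.
have [->|x0] := eqVneq x 0; first by rewrite invr0 val_at0.
by apply: (@addrI _ (P x));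
  rewrite -val_atM ?invr_eq0 // mulfV // val_at1 subrr.
Qed.

Lemma val_atX P x n : P (x ^+ n) = P x * n%:Z.
Proof.
have [->|x0] := eqVneq x 0.
  by rewrite expr0n; case: n => [|n]; rewrite ?val_at1 ?val_at0 ?mulr0 ?mul0r.
elim: n => [|n IH]; first by rewrite expr0 val_at1 mulr0.
by rewrite exprS val_atM ?expf_neq0 // IH intS mulrDr mulr1.
Qed.

Lemma val_atXz P x (n : int) : P (x ^ n) = P x * n.
Proof.
case: n => n; first exact: val_atX.
by rewrite NegzE -exprnN val_atV val_atX mulrN.
Qed.

Lemma val_atN P x : P (- x) = P x.
Proof.
have [->|x0] := eqVneq x 0; first by rewrite oppr0.
rewrite -mulN1r val_atM ?oppr_eq0 ?oner_eq0 //.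
have : P ((-1) ^+ 2) = 0 by rewrite sqrrN expr1n val_at1.
by rewrite val_atX; lia.
Qed.

Lemma vgeN P m x : vge P m x -> vge P m (- x).
Proof. by move=> [->|mx]; [left; rewrite oppr0|right; rewrite val_atN]. Qed.

Lemma vgeB P m x y : vge P m x -> vge P m y -> vge P m (x - y).
Proof. by move=> mx my; apply: vgeD => //; apply: vgeN. Qed.

Lemma vge_const P c : vge P 0 (kconst c).
Proof.
have [->|c0] := eqVneq c 0; first by left; rewrite -polyFC polyC0 rmorph0.
by right; rewrite val_at_const.
Qed.

Lemma vge1 P : vge P 0 1. Proof. by right; rewrite val_at1. Qed.

Lemma vge_subring P : subring (vge P 0).
Proof.
split=> [|x y|x y Px Py]; [exact: vge1|exact: vgeB|].
by rewrite -[0]addr0; apply: vgeM.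
Qed.

Lemma vge_strict P x y : x != 0 -> vge P (P x + 1) y ->
  x + y != 0 /\ P (x + y) = P x.
Proof.
move=> x0 [->|yx]; first by rewrite addr0.
have xy : P x < P y by lia.
have y0 z : z + y = 0 -> P z < P y -> False.
  by move/eqP; rewrite addr_eq0 => /eqP->; rewrite val_atN ltxx.
have xy0 : x + y != 0 by apply/eqP => /y0; apply.
split=> //; have [y00|yn0] := eqVneq y 0; first by rewrite y00 addr0.
apply/eqP; rewrite eq_le; apply/andP; split; last first.
  by apply: le_trans (val_atD P x0 yn0 xy0); rewrite le_min lexx ltW.
have := @val_atD _ _ P (x + y) (- y) xy0; rewrite addrK val_atN oppr_eq0.
by move=> /(_ yn0 x0); rewrite ge_min => /orP[//|]; rewrite leNgt xy.
Qed.

Lemma base_constants_subfield : subfield (@base_constants k F).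
Proof.
split=> [|_ _ [a _ <-] [b _ <-]|_ _ [a _ <-] [b _ <-]|_ [a _ <-]].
- by exists 1 => //; rewrite -polyFC rmorph1.
- by exists (a - b) => //; rewrite -!polyFC polyCB rmorphB.
- by exists (a * b) => //; rewrite -!polyFC polyCM rmorphM.
exists a^-1 => //; have [->|a0] := eqVneq a 0.
  by rewrite invr0 -!polyFC polyC0 rmorph0 invr0.
have ka0 : kconst a != 0 by rewrite -polyFC polyF_eq0 polyC_eq0.
apply: (mulfI ka0); rewrite mulfV // -!polyFC -rmorphM -polyCM mulfV //.
exact: rmorph1.
Qed.

Lemma vge_submodule P m : submodule base_constants (vge P m).
Proof.
split=> [|x y|_ x [c _ <-] Px]; [exact: vge0|exact: vgeD|].
by rewrite -[m]add0r; apply: vgeM => //; apply: vge_const.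
Qed.

Lemma place_ringE P : place_ring P = vge P 0. Proof. by []. Qed.

Lemma place_idealE P : place_ideal P = vge P 1.
Proof.
by apply/seteqP; split=> x [->|Px]; [left|right|left|right].
Qed.

Lemma place_eq P Q : (forall x, P x = Q x) -> P = Q.
Proof.
case: P Q => [p p0 pM pD pC pU] [q q0 qM qD qC qU] /= /funext E.
by case: q / E in q0 qM qD qC qU *; congr Place; apply: Prop_irrelevance.
Qed.

Lemma integral_vge P (R : set F) x :
  (forall y, R y -> vge P 0 y) -> integral_over R x -> vge P 0 x.
Proof.
move=> RP xi; have [->|x0] := eqVneq x 0; first exact: vge0.
have [Px|xneg] := leP 0 (P x); first by right.
apply: integral_inv_mem; first exact: vge_subring.
  by right; rewrite val_atV oppr_ge0 ltW.
exact: integral_overS xi.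
Qed.

Lemma algebraic_integral x : algebraicOver kconst x ->
  integral_over (@base_constants k F) x.
Proof.
move=> /integral_algebraic.
move=> [p mp px]; exists (map_poly kconst p).
  exact: monic_map.
split; last by apply/rootP.
by move=> i; rewrite coef_map; exists p`_i.
Qed.

(** For x nonzero, both x and x^-1 are integral over k, hence in the ring of P. *)
Lemma algebraic_val P x : algebraicOver kconst x -> P x = 0.
Proof.
have [->|x0] := eqVneq x 0; first by rewrite val_at0.
have H y : algebraicOver kconst y -> vge P 0 y.
  move=> /algebraic_integral; apply: integral_vge => _ [c _ <-].
  exact: vge_const.
move=> ax; apply/eqP; rewrite eq_le -oppr_ge0 -val_atV.
apply/andP; split; last by apply/(vgeE _ _ x0)/H.
apply/vgeE; rewrite ?invr_eq0 //; apply: H.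
exact: algebraic_inv.
Qed.

Lemma integral_algebraic_const x :
  integral_over (@base_constants k F) x -> algebraicOver kconst x.
Proof.
move=> [p mp [Cp px]].
have /choice[c cE] i : exists c, kconst c = p`_i by have [c _ cE] := Cp i;
  exists c.
pose q := \poly_(i < size p) c i.
have qp : map_poly kconst q = p.
  apply/polyP => i; rewrite coef_map coef_poly; case: ltnP => [_|sp];
    first exact: cE.
  by rewrite nth_default //; apply: (rmorph0 kconst).
exists q; last by apply/rootP; rewrite qp.
by apply: contraNneq (monic_neq0 mp) => q0; rewrite -qp q0 rmorph0.
Qed.

End Places.

(** * Weak approximation *)

Section Approximation.
Context {k : fieldType} {F : fieldExtType (ratfun k)}.
Local Notation C := (@base_constants k F).
Implicit Types (P Q : place F) (x y : F) (s : seq (place F)).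

(** If the ring of P were contained in that of Q, then Q would vanish on the units at P and be the
    multiple of P by Q pi. As Q takes the value 1, this factor would be 1. *)
Lemma places_incomparable P Q : P != Q -> exists x, [/\ x != 0,
  0 <= P x & Q x < 0].
Proof.
move=> PQ; apply: contrapT => H; case/eqP: PQ; apply/place_eq.
have ge x : x != 0 -> 0 <= P x -> 0 <= Q x.
  by move=> x0 Px; rewrite leNgt; apply/negP => Qx; case: H; exists x.
have eq0 x : x != 0 -> P x = 0 -> Q x = 0.
  move=> x0 Px; apply/eqP; rewrite eq_le ge ?Px // andbT.
  by rewrite -oppr_ge0 -val_atV ge ?invr_eq0 // val_atV Px.
have [pi pi0 Ppi] := val_at_unif P.
have QE x : x != 0 -> Q x = P x * Q pi.
  move=> x0; have /eq0 : x / pi ^ (P x) != 0 by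
    rewrite mulf_neq0 ?invr_eq0 ?expfz_neq0.
  rewrite !val_atM ?invr_eq0 ?expfz_neq0 // !val_atV !val_atXz Ppi mul1r subrr.
  by move=> /(_ erefl)/eqP; rewrite subr_eq0 mulrC => /eqP.
have [y y0 Qy] := val_at_unif Q.
have Qpi : 0 <= Q pi by apply: ge; rewrite ?Ppi.
have Q1 : Q pi = 1.
  have := QE y y0; rewrite Qy; move: Qpi; move: (Q pi) (P y) => q p q0 E.
  have [p0|p0] := leP p 0; first by nia.
  have [q1|q1] := leP q 1; first by nia.
  by nia.
move=> x; have [->|x0] := eqVneq x 0; first by rewrite !val_at0.
by rewrite QE // Q1 mulr1.
Qed.

Lemma separate2 P Q : P != Q -> exists x, 0 < P x /\ Q x < 0.
Proof.
move=> PQ; have [x [x0 Px Qx]] := places_incomparable PQ.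
have [|y [y0 Qy Py]] := places_incomparable (P := Q) (Q := P);
  first by rewrite eq_sym.
exists (x / y); rewrite !val_atM ?invr_eq0 // !val_atV; split; lia.
Qed.

Lemma seq_bound s (f : place F -> int) : exists m : nat, forall P, P \in s ->
  `|f P| < m%:Z.
Proof.
elim: s => [|Q s [m Hm]]; first by exists 0.
exists (m + `|f Q|).+1%N => P; rewrite inE => /predU1P[->|/Hm]; lia.
Qed.

(** By induction y serves all places but Q, and z separates P from Q. If y is not already negative
    at Q, take z^(m+1) + y, where m bounds all |R y|: its two terms have different values at every
    place of the enlarged list, so no cancellation occurs. *)
Lemma separate P s : P \notin s -> exists x, 0 < P x /\ forall Q, Q \in s ->
  Q x < 0.
Proof.
elim: s => [|Q s IH]; first by have [x _ Px] := val_at_unif P; exists x;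
  rewrite Px.
rewrite inE negb_or => /andP[PQ /IH[y [Py sy]]].
have [Qy|Qy] := ltP (Q y) 0.
  by exists y; split=> // R; rewrite inE => /predU1P[->|/sy].
have [z [Pz Qz]] := separate2 PQ.
have z0 : z != 0 by apply: contraTneq Pz => ->; rewrite val_at0.
have y0 : y != 0 by apply: contraTneq Py => ->; rewrite val_at0.
have [m Hm] := seq_bound s (fun P => P y).
have Qx : Q (z ^+ m.+1 + y) < 0.
  have [|_ ->] := @vge_strict _ _ Q (z ^+ m.+1) y (expf_neq0 _ z0).
    by right; rewrite val_atX; nia.
  by rewrite val_atX; nia.
exists (z ^+ m.+1 + y); split.
  have x0 : z ^+ m.+1 + y != 0 by apply: contraTneq Qx => ->; rewrite val_at0.
  have /(vgeE _ _ x0) : vge P 1 (z ^+ m.+1 + y).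
    by apply: vgeD; right; rewrite ?val_atX; nia.
  by [].
move=> R; rewrite inE => /predU1P[->//|Rs].
have := sy R Rs; have := Hm R Rs => Rm Ry.
have [Rz|Rz] := leP 0 (R z).
  rewrite addrC; have [|_ ->//] := @vge_strict _ _ R y (z ^+ m.+1) y0.
  by right; rewrite val_atX; nia.
have [|_ ->] := @vge_strict _ _ R (z ^+ m.+1) y (expf_neq0 _ z0).
  by right; rewrite val_atX; nia.
by rewrite val_atX; nia.
Qed.

Lemma approximate_one P s (N : nat) : P \notin s ->
  exists w, vge P N (w - 1) /\ forall Q, Q \in s -> vge Q N w.
Proof.
move=> /separate[x [Px sx]]; pose M := N.+1.
have x0 : x != 0 by apply: contraTneq Px => ->; rewrite val_at0.
have xM0 : x ^+ M != 0 by rewrite expf_neq0.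
have [|u0 Pu] := @vge_strict _ _ P 1 (x ^+ M) (oner_neq0 _).
  by right; rewrite val_at1 val_atX; nia.
(* As x has a zero at P and poles on s, 1 / (1 + x^M) is close to 1 at P and to 0 on s. *)
exists (1 + x ^+ M)^-1; split.
  have -> : (1 + x ^+ M)^-1 - 1 = - (x ^+ M / (1 + x ^+ M)).
    apply: (mulIf u0); rewrite mulrBl mulNr divfK // mulVf // mul1r.
    by rewrite opprD addNKr.
  apply: vgeN; right; rewrite val_atM ?invr_eq0 // val_atV Pu val_at1 val_atX /M.
  nia.
move=> Q /sx Qx; right; rewrite val_atV addrC.
have [|_ ->] := @vge_strict _ _ Q (x ^+ M) 1 xM0.
  by right; rewrite val_at1 val_atX /M; nia.
by rewrite val_atX /M; nia.
Qed.

Lemma approximate P s y (N : nat) : P \notin s ->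
  exists z, vge P N (z - y) /\ forall Q, Q \in s -> vge Q N z.
Proof.
move=> Ps; have [m Hm] := seq_bound (P :: s) (fun P => P y).
have [w [Pw sw]] := @approximate_one P s (N + m) Ps.
have Hy Q : Q \in P :: s -> vge Q (- m%:Z) y by move=> /Hm Qm; right; lia.
exists (w * y); split.
  rewrite -{2}[y]mul1r -mulrBl; apply: vge_le (vgeM Pw (Hy P _)); last first.
    by rewrite inE eqxx.
  lia.
move=> Q Qs; apply: vge_le (vgeM (sw Q Qs) (Hy Q _));
  last by rewrite inE Qs orbT.
lia.
Qed.

Definition vge_on s (E : place F -> nat) : set F :=
  [set z | forall P, P \in s -> vge P (E P) z].

Lemma vge_on_submodule s E : submodule C (vge_on s E).
Proof.
split=> [P _|x y sx sy P Ps|c x Cc sx P Ps]; first exact: vge0.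
  by apply: vgeD; [apply: sx|apply: sy].
by apply: (submodM (vge_submodule P _)) => //; apply: sx.
Qed.

(* One adds a place of s at a time: by approximation, a residue basis at P lifts
   to elements divisible by high powers of the other places. *)
Lemma free_mod_approx s (E f : place F -> nat) : uniq s ->
  (forall P, P \in s -> exists b : 'I_(f P) -> F,
     (forall i, vge P 0 (b i)) /\ free_mod C (vge P 1) b) ->
  exists (I : finType) (w : I -> F),
    [/\ forall i, vge_on s (fun=> 0%N) (w i), free_mod C (vge_on s E) w
      & #|I| = \sum_(P <- s) E P * f P]%N.
Proof.
move=> us sb; have [t] := ubnP (\sum_(P <- s) E P)%N; elim: t E => // t IH E Et.
have [/hasP[P Ps EP]|/hasPn E0] := boolP (has (fun P => 0 < E P)%N s);
  last first.
  exists void, (@of_void F); split=> [[]|c _ _ []|].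
  rewrite card_void big_seq big1 // => P /E0.
  by rewrite -eqn0Ngt => /eqP->.
(* Lowering the exponent at P by one splits off a layer that multiplication by pi^(E' P) identifies
   with the residue space at P. *)
pose E' Q := if Q == P then (E P).-1 else E Q.
have E'P : E' P = (E P).-1 by rewrite /E' eqxx.
have E'E (g : place F -> nat) : (\sum_(Q <- s) E Q * g Q = \sum_(Q <- s) E' Q *
  g Q + g P)%N.
  rewrite (bigD1_seq P) //= [in RHS](bigD1_seq P) //= E'P.
  rewrite (eq_bigr (fun Q => E' Q * g Q)%N); last by move=> Q /negPf QP;
    rewrite /E' QP.
  by rewrite -{1}(prednK EP) mulSn; lia.
have [|I [w [w0 fw Iw]]] := IH E'.
  have := E'E (fun=> 1%N); rewrite -!big_distrl /= !muln1 => E1.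
  by rewrite E1 in Et; lia.
have [b [b0 fb]] := sb P Ps.
have [pi pi0 Ppi] := val_at_unif P.
have [N HN] := seq_bound s (fun P => (E P)%:Z).
have HN' Q : Q \in s -> ((E Q)%:Z <= N%:Z) by move=> /HN; lia.
have /choice[u uP] j : exists u, vge P N (u - b j * pi ^ (E' P)) /\
    forall Q, Q \in rem P s -> vge Q N u.
  by apply: approximate; rewrite mem_rem_uniqF.
have uQ j Q : Q \in s -> Q != P -> vge Q (E Q) (u j).
  move=> Qs QP; apply: vge_le (HN' Q Qs) _; apply: (uP j).2.
  by rewrite mem_rem_uniq // inE QP.
have uE' j : vge_on s E' (u j).
  move=> Q Qs; rewrite /E'; case: eqVneq => [->|QP]; last exact: uQ.
  rewrite -[u j](subrK (b j * pi ^ (E' P))); apply: vgeD.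
    by apply: vge_le (uP j).1; have := HN' P Ps; lia.
  rewrite -[X in vge P X]add0r; apply: vgeM => //; right.
  by rewrite val_atXz Ppi mul1r E'P.
have fu : free_mod C (vge_on s E) u.
  move=> c Cc /(_ P Ps) Pu; apply: fb => //.
  have piE : pi ^ (E' P) != 0 by rewrite expfz_neq0.
  have : vge P (E P) (\sum_j c j * (b j * pi ^ (E' P))).
    have -> : \sum_j c j * (b j * pi ^ (E' P)) = \sum_j c j * u j -
        \sum_j c j * (u j - b j * pi ^ (E' P)).
      by rewrite -sumrB; apply: eq_bigr => j _; ring.
    apply: vgeB => //; apply: (submod_comb (vge_submodule P _)) => // j.
    by apply: vge_le (HN' P Ps) (uP j).1.
  under eq_bigr => j _ do rewrite mulrA.
  rewrite -mulr_suml => Pb; rewrite -[X in vge P 1 X](mulfK piE).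
  have : vge P (- (E' P)%:Z) (pi ^ (E' P))^-1.
    by right; rewrite val_atV val_atXz Ppi mul1r.
  by move/(vgeM Pb); apply: vge_le; rewrite E'P; lia.
exists (I + 'I_(f P))%type, (fun x : I + 'I_(f P) => match x with inl i =>
  w i | inr j => u j end).
split.
- move=> [i|j] Q Qs; first exact: w0.
  by apply: vge_le (uE' j Q Qs).
- have EE' : (vge_on s E `<=` vge_on s E')%classic.
    move=> x sx Q Qs; apply: vge_le (sx Q Qs).
    by rewrite /E'; case: eqVneq => [->|//]; lia.
  exact: (free_mod_sum (base_constants_subfield (F := F)) EE'
    (vge_on_submodule s E') fw uE' fu).
- by rewrite card_sum card_ord Iw E'E.
Qed.

End Approximation.

(** * Degrees of places *)

Section DegreeBound.
Context {k : fieldType} {F : fieldExtType (ratfun k)}.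
Local Notation K := (ratfun k).
Local Notation kconst := (@kconst k F).
Local Notation C := (@base_constants k F).
Local Notation polyF := (@polyF k F).
Local Notation n := (\dim {:F}).
Implicit Types (P Q : place F) (x y : F) (s : seq (place F)).

Lemma base_constant c : C (kconst c). Proof. by exists c. Qed.

(** As x W lies in W', reducing a relation modulo W' leaves only its constant terms, which must
    vanish; then divide by x. So w is free over k[x]. *)
Lemma free_mod_powers (W W' : set F) (I : finType) (w : I -> F) x :
  x != 0 -> submodule C W -> submodule C W' ->
  (forall y, W y -> W' (x * y)) -> (W' `<=` W)%classic ->
  (forall i, W (w i)) -> free_mod C W' w ->
  forall m (c : I -> nat -> F), (forall i j, C (c i j)) ->
    \sum_(j < m) (\sum_i c i j * w i) * x ^+ j = 0 ->
    forall i j, (j < m)%N -> c i j = 0.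
Proof.
move=> x0 sW sW' xW W'W Ww fw; elim=> // m IH c Cc.
rewrite big_ord_recl expr0 mulr1.
have -> : \sum_(j < m) (\sum_i c i (lift ord0 j) * w i) * x ^+ lift ord0 j =
    x * (\sum_(j < m) (\sum_i c i j.+1 * w i) * x ^+ j).
  by rewrite mulr_sumr; apply: eq_bigr => j _; rewrite lift0 exprS mulrCA.
set t := \sum_(j < m) _ => E.
have Wt : W t.
  have WX l y : W y -> W (x ^+ l * y).
    move=> Wy; elim: l => [|l IHl]; first by rewrite expr0 mul1r.
    by rewrite exprS -mulrA; apply/W'W/xW.
  by apply: (submod_sum sW) => j _; rewrite mulrC; apply/WX/(submod_comb sW).
have c0 : forall i, c i 0%N = 0.
  apply: fw => //; rewrite (_ : \sum_i _ = - (x * t)); last first.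
    by apply/eqP; rewrite -addr_eq0; apply/eqP.
  by apply: (submodN (base_constants_subfield (F := F)) sW'); apply: xW.
have t0 : t = 0.
  move/eqP: E; rewrite big1 ?add0r ?mulf_eq0 ?(negPf x0); last first.
    by move=> i _; rewrite c0 mul0r.
  by move/eqP.
move=> i [|j] // jm; apply: (IH (fun i j => c i j.+1)) => //.
Qed.

Lemma common_denominator (J : finType) (y : J -> K) :
  exists2 c : {poly k}, c != 0 &
    forall j, exists a, y j * FracField.tofrac c = FracField.tofrac a.
Proof.
have /choice[d dP] j : exists d : {poly k}, d != 0 /\
    exists a, y j * FracField.tofrac d = FracField.tofrac a.
  have [a [b [b0 ->]]] := ratfun_frac (y j); exists b; split=> //; exists a.
  by rewrite divfK // tofrac_eq0.
exists (\prod_j d j); first by apply/prodf_neq0 => j _; case: (dP j).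
move=> j; have [_ [a aE]] := dP j.
exists (a * \prod_(i | i != j) d i).
by rewrite (bigD1 j) //= rmorphM mulrA aE -rmorphM.
Qed.

(** All [w i] lie in the span over k of the n M elements t^e v_l / c with e < M, where v is the
    chosen basis of F. *)
Lemma leq_free_poly_span (I : finType) (w : I -> F) (c : F) (q : I -> 'I_n ->
  {poly k}) M :
  c != 0 -> (forall i, w i * c = \sum_l polyF (q i l) * (vbasis {:F})`_l) ->
  (forall i l, (size (q i l) <= M)%N) -> free_mod C [set 0] w ->
  (#|I| <= n * M)%N.
Proof.
move=> c0 wE sq fw.
pose V := range w.
pose b (x : 'I_n * 'I_M) := polyF 'X ^+ x.2 * (vbasis {:F})`_x.1 / c.
have : span_mod C V [set 0] b.
  move=> _ [i _ <-]; exists (fun x : 'I_n * 'I_M => kconst (q i x.1)`_x.2).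
    by move=> x; apply: base_constant.
  apply/eqP; rewrite subr_eq0; apply/eqP; apply: (mulIf c0).
  rewrite wE mulr_suml -(pair_bigA _ (fun (l : 'I_n) (e : 'I_M)
    => kconst (q i l)`_e * b (l, e) * c)) /=.
  apply: eq_bigr => l _; rewrite polyF_sum mulr_suml.
  rewrite (big_ord_widen _ (fun e => kconst (q i l)`_e * polyF 'X ^+ e *
    (vbasis {:F})`_l) (sq i l)).
  rewrite big_mkcond /=; apply: eq_bigr => e _.
  case: ltnP => [_|se]; first by rewrite -!mulrA mulVf // mulr1.
  by rewrite nth_default // (rmorph0 kconst) !mul0r.
have Vw i : V (w i) by exists i.
have := leq_free_span (base_constants_subfield (F := F)) (submodule0 C) Vw fw.
by move=> H /H; rewrite card_prod !card_ord.
Qed.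

(* Growth argument: the elements [w i * h ^ j * u ^ (m - j)] with j < m are
   independent over k and their coordinates have degree at most d m + O(1). *)
Lemma leq_free_degree (W W' : set F) (I : finType) (w : I ->
  F) x (h u : {poly k}) d :
  h != 0 -> u != 0 -> (size h <= d.+1)%N -> (size u <= d.+1)%N ->
  x = polyF h / polyF u -> submodule C W -> submodule C W' ->
  (forall y, W y -> W' (x * y)) -> (W' `<=` W)%classic ->
  (forall i, W (w i)) -> free_mod C W' w -> (#|I| <= n * d)%N.
Proof.
move=> h0 u0 sh su xE sW sW' xW W'W Ww fw.
have pu0 : polyF u != 0 by rewrite polyF_eq0.
have x0 : x != 0 by rewrite xE mulf_neq0 ?invr_eq0 ?polyF_eq0.
have [c c0 cP] := common_denominator
  (fun z : I * 'I_n => coord (vbasis {:F}) z.2 (w z.1)).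
have /choice[q qP] := cP.
pose B := \max_z size (q z).
have key m : (#|I| * m.+1 <= n * (d * m + B))%N.
  have := @leq_free_poly_span (I * 'I_m.+1)%type
    (fun z => w z.1 * (polyF h ^+ z.2 * polyF u ^+ (m - z.2))) (polyF c)
    (fun z l => q (z.1, l) * (h ^+ z.2 * u ^+ (m - z.2))) (d * m + B).
  rewrite card_prod card_ord; apply.
  - by rewrite polyF_eq0.
  - move=> [i j] /=; rewrite mulrAC.
    rewrite {1}[w i](coord_vbasis (memvf _)) !mulr_suml; apply: eq_bigr => l _.
    have E : polyF (q (i, l)) = (coord (vbasis {:F}) l (w i))%:A * polyF c.
      by rewrite -[LHS]/(in_alg F (FracField.tofrac (q (i, l)))) -qP rmorphM.
    by rewrite !rmorphM !rmorphXn /= E -[_ *: _`_l]mulr_algl; ring.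
  - move=> [i j] l /=.
    apply: leq_trans (size_polyMleq _ _) _; rewrite -subn1 leq_subLR.
    apply: (@leq_trans (B + (d * m).+1)); last by lia.
    apply: leq_add; first exact: (leq_bigmax (i, l)).
    apply: leq_trans (size_polyMleq _ _) _.
    have := size_poly_exp_leq h j; have := size_poly_exp_leq u (m - j).
    have := ltn_ord j.
    move: (size (h ^+ j)) (size (u ^+ (m - j))) => s1 s2 jm H2 H1.
    have {H1 sh} : (s1 <= (d * j).+1)%N.
      apply: leq_trans H1 _; rewrite ltnS leq_mul2r; lia.
    have {H2 su} : (s2 <= (d * (m - j)).+1)%N.
      apply: leq_trans H2 _; rewrite ltnS leq_mul2r; lia.
    rewrite mulnBr; have : (d * j <= d * m)%N by rewrite leq_mul2l; lia.
    lia.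
  - move=> e Ce E [i j].
    have := free_mod_powers x0 sW sW' xW W'W Ww fw (m := m.+1)
      (c := fun i j => e (i, inord j)) (fun _ _ => Ce _).
    move=> /(_ _ i j (ltn_ord j)); rewrite inord_val; apply.
    apply: (mulIf (expf_neq0 m pu0)); rewrite mul0r -[RHS]E mulr_suml.
    under eq_bigr => l _ do rewrite -mulrA mulr_suml.
    rewrite exchange_big pair_bigA /=; apply: eq_bigr => -[i' j'] _ /=.
    rewrite inord_val -mulrA; congr (_ * (_ * _)).
    have um : polyF u ^+ m = polyF u ^+ j' * polyF u ^+ (m - j').
      by rewrite -exprD subnKC // -ltnS.
    by rewrite um mulrA -exprMn xE divfK.
(* If #|I| were at least n d + 1, the left side of [key] would grow faster in m than the right side;
   m = n B is already large enough for a contradiction. *)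
rewrite leqNgt; apply/negP => Nlt.
have := key (n * B)%N; rewrite leqNgt => /negP; apply.
have : ((n * d).+1 * (n * B).+1 <= #|I| * (n * B).+1)%N by
  rewrite leq_mul2r Nlt orbT.
apply: leq_trans; rewrite mulSn mulnS mulnDr mulnA; lia.
Qed.

Definition residue_dim P f := has_dim C (vge P 0) (vge P 1) f.

Lemma place_pole_exists : exists P, P (polyF 'X) < 0.
Proof.
have [|||P [_ PX]] := @place_exists _ _ C (polyF 'X); last by exists P.
- have [C1 CB CM _] := base_constants_subfield (F := F); by split.
- exact: base_constant.
move=> /integral_algebraic_const[q q0 /rootP].
have -> : (map_poly kconst q).[polyF 'X] = polyF q.
  rewrite (polyF_sum q) (@horner_coef_wide _ (size q)) ?size_map_poly //.
  by apply: eq_bigr => i _; rewrite coef_map.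
by move/eqP; rewrite polyF_eq0 (negPf q0).
Qed.

(** [f P] counts independent residues instead of being the degree of P, because finiteness of that
    degree is deduced from this inequality. In [leq_free_degree], W consists of the elements regular
    on s, and W' of those that vanish on s at least to the order of h / u. *)
Lemma sum_degree_leq s (f : place F -> nat) (h u : {poly k}) d :
  uniq s -> h != 0 -> u != 0 -> (size h <= d.+1)%N -> (size u <= d.+1)%N ->
  (forall P, P \in s -> 0 <= P (polyF h / polyF u)) ->
  (forall P, P \in s -> exists b : 'I_(f P) -> F,
     (forall i, vge P 0 (b i)) /\ free_mod C (vge P 1) b) ->
  (\sum_(P <- s) `|P (polyF h / polyF u)|%N * f P <= n * d)%N.
Proof.
move=> us h0 u0 sh su Px sb.
have [I [w [w0 fw <-]]] :=
  free_mod_approx (fun P => `|P (polyF h / polyF u)|%N) us sb.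
apply: (leq_free_degree h0 u0 sh su erefl (vge_on_submodule s _)
  (vge_on_submodule s _)
  _ _ w0 fw) => [y sy P Ps|y sy P Ps].
  rewrite -[X in vge P X]addr0; apply: vgeM; last exact: sy.
  by right; rewrite gez0_abs // Px.
by apply: vge_le (sy P Ps).
Qed.

(** Otherwise all nonzero elements of k(t) have value 0 at P, and F, being integral over k(t), has
    no element of negative value. *)
Lemma nonconst_val P : exists2 a : {poly k}, a != 0 & P (polyF a) != 0.
Proof.
apply: contrapT => H; have [y y0 Py] := val_at_unif P.
have Pa (a : {poly k}) : P (polyF a) = 0.
  have [->|a0] := eqVneq a 0; first by rewrite rmorph0 val_at0.
  by apply/eqP; apply: contrapT => /negP Pa; apply: H; exists a.
have Pc c : P (in_alg F c) = 0.
  have [a [b [b0 ->]]] := ratfun_frac c; rewrite rmorphM fmorphV.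
  have [->|a0] := eqVneq a 0; first by rewrite !rmorph0 mul0r val_at0.
  by rewrite val_atM ?invr_eq0 ?polyF_eq0 // val_atV !Pa.
have : vge P 0 y^-1.
  apply: integral_vge (field_elem_integral _) => _ [c _ <-].
  by right; rewrite Pc.
by rewrite vgeE ?invr_eq0 // val_atV Py.
Qed.

Lemma residue_dim_exists P : exists2 f, residue_dim P f & (0 < f)%N.
Proof.
have [a a0 Pa] := nonconst_val P.
(* One of a and 1/a has a zero at P. *)
have [h [u [h0 u0 Phu]]] : exists h u : {poly k},
    [/\ h != 0, u != 0 & 0 < P (polyF h / polyF u)].
  have [Pa0|Pa0] := ltP 0 (P (polyF a)).
    by exists a, 1; rewrite rmorph1 divr1 oner_eq0.
  exists 1, a; rewrite rmorph1 div1r oner_eq0 val_atV; split=> //.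
  by move: Pa Pa0; case: ltgtP => //; lia.
have [s0 s1] := (vge_submodule P 0, vge_submodule P 1).
have [|f ff _] := has_dim_bound (base_constants_subfield (F := F)) s0 s1
    (N := n * maxn (size h) (size u)).
- move=> d b b0 fb.
  have := @sum_degree_leq [:: P] (fun=> d) h u (maxn (size h) (size u))
    isT h0 u0.
  rewrite big_seq1 => H; apply: leq_trans (H _ _ _ _).
  + by rewrite leq_pmull // absz_gt0 gt_eqF.
  + by rewrite leqW // leq_maxl.
  + by rewrite leqW // leq_maxr.
  + by move=> Q; rewrite inE => /eqP->; apply: ltW.
  + by move=> Q; rewrite inE => /eqP->; exists b.
exists f => //; case: f ff => // -[b [_ _ sb]].
have [c _] := sb 1 (vge1 P); rewrite big_ord0 subr0 => /vgeE.
by rewrite oner_eq0 val_at1 => /(_ isT).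
Qed.

Definition resdeg P : nat := const_dim C (place_ring P) (place_ideal P).

Lemma resdegP P : residue_dim P (resdeg P).
Proof.
have [f ff _] := residue_dim_exists P; rewrite /resdeg place_ringE place_idealE.
exact: has_dim_const (base_constants_subfield (F := F)) (vge_submodule P 1) ff.
Qed.

Lemma resdeg_gt0 P : (0 < resdeg P)%N.
Proof.
have [f ff f0] := residue_dim_exists P.
by rewrite (has_dim_uniq (base_constants_subfield (F := F)) (vge_submodule P 1)
  (resdegP P) ff).
Qed.

Lemma sum_resdeg_leq s (h u : {poly k}) d :
  uniq s -> h != 0 -> u != 0 -> (size h <= d.+1)%N -> (size u <= d.+1)%N ->
  (forall P, P \in s -> 0 <= P (polyF h / polyF u)) ->
  (\sum_(P <- s) `|P (polyF h / polyF u)|%N * resdeg P <= n * d)%N.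
Proof.
move=> us h0 u0 sh su Px; apply: sum_degree_leq => // P _.
by have [b [b0 fb _]] := resdegP P; exists b.
Qed.

Lemma finite_enum (A : set (place F)) (N : nat) :
  (forall s, uniq s -> (forall P, P \in s -> A P) -> (size s <= N)%N) ->
  exists2 s, uniq s & forall P, A P <-> P \in s.
Proof.
move=> bd.
pose Q m := `[< exists s, [/\ uniq s, forall P, P \in s -> A P & size s = m] >].
have exQ : exists m, Q m by exists 0%N; apply/asboolP; exists [::].
have leQ m : Q m -> (m <= N)%N by move=> /asboolP[s [us sA <-]]; apply: bd.
case: (ex_maxnP exQ leQ) => m /asboolP[s [us sA sm]] mmax.
exists s => // P; split=> [AP|/sA//]; apply: contrapT => /negP Ps.
suff /mmax : Q m.+1 by rewrite ltnn.
apply/asboolP; exists (P :: s); rewrite /= Ps us sm; split=> // Q'.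
by rewrite inE => /predU1P[->//|/sA].
Qed.

(** Each zero contributes at least 1 to the sum bounded in [sum_resdeg_leq]. *)
Lemma zeros_finite (h u : {poly k}) : h != 0 -> u != 0 ->
  exists2 s, uniq s & forall P, 0 < P (polyF h / polyF u) <-> P \in s.
Proof.
move=> h0 u0; set d := maxn (size h) (size u).
apply: (@finite_enum (fun P => 0 < P (polyF h / polyF u)) (n * d)) => s us sP.
have : (\sum_(P <- s) `|P (polyF h / polyF u)|%N * resdeg P <= n * d)%N.
  apply: sum_resdeg_leq => //; last by move=> P /sP/ltW.
    by rewrite leqW // leq_maxl.
  by rewrite leqW // leq_maxr.
apply: leq_trans; rewrite -sum1_size big_seq [X in (_ <= X)%N]big_seq.
apply: leq_sum => P /sP Pp.
by rewrite muln_gt0 resdeg_gt0 absz_gt0 gt_eqF.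
Qed.

End DegreeBound.

(** * Riemann-Roch spaces *)

Section RiemannRochSpaces.
Context {k : fieldType} {F : fieldExtType (ratfun k)}.
Local Notation C := (@base_constants k F).
Implicit Types (P Q : place F) (beta : place F -> int) (s : seq (place F)).

Let subC := base_constants_subfield (F := F).

Definition rrspace beta : set F := [set z | forall P, vge P (- beta P) z].

Lemma rrspaceE (B : divisor F) : riemann_roch_space B = rrspace B.
Proof.
apply/seteqP; split=> [x [->|Bx] P|x Bx]; [exact: vge0|by right|].
have [->|x0] := eqVneq x 0; first by left.
by right=> P; apply/(vgeE _ _ x0)/Bx.
Qed.

Lemma rrspace_submodule beta : submodule C (rrspace beta).
Proof.
split=> [P|x y Bx By P|c x Cc Bx P]; [exact: vge0|exact: vgeD|].
exact: (submodM (vge_submodule P _)).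
Qed.

Lemma rrspace_le beta beta' : (forall P, beta P <= beta' P) ->
  (rrspace beta `<=` rrspace beta')%classic.
Proof. by move=> le x Bx P; apply: vge_le (Bx P); rewrite lerN2. Qed.

(** Multiplication by a power of a uniformizer at P0 embeds L(B + P0) / L(B) into the residue field
    at P0. *)
Lemma rrspace_step beta P0 l : has_dim C (rrspace beta) [set 0] l ->
  exists l', [/\ has_dim C (rrspace (fun Q => beta Q + (Q == P0)%:Z))
    [set 0] l',
    (l <= l')%N & (l' <= l + resdeg P0)%N].
Proof.
set beta' := fun Q => _ => hl; have [pi pi0 Ppi] := val_at_unif P0.
have bb' P : beta P <= beta' P by rewrite /beta'; case: (P == P0); lia.
have [|x Bx|x Bx|e he el] := has_dim_inj (phi := *%R^~ (pi ^ (beta' P0))) subC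
  (rrspace_submodule beta') (rrspace_submodule beta) (vge_submodule P0 1)
  _ _ _ (resdegP P0).
- exact: linear_over_mul.
- rewrite -[X in vge P0 X](addNr (beta' P0)); apply: vgeM; first exact: Bx.
  by right; rewrite val_atXz Ppi mul1r.
- move=> Px P; have [->|PP0] := eqVneq P P0; last first.
    by have := Bx P; rewrite /beta' (negPf PP0) addr0.
  have : vge P0 (- beta' P0) (pi ^ (beta' P0))^-1.
    by right; rewrite val_atV val_atXz Ppi mul1r.
  move/(vgeM Px); rewrite mulfK ?expfz_neq0 //; apply: vge_le.
  by rewrite /beta' eqxx; lia.
exists (e + l)%N; split; [|exact: leq_addl|by rewrite addnC leq_add2l].
apply: (has_dim_add subC _ _ (rrspace_submodule beta) he hl).
  by move=> _ -> P; apply: vge0.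
exact: rrspace_le.
Qed.

Lemma rrspace_mono s beta beta' l : uniq s ->
  (forall P, beta P <= beta' P) -> (forall P, P \notin s -> beta P = beta' P) ->
  has_dim C (rrspace beta) [set 0] l ->
  exists l', [/\ has_dim C (rrspace beta') [set 0] l', (l <= l')%N &
    l'%:Z <= l%:Z + \sum_(P <- s) (beta' P - beta P) * (resdeg P)%:Z].
Proof.
move=> us bb'; have [t] : exists t : nat, \sum_(P <- s) (beta' P - beta P)
  < t%:Z.
  by exists (absz (\sum_(P <- s) (beta' P - beta P))).+1; lia.
elim: t beta l bb' => [|t IH] beta l bb' bt boff hl.
  move: bt; rewrite ltNge sumr_ge0 // => P _; by rewrite subr_ge0.
have [/hasP[P Ps bP]|/hasPn E0] := boolP (has (fun P => beta P < beta' P) s);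
  last first.
  have -> : beta' = beta.
    apply/funext => P; have [Ps|Ps] := boolP (P \in s); last by rewrite boff.
    by apply/eqP; rewrite eq_le bb' andbT leNgt E0.
  exists l; split=> //; rewrite big1 ?addr0 // => P _.
  by rewrite subrr mul0r.
have [l1 [h1 l11 l12]] := rrspace_step P hl.
set beta1 := fun Q => _ in h1.
have b1 : (forall Q, beta1 Q <= beta' Q).
  by move=> Q; rewrite /beta1; case: eqVneq => [->|_]; have := bb' Q; lia.
have sumE (w : place F -> int) :
    \sum_(Q <- s) (beta' Q - beta Q) * w Q =
    w P + \sum_(Q <- s) (beta' Q - beta1 Q) * w Q.
  rewrite (bigD1_seq P) //= [in RHS](bigD1_seq P) //= addrA; congr (_ + _).
    have -> : beta1 P = beta P + 1 by rewrite /beta1 eqxx.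
    by ring.
  by apply: eq_bigr => Q /negPf QP; rewrite /beta1 QP addr0.
have [||||l2 [h2 l21 l22]] := IH beta1 l1.
- exact: b1.
- move: bt; have := sumE (fun=> 1); rewrite -!mulr_suml !mulr1 => ->.
  by rewrite intS ltrD2l.
- move=> Q Qs; rewrite /beta1 boff //; case: eqVneq => [QP|];
    last by rewrite addr0.
  by rewrite QP Ps in Qs.
- exact: h1.
exists l2; split=> //; first exact: leq_trans l21.
apply: le_trans l22 _; rewrite (sumE (fun P => (resdeg P)%:Z)); lia.
Qed.

(** An element integral over k has value 0 everywhere. One with a zero is therefore not integral,
    and some place is negative on it. *)
Lemma place_neg_exists (x : F) P : x != 0 -> 0 < P x -> exists Q, Q x < 0.
Proof.
move=> x0 Px; have [|||Q [_ Qx]] := @place_exists _ _ C x; last by exists Q.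
- by have [C1 CB CM _] := subC; split.
- exact: base_constant.
- by move=> /integral_algebraic_const/(algebraic_val P) Px0; rewrite Px0 in Px.
Qed.

(** A nonzero element of this space would have a zero at P0 and no pole. *)
Lemma rrspace_neg beta P0 : (forall P, beta P <= 0) -> beta P0 < 0 ->
  has_dim C (rrspace beta) [set 0] 0.
Proof.
move=> b0 bP0; exists (fun=> 0); split=> [[]//|c _ _ []//|x Bx].
exists (fun=> 0); first by case.
rewrite big_ord0 subr0; apply/eqP; apply: contraT => x0.
have [|Q Qx] := @place_neg_exists x P0 x0.
  by have /(vgeE _ _ x0) := Bx P0; lia.
by have /(vgeE _ _ x0) := Bx Q; have := b0 Q; lia.
Qed.

Lemma rrspace_finite s beta : (forall P, P \notin s -> beta P <= 0) ->
  exists l, has_dim C (rrspace beta) [set 0] l.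
Proof.
move=> bs; have [P0 _] := place_pole_exists (F := F).
(* Cutting off the positive part and subtracting P0 gives a divisor whose space is zero; it differs
   from [beta] at finitely many places only. *)
pose beta0 Q := Num.min (beta Q) 0 - (Q == P0)%:Z.
have h0 : has_dim C (rrspace beta0) [set 0] 0.
  apply: (@rrspace_neg _ P0) => [P|]; last by rewrite /beta0 eqxx; lia.
  by rewrite /beta0; case: (P == P0); lia.
have [|||| l [hl _ _]] := @rrspace_mono (undup (P0 :: s)) beta0 beta 0;
  last by exists l.
- exact: undup_uniq.
- by move=> P; rewrite /beta0; case: (P == P0); lia.
- move=> P; rewrite mem_undup inE negb_or /beta0 => /andP[/negPf-> /bs Pb].
  by rewrite min_l // subr0.
- exact: h0.
Qed.

Definition ell beta : nat := const_dim C (rrspace beta) [set 0].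

Lemma ellP s beta : (forall P, P \notin s -> beta P <= 0) ->
  has_dim C (rrspace beta) [set 0] (ell beta).
Proof.
by move=> /rrspace_finite[l hl]; apply: has_dim_const subC (submodule0 C) hl.
Qed.

Lemma ell_mono s beta beta' : uniq s -> (forall P, beta P <= beta' P) ->
  (forall P, P \notin s -> beta P = 0) -> (forall P, P \notin s ->
    beta' P = 0) ->
  (ell beta <= ell beta')%N /\
  \sum_(P <- s) beta P * (resdeg P)%:Z - (ell beta)%:Z <=
  \sum_(P <- s) beta' P * (resdeg P)%:Z - (ell beta')%:Z.
Proof.
move=> us bb' b0 b0'.
have hb : has_dim C (rrspace beta) [set 0] (ell beta).
  by apply: (@ellP s) => P /b0->.
have [|l' [hl' le le']] := rrspace_mono us bb' _ hb.
  by move=> P Ps; rewrite b0 ?b0'.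
have -> : ell beta' = l' by apply: const_dimE subC (submodule0 C) hl'.
split=> //; move: le'.
have -> : \sum_(P <- s) (beta' P - beta P) * (resdeg P)%:Z =
  \sum_(P <- s) beta' P * (resdeg P)%:Z - \sum_(P <- s) beta P * (resdeg P)%:Z.
  by rewrite -sumrB; apply: eq_bigr => P _; rewrite mulrBl.
by move: (\sum_(P <- s) _) (\sum_(P <- s) _); lia.
Qed.

End RiemannRochSpaces.

(** * Lattices and their index *)

(* Otherwise failing unifications compute in the field of fractions. *)
#[local] Opaque degK.

Section DegreeOfRationalFunctions.
Context {k : fieldType}.
Local Notation K := (ratfun k).
Local Notation tofrac := (@FracField.tofrac {poly k}).
Implicit Types (x y : K) (a b : {poly k}).

Lemma ratfunP x : x != 0 -> exists a b, [/\ a != 0,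
  b != 0 & x = tofrac a / tofrac b].
Proof.
have [a [b [b0 ->]]] := ratfun_frac x => x0; exists a, b; split=> //.
by apply: contraNneq x0 => ->; rewrite rmorph0 mul0r.
Qed.

Lemma degKM x y : x != 0 -> y != 0 -> degK (x * y) = degK x + degK y.
Proof.
move=> /ratfunP[a [b [a0 b0 ->]]] /ratfunP[c [d [c0 d0 ->]]].
rewrite mulf_div -!rmorphM !degK_frac ?mulf_neq0 // !size_mul //.
move: a0 b0 c0 d0; rewrite -!size_poly_gt0.
move: (size a) (size b) (size c) (size d); lia.
Qed.

Lemma degK_tofrac a : a != 0 -> degK (tofrac a) = (size a).-1.
Proof.
move=> a0; rewrite -[tofrac a]divr1 -(rmorph1 tofrac) degK_frac ?oner_eq0 //.
by rewrite size_poly1 subr0.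
Qed.

Lemma degK1 : degK (1 : K) = 0.
Proof. by rewrite -(rmorph1 tofrac) degK_tofrac ?oner_eq0 // size_poly1. Qed.

Lemma degKV x : x != 0 -> degK x^-1 = - degK x.
Proof.
move=> x0; apply: (@addrI _ (degK x)).
by rewrite -degKM ?invr_eq0 // mulfV // degK1 subrr.
Qed.

Lemma tK_neq0 : tK != 0 :> K.
Proof. by rewrite tofrac_eq0 polyX_eq0. Qed.

Lemma degK_tKXz (m : int) : degK ((tK : K) ^ m) = m.
Proof.
have H (j : nat) : degK ((tK : K) ^+ j) = j.
  by rewrite /tK -rmorphXn degK_tofrac ?expf_neq0 ?polyX_eq0 // size_polyXn.
case: m => j; first exact: H.
by rewrite NegzE -exprnN degKV ?expf_neq0 ?tK_neq0 // H.
Qed.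

Lemma degK_prod (I : finType) (h : I -> K) : (forall i, h i != 0) ->
  degK (\prod_i h i) = \sum_i degK (h i).
Proof.
move=> h0; suff [] : \prod_i h i != 0 /\ degK (\prod_i h i) = \sum_i degK (h i)
  by [].
elim: (index_enum I) => [|i s [s0 IH]]; rewrite ?big_nil ?big_cons.
  by rewrite oner_eq0 degK1.
by split; [exact: mulf_neq0 (h0 i) s0|rewrite (degKM (h0 i) s0) IH].
Qed.

(** The value [degK 0] is bypassed: 0 counts as an element of degree -oo. *)
Definition vle (m : int) : set K := [set x | x = 0 \/ degK x <= m].

Lemma vleE m x : x != 0 -> vle m x <-> degK x <= m.
Proof. by move=> x0; split=> [[/eqP|//]|]; [rewrite (negPf x0)|right]. Qed.

Lemma vle0 m : vle m 0. Proof. by left. Qed.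

Lemma vle_le m m' x : m <= m' -> vle m x -> vle m' x.
Proof. by move=> mm' [->|xm]; [left|right; apply: le_trans mm']. Qed.

Lemma vleM m m' x y : vle m x -> vle m' y -> vle (m + m') (x * y).
Proof.
have [->|x0] := eqVneq x 0; first by rewrite mul0r; left.
have [->|y0] := eqVneq y 0; first by rewrite mulr0; left.
move=> /(vleE _ x0) mx /(vleE _ y0) my.
by right; rewrite (degKM x0 y0) lerD.
Qed.

Lemma vleMz m x y : y != 0 -> vle m (x * y) <-> vle (m - degK y) x.
Proof.
move=> y0; split=> [xy|xm].
  rewrite -[x](mulfK y0); apply: (vleM xy); right; by rewrite (degKV y0).
rewrite -[m](subrK (degK y)); apply: (vleM xm); right; exact: lexx.
Qed.

Lemma vleD m x y : vle m x -> vle m y -> vle m (x + y).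
Proof.
have [->|x0] := eqVneq x 0; first by rewrite add0r.
have [->|y0] := eqVneq y 0; first by rewrite addr0.
move=> /(vleE _ x0) mx /(vleE _ y0) my.
have [->|xy0] := eqVneq (x + y) 0; first exact: vle0.
right; have [a [b [a0 b0 xE]]] := ratfunP x0;
  have [c [d [c0 d0 yE]]] := ratfunP y0.
have E : x + y = tofrac (a * d + c * b) / tofrac (b * d).
  by rewrite xE yE rmorphD !rmorphM /= addf_div ?tofrac_eq0.
have s0 : a * d + c * b != 0.
  by apply: contraNneq xy0 => s0; rewrite E s0 rmorph0 mul0r.
rewrite E degK_frac ?mulf_neq0 //.
rewrite xE degK_frac // in mx; rewrite yE degK_frac // in my.
have := size_polyD (a * d) (c * b); rewrite !size_mul //.
move: mx my a0 b0 c0 d0 s0; rewrite -!size_poly_gt0; clear.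
move: (size (a * d + c * b)%R) (size a) (size b) (size c) (size d); lia.
Qed.

Lemma vleN m x : vle m x -> vle m (- x).
Proof.
rewrite -mulN1r -[m in X in _ -> X]add0r => mx; apply: (fun H => vleM H mx);
  right.
have N0 : (-1 : K) != 0 by rewrite oppr_eq0 oner_eq0.
have : degK ((-1 : K) * (-1)) = 0 by rewrite mulrNN mulr1 degK1.
by rewrite (degKM N0 N0); lia.
Qed.

Lemma vle_tofrac (D : nat) a : (size a <= D)%N -> vle (D%:Z - 1) (tofrac a).
Proof.
have [->|a0] := eqVneq a 0; first by rewrite rmorph0; left.
move=> sa; right; rewrite (degK_tofrac a0); move: a0 sa.
by rewrite -size_poly_gt0; move: (size a); lia.
Qed.

Lemma vle_neg_tofrac a : vle (-1) (tofrac a) -> a = 0.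
Proof.
move=> [/eqP|]; first by rewrite tofrac_eq0 => /eqP.
have [//|a0] := eqVneq a 0; rewrite degK_tofrac //; lia.
Qed.

Lemma vle_tofrac_size (m : int) a : vle m (tofrac a) ->
  ((size a)%:Z <= Num.max 0 (m + 1)).
Proof.
have [->|a0] := eqVneq a 0; first by rewrite size_poly0 le_max lexx.
move=> /vleE; rewrite tofrac_eq0 degK_tofrac // => /(_ a0).
move: a0; rewrite -size_poly_gt0; lia.
Qed.

Lemma polynomial_part x : exists a, vle (-1) (x - tofrac a).
Proof.
have [p [q [q0 ->]]] := ratfun_frac x; exists (p %/ q).
have -> : tofrac p / tofrac q - tofrac (p %/ q) = tofrac (p %% q) / tofrac q.
  have q1 : tofrac q != 0 by rewrite tofrac_eq0.
  apply: (mulIf q1); rewrite mulrBl !divfK // {1}(divp_eq p q) rmorphD rmorphM.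
  by rewrite addrAC subrr add0r.
have [->|r0] := eqVneq (p %% q) 0; first by rewrite rmorph0 mul0r; left.
right; rewrite degK_frac //; have := ltn_modp p q; rewrite q0.
move: r0; rewrite -size_poly_gt0; move: (size (p %% q)%R) (size q); lia.
Qed.

Lemma division_part x h : h != 0 -> exists a,
  vle (degK h - 1) (x - tofrac a * h).
Proof.
move=> h0; have [a xa] := polynomial_part (x / h); exists a.
have -> : x - tofrac a * h = (x / h - tofrac a) * h by rewrite mulrBl divfK.
rewrite addrC; apply: (vleM xa); right; exact: lexx.
Qed.

Lemma ringAooE : @ringAoo k = vle 0. Proof. by []. Qed.

End DegreeOfRationalFunctions.

(** * Overmodules of A and of A_oo in k(t) *)

Section PrincipalModules.
Context {k : fieldType} {F : fieldExtType (ratfun k)}.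
Local Notation K := (ratfun k).
Local Notation kconst := (@kconst k F).
Local Notation C := (@base_constants k F).
Local Notation polyF := (@polyF k F).
Local Notation tofrac := (@FracField.tofrac {poly k}).
Implicit Types (R I : set K) (x y h : K).

Let subC := base_constants_subfield (F := F).

(** Dimensions are measured for subsets of F, so subsets of k(t) are carried into F. *)
Definition emb I : set F := [set y | exists2 x, I x & y = in_alg F x].

Lemma embE I x : emb I (in_alg F x) <-> I x.
Proof.
by split=> [[y Iy /(fmorph_inj (in_alg F)) ->]//|Ix]; exists x.
Qed.

Lemma polyF_poly D (a : nat -> k) :
  polyF (\poly_(i < D) a i) = \sum_(i < D) kconst (a i) * polyF 'X ^+ i.
Proof.
rewrite poly_def rmorph_sum /=; apply: eq_bigr => i _.
by rewrite -mul_polyC rmorphM rmorphXn.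
Qed.

Lemma base_constants_coef (D : nat) (c : 'I_D -> F) : (forall j, C (c j)) ->
  exists2 a : nat -> k, (forall j, c j = kconst (a j)) &
    forall h, \sum_j c j * in_alg F (tofrac 'X ^+ j * h) =
      in_alg F (tofrac (\poly_(i < D) a i) * h).
Proof.
move=> Cc; have /choice[a0 aE] j : exists a, c j = kconst a by have [a _ <-] :=
  Cc j; exists a.
pose a i := if insub i is Some j then a0 j else 0.
have aj (j : 'I_D) : a j = a0 j by rewrite /a valK.
exists a => [j|h]; first by rewrite aj.
rewrite rmorphM -[X in X * _]/(polyF _) polyF_poly mulr_suml.
by apply: eq_bigr => j _; rewrite aE aj rmorphM rmorphXn mulrA.
Qed.

Lemma poly_coef0 D (a : nat -> k) (j : 'I_D) : \poly_(i < D) a i = 0 -> a j = 0.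
Proof. by move=> /(congr1 (fun p : {poly k} => p`_j));
  rewrite coef_poly ltn_ord coef0. Qed.

(** A common interface for A and A_oo. If I / R has dimension d, then I is generated by some h = 1/a
    with deg a = d in the case of A, and by an h of degree d in the case of A_oo; accordingly, [sg]
    is -1 or 1. *)
Record pid_ring R (sg : int) : Prop := PidRing {
  pid1 : R 1;
  pidB : forall x y, R x -> R y -> R (x - y);
  pidM : forall x y, R x -> R y -> R (x * y);
  pid_const : forall c, R (tofrac c%:P);
  pid_unit : forall u, u != 0 -> R u -> R u^-1 -> degK u = 0;
  pid_principal : forall I (d : nat), (R `<=` I)%classic ->
    (forall x y, I x -> I y -> I (x + y)) -> (forall c x, R c -> I x ->
      I (c * x)) ->
    has_dim C (emb I) (emb R) d ->
    exists h, [/\ h != 0, forall x, I x <-> R (x / h) & degK h = sg * d%:Z] }.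

Lemma emb_submodule R I : (forall c : k, R (tofrac c%:P)) -> I 0 ->
  (forall x y, I x -> I y -> I (x + y)) -> (forall c x, R c -> I x ->
    I (c * x)) ->
  submodule C (emb I).
Proof.
move=> RC I0 ID IM; split.
- by exists 0; rewrite ?rmorph0.
- by move=> _ _ [x Ix ->] [y Iy ->]; exists (x + y);
    [exact: ID|rewrite rmorphD].
move=> _ _ [c _ <-] [x Ix ->]; exists (tofrac c%:P * x);
  first exact: (IM _ _ (RC c) Ix).
by rewrite rmorphM.
Qed.

Lemma ringA_mem a : ringA (tofrac a). Proof. by exists a. Qed.

Lemma ringA_deg x : ringA x -> vle (-1) x -> x = 0.
Proof. by move=> [a _ <-] /vle_neg_tofrac ->; rewrite rmorph0. Qed.

Lemma pid_ringA : pid_ring ringA (-1).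
Proof.
have AC (c : k) : ringA (tofrac c%:P) by apply: ringA_mem.
split=> //.
- by exists 1; rewrite ?rmorph1.
- by move=> _ _ [a _ <-] [b _ <-]; exists (a - b); rewrite ?rmorphB.
- by move=> _ _ [a _ <-] [b _ <-]; exists (a * b); rewrite ?rmorphM.
- move=> u u0 [a _ aE] [b _ bE].
  have a0 : a != 0 by apply: contraNneq u0 => a0; rewrite -aE a0 rmorph0.
  have b0 : b != 0 by apply: contraNneq u0 => b0;
    rewrite -invr_eq0 -bE b0 rmorph0.
  have := degKV u0; rewrite -bE -aE (degK_tofrac a0) (degK_tofrac b0); lia.
move=> I d AI ID IM hd.
have I0 : I 0 by rewrite -(rmorph0 tofrac); apply/AI/ringA_mem.
have A0 : ringA (0 : K) by rewrite -(rmorph0 tofrac); apply: ringA_mem.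
have AD (x y : K) : ringA x -> ringA y -> ringA (x + y).
  by move=> [a _ <-] [b _ <-]; exists (a + b); rewrite ?rmorphD.
have AM (x y : K) : ringA x -> ringA y -> ringA (x * y).
  by move=> [a _ <-] [b _ <-]; exists (a * b); rewrite ?rmorphM.
have sA := emb_submodule AC A0 AD AM.
have I1 : I 1 by rewrite -(rmorph1 tofrac); apply/AI/ringA_mem.
(* If h has degree -D, nontrivial combinations of the t^j h with j < D have negative degree, hence
   are not in A. So no nonzero element of I has degree less than -d. *)
pose w h (j : nat) : F := in_alg F (tofrac 'X ^+ j * h).
have fw h D : h != 0 -> degK h = - D%:Z -> free_mod C (emb ringA)
  (fun j : 'I_D => w h j).
  move=> h0 hD c Cc; have [a aE aS] := base_constants_coef Cc.
  rewrite aS => /embE Ah j; rewrite aE.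
  suff p0 : \poly_(i < D) a i = 0 by rewrite (poly_coef0 j p0) (rmorph0 kconst).
  have /eqP : tofrac (\poly_(i < D) a i) * h = 0.
    apply: (ringA_deg Ah); apply/(vleMz _ _ h0).
    have -> : -1 - degK h = D%:Z - 1 by rewrite hD; lia.
    exact/vle_tofrac/size_poly.
  by rewrite mulf_eq0 (negPf h0) orbF tofrac_eq0 => /eqP.
have Iw h D (j : 'I_D) : I h -> emb I (w h j).
  move=> Ih; exists (tofrac 'X ^+ j * h) => //; rewrite -rmorphXn.
  by apply: (IM _ _ _ Ih); apply: ringA_mem.
have degI h : h != 0 -> I h -> (- d%:Z <= degK h).
  move=> h0 Ih; have [hpos|hneg] := leP 0 (degK h); first by lia.
  pose D := absz (degK h); have hD : degK h = - D%:Z by rewrite /D; lia.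
  have := has_dim_free_le subC sA hd (fun j : 'I_D => Iw h D j Ih)
    (fw h D h0 hD).
  by rewrite card_ord hD; lia.
(* A nonzero element of least degree generates I, by division with remainder. Degrees are shifted by
   d to make them nonnegative, by [degI]. *)
pose Q m := `[< exists h, [/\ h != 0, I h & absz (degK h + d%:Z)%R = m] >].
have exQ : exists m, Q m.
  by exists (absz (degK (1 : K) + d%:Z)); apply/asboolP; exists 1;
    rewrite oner_eq0.
case: (ex_minnP exQ) => m /asboolP[h [h0 Ih hm]] hmin.
have Imin x : I x -> vle (degK h - 1) x -> x = 0.
  move=> Ix [//|xh]; have [//|x0] := eqVneq x 0.
  have : (m <= absz (degK x + d%:Z)%R)%N by apply: hmin; apply/asboolP;
    exists x.
  by have := degI x x0 Ix; have := degI h h0 Ih; lia.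
have IN x : I x -> I (- x).
  move=> Ix; rewrite -mulN1r; apply: (IM _ _ _ Ix).
  by rewrite -(rmorph1 tofrac) -rmorphN; apply: ringA_mem.
have IE x : I x -> exists a, x = tofrac a * h.
  move=> Ix; have [a xa] := division_part x h0; exists a.
  apply/eqP; rewrite -subr_eq0; apply/eqP/Imin => //.
  apply: (ID _ _ Ix); apply: IN; apply: (IM _ _ _ Ih); exact: ringA_mem.
(* Since I contains 1, h is the inverse of a polynomial a0, and the t^j / a0 with j < deg a0 form a
   basis of I / A. *)
have [a0 a0E] := IE 1 I1.
have a00 : a0 != 0.
  by apply: contra_eqN a0E => /eqP->; rewrite rmorph0 mul0r oner_eq0.
pose D := (size a0).-1.
have hD : degK h = - D%:Z.
  have ta0 : tofrac a0 != 0 by rewrite tofrac_eq0.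
  by have := degKM ta0 h0; rewrite -a0E degK1 (degK_tofrac a00) -/D;
    move: D (degK h); lia.
exists h; split=> //.
  move=> x; split=> [/IE[a ->]|[a _ ax]].
    by rewrite mulfK //; apply: ringA_mem.
  by rewrite -[x](divfK h0) -ax; apply: (IM _ _ _ Ih); apply: ringA_mem.
rewrite hD mulN1r; congr (- _%:Z); apply: (has_dim_uniq subC sA _ hd).
exists (fun j : 'I_D => w h j); split=> [j||]; [exact: Iw|exact: fw|].
move=> _ [x Ix ->]; have [a aE] := IE x Ix.
exists (fun j : 'I_D => kconst (a %% a0)`_j) => [j|];
  first exact: base_constant.
exists (tofrac (a %/ a0)); first exact: ringA_mem.
have -> : \sum_(j < D) kconst (a %% a0)`_j * w h j = in_alg F (tofrac (a %% a0)
  * h).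
  rewrite rmorphM -[X in _ = X * _]/(polyF _).
  have -> : a %% a0 = \poly_(i < D) (a %% a0)`_i.
    have sr : (size (a %% a0)%R <= D)%N.
      by have := ltn_modp a a0; rewrite a00 /D; move: (size _) (size _); lia.
    apply/polyP => i; rewrite coef_poly; case: ltnP => // Di.
    by rewrite nth_default // (leq_trans sr).
  rewrite polyF_poly mulr_suml; apply: eq_bigr => j _.
  by rewrite coef_poly ltn_ord /w rmorphM rmorphXn mulrA.
rewrite -rmorphB; congr (in_alg F _).
rewrite aE {1}(divp_eq a a0) rmorphD rmorphM mulrDl addrK -mulrA -a0E.
by rewrite mulr1.
Qed.

Lemma pid_ringAoo : pid_ring ringAoo 1.
Proof.
rewrite ringAooE.
have OC (c : k) : vle 0 (tofrac c%:P).
  by apply: (@vle_tofrac _ 1); rewrite size_polyC; case: eqP.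
have OM (x y : K) : vle 0 x -> vle 0 y -> vle 0 (x * y).
  by move=> x0 y0; have := vleM x0 y0; rewrite addr0.
have O1 : vle 0 (1 : K) by right; rewrite degK1.
split=> //.
- by move=> x y x0 y0; apply: (vleD x0); apply: vleN.
- move=> u u0 /(vleE _ u0) du; have ui0 := invr_neq0 u0.
  by move=> /(vleE _ ui0); rewrite (degKV u0); move: (degK u) du; lia.
move=> I d OI ID IM hd.
have I0 : I 0 by apply/OI/vle0.
have sO : submodule C (emb (vle (0 : int) : set K)).
  by apply: (emb_submodule (R := vle 0)) => //; [exact: vle0|exact: vleD].
(* An overmodule of greatest degree D has the basis t, ..., t^D modulo A_oo; the exponent j + 1
   skips the constants, which lie in A_oo. *)
pose w (j : nat) : F := in_alg F (tofrac 'X ^+ j * tK).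
have fw D : free_mod C (emb (vle (0 : int) : set K)) (fun j : 'I_D => w j).
  move=> c Cc; have [a aE aS] := base_constants_coef Cc.
  rewrite aS => /embE Ah j; rewrite aE.
  suff p0 : \poly_(i < D) a i = 0 by rewrite (poly_coef0 j p0) (rmorph0 kconst).
  apply/eqP/negPn/negP => p0; move: Ah; rewrite /tK -rmorphM =>
    /vle_tofrac_size.
  by rewrite size_mulX //; move: p0; rewrite -size_poly_gt0; move: (size _);
    lia.
have Iw h (j D : nat) : h != 0 -> degK h = D%:Z -> (j < D)%N -> I h ->
  emb I (w j).
  move=> h0 hD jD Ih; exists (tofrac 'X ^+ j * tK) => //.
  rewrite -(divfK h0 (_ * tK)); apply: (IM _ _ _ Ih).
  have tj0 : (tK : K) ^+ j.+1 != 0 := expf_neq0 _ (tK_neq0 (k := k)).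
  have hi0 := invr_neq0 h0.
  rewrite -exprSr; apply/(vleE _ (mulf_neq0 tj0 hi0)).
  rewrite (degKM tj0 hi0) (degKV h0) hD -[degK _]/(degK (tK ^ (j.+1)%:Z))
    degK_tKXz.
  by lia.
have degI h : h != 0 -> I h -> (degK h <= d%:Z).
  move=> h0 Ih; have [hpos|hneg] := leP (degK h) 0; first by lia.
  pose D := absz (degK h); have hD : degK h = D%:Z by rewrite /D; lia.
  have := has_dim_free_le subC sO hd (fun j : 'I_D =>
    Iw h j D h0 hD (ltn_ord j) Ih) (fw D).
  by rewrite card_ord hD; lia.
have I1 : I 1 by apply: OI.
pose Q m := `[< exists h, [/\ h != 0, I h & degK h = m%:Z] >].
have exQ : exists m, Q m.
  by exists 0%N; apply/asboolP; exists 1; rewrite oner_eq0 degK1.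
have leQ m : Q m -> (m <= d)%N.
  by move=> /asboolP[h [h0 Ih hm]]; have := degI h h0 Ih; rewrite hm.
case: (ex_maxnP exQ leQ) => D /asboolP[h [h0 Ih hD]] hmax.
have IE x : I x -> vle D x.
  move=> Ix; have [->|x0] := eqVneq x 0; first exact: vle0.
  right; have [xneg|xpos] := leP (degK x) 0; first by lia.
  have : (absz (degK x) <= D)%N.
    by apply: hmax; apply/asboolP; exists x; split=> //; lia.
  by move: (degK x) xpos; lia.
have hi0 := invr_neq0 h0.
exists h; split; first exact: h0.
  move=> x; split=> [/IE xD|xh].
    apply/(vleMz _ _ hi0); rewrite (degKV h0) hD.
    by apply: vle_le xD; lia.
  by rewrite -[x](divfK h0); apply: (IM _ _ xh Ih).
rewrite hD mul1r; congr (_%:Z); apply: (has_dim_uniq subC sO _ hd).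
exists (fun j : 'I_D => w j); split=> [j||]; [exact: Iw h0 hD (ltn_ord j)
  Ih|exact: fw|].
move=> _ [x Ix ->]; have [a ax] := polynomial_part x.
have sa : (size a <= D.+1)%N.
  have : vle D (tofrac a).
    rewrite -[tofrac a](subKr x); apply: vleD; first exact: IE.
    by apply: vleN; apply: vle_le ax; lia.
  by move/vle_tofrac_size; move: (size a); lia.
exists (fun j : 'I_D => kconst a`_j.+1) => [j|]; first exact: base_constant.
exists (x - tofrac a + tofrac (a`_0)%:P).
  by apply: vleD; [apply: vle_le ax|exact: OC].
have -> : \sum_(j < D) kconst a`_j.+1 * w j = polyF (a - (a`_0)%:P).
  have ap : a = \poly_(i < D.+1) a`_i.
    apply/polyP => i; rewrite coef_poly; case: ltnP => // Di.
    by rewrite nth_default // (leq_trans sa).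
  have aS : polyF a = \sum_(i < D.+1) kconst a`_i * polyF 'X ^+ i.
    by rewrite {1}ap polyF_poly.
  rewrite rmorphB -[X in _ = X - _]/(polyF a) aS big_ord_recl expr0 mulr1.
  rewrite addrAC subrr add0r; apply: eq_bigr => j _.
  by rewrite /w lift0 exprSr rmorphM rmorphXn.
rewrite -[polyF _]/(in_alg F (tofrac _)) -rmorphB; congr (in_alg F _).
by rewrite rmorphB opprB addrA addrAC.
Qed.

End PrincipalModules.

(** * The index of a sublattice as a dimension *)

Section LatticeIndex.
Context {k : fieldType} {F : fieldExtType (ratfun k)}.
Local Notation K := (ratfun k).
Local Notation kconst := (@kconst k F).
Local Notation C := (@base_constants k F).
Local Notation tofrac := (@FracField.tofrac {poly k}).
Local Notation n := (\dim {:F}).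
Variables (R : set K) (sg : int) (pidR : pid_ring (F := F) R sg).

Let subC := base_constants_subfield (F := F).

Definition lat (S : set K) (e : n.-tuple F) : set F :=
  [set x | forall i, S (coord e i x)].

Lemma basis_free (e : n.-tuple F) : basis_of {:F} e -> free e.
Proof. by case/andP. Qed.

Lemma coord_sum (e : n.-tuple F) x : basis_of {:F} e ->
  x = \sum_i coord e i x *: tnth e i.
Proof.
move=> be; rewrite {1}(coord_basis be (memvf x)).
by apply: eq_bigr => i _; rewrite (tnth_nth 0).
Qed.

Lemma coord_comb (e : n.-tuple F) (c : 'I_n -> K) j : basis_of {:F} e ->
  coord e j (\sum_i c i *: tnth e i) = c j.
Proof.
move=> be; rewrite (eq_bigr (fun i : 'I_n => c i *: e`_i)).
  exact/coord_sum_free/basis_free.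
by move=> i _; rewrite (tnth_nth 0).
Qed.

Lemma coord_gen (e : n.-tuple F) i j : basis_of {:F} e ->
  coord e i (tnth e j) = (i == j)%:R.
Proof.
move=> be; rewrite (tnth_nth 0) coord_free ?basis_free //.
by rewrite eq_sym.
Qed.

Lemma lattice_basisE M (b : n.-tuple F) :
  lattice_basis R M b <-> basis_of {:F} b /\ M = lat R b.
Proof.
suff E : basis_of {:F} b -> [set \sum_i c i *: tnth b i |
    c in [set c : 'I_n -> K | forall i, R (c i)]]%classic = lat R b.
  by split=> -[bb MM]; split=> //; rewrite MM E.
move=> bb; apply/seteqP; split=> [_ [c Rc <-] i|x Rx].
  by rewrite coord_comb.
by exists (fun i => coord b i x); rewrite // -coord_sum.
Qed.

Lemma pid0 : R 0.
Proof. by rewrite -(subrr 1); apply: (pidB pidR); apply: (pid1 pidR). Qed.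

Lemma pidN x : R x -> R (- x).
Proof. by move=> Rx; rewrite -sub0r; apply: (pidB pidR pid0). Qed.

Lemma pidD x y : R x -> R y -> R (x + y).
Proof. by move=> Rx Ry; rewrite -[y]opprK; apply: (pidB pidR Rx); apply: pidN.
  Qed.

Lemma pid_sum (I : finType) (P : pred I) (c : I -> K) :
  (forall i, R (c i)) -> R (\sum_(i | P i) c i).
Proof. by move=> Rc; elim/big_ind: _ => //; [exact: pid0|exact: pidD]. Qed.

Lemma pid_prod (I : finType) (P : pred I) (c : I -> K) :
  (forall i, R (c i)) -> R (\prod_(i | P i) c i).
Proof. by move=> Rc; elim/big_ind: _ => //;
  [exact: (pid1 pidR)|exact: (pidM pidR)]. Qed.

Lemma pid_det m (U : 'M[K]_m) : (forall i j, R (U i j)) -> R (\det U).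
Proof.
move=> RU; apply: pid_sum => s; apply: (pidM pidR); last exact: pid_prod.
by case: (perm.odd_perm s); rewrite ?expr0 ?expr1; [apply: pidN|];
  apply: (pid1 pidR).
Qed.

Definition base_change (b b' : n.-tuple F) (U : 'M[K]_n) :=
  forall j, tnth b' j = \sum_i U i j *: tnth b i.

Lemma base_change_comp b b' b'' U V :
  base_change b b' U -> base_change b' b'' V -> base_change b b'' (U *m V).
Proof.
move=> bU bV j; rewrite bV.
under eq_bigr => i _ do rewrite bU scaler_sumr.
rewrite exchange_big; apply: eq_bigr => i _; rewrite mxE scaler_suml.
by apply: eq_bigr => l _; rewrite scalerA mulrC.
Qed.

Lemma base_change_inj (b b' : n.-tuple F) U V : basis_of {:F} b ->
  base_change b b' U -> base_change b b' V -> U = V.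
Proof.
move=> bb bU bV; apply/matrixP => i j.
have := congr1 (coord b i) (bU j); rewrite {1}bV.
by rewrite (coord_comb (fun i => V i j) _ bb) (coord_comb (fun i => U i j)
  _ bb).
Qed.

Lemma base_change_id b : base_change b b 1%:M.
Proof.
move=> j; rewrite (bigD1 j) //= mxE eqxx scale1r big1 ?addr0 // => i ij.
by rewrite mxE (negPf ij) scale0r.
Qed.

(** The matrices of the two base changes have entries in R and are inverse to each other, so their
    determinants are units of R. *)
Lemma base_change_lattice M (b b' : n.-tuple F) : lattice_basis R M b ->
  lattice_basis R M b' ->
  exists U, [/\ base_change b b' U, \det U != 0 & degK (\det U) = 0].
Proof.
have H M' c c' : lattice_basis R M' c -> lattice_basis R M' c' ->
    exists2 U, base_change c c' U & R (\det U).
  move=> /lattice_basisE[bc Mc] /lattice_basisE[bc' Mc'].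
  exists (\matrix_(i, j) coord c i (tnth c' j)).
    move=> j; rewrite [LHS](coord_sum _ bc).
    by apply: eq_bigr => i _; rewrite mxE.
  apply: pid_det => i j; rewrite mxE; suff : lat R c (tnth c' j) by apply.
  rewrite -Mc Mc' => l; rewrite coord_gen //.
  by case: (l == j); [apply: (pid1 pidR)|apply: pid0].
move=> hb hb'; have [U bU RU] := H _ _ _ hb hb';
  have [V bV RV] := H _ _ _ hb' hb.
have [/= bb _] := hb.
have UV : U *m V = 1%:M.
  exact: base_change_inj bb (base_change_comp bU bV) (base_change_id b).
have dUV : \det U * \det V = 1 by rewrite -det_mulmx UV det1.
have dU0 : \det U != 0.
  by apply/eqP => dU0; move/eqP: dUV; rewrite dU0 mul0r eq_sym oner_eq0.
exists U; split=> //; apply: (pid_unit pidR dU0 RU).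
suff -> : (\det U)^-1 = \det V by [].
by apply: (mulfI dU0); rewrite mulfV.
Qed.

Lemma abs_lattice_index_eq O M (b b' : n.-tuple F) T : lattice_basis R O b ->
  lattice_basis R M b' ->
  base_change b b' T -> \det T != 0 -> abs_lattice_index R O M = degK (\det T).
Proof.
move=> hb hb' bT dT; rewrite /abs_lattice_index.
have hT : lattice_index R O M (\det T).
  by exists b, b', T; split=> //; rewrite unitmxE unitfE.
have [b2 [b2' [T2 [hb2 hb2' uT2 bT2 ->]]]] := xgetI 0 hT.
have dT2 : \det T2 != 0 by rewrite -unitfE -unitmxE.
have [U [bU dU dU0]] := base_change_lattice hb hb2.
have [W [bW dW dW0]] := base_change_lattice hb' hb2'.
have [/= bb _] := hb.
have E : U *m T2 = T *m W.
  exact: base_change_inj bb (base_change_comp bU bT2) (base_change_comp bT bW).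
have := congr1 degK (congr1 determinant E); rewrite !det_mulmx.
by rewrite (degKM dU dT2) (degKM dT dW) dU0 dW0 add0r addr0.
Qed.

Section IndexDimension.
Variables (e : n.-tuple F) (be : basis_of {:F} e) (O : set F).
Hypotheses (OD : forall x y, O x -> O y -> O (x + y))
           (OZ : forall c x, R c -> O x -> O (c *: x))
           (eO : (lat R e `<=` O)%classic).

(* A filtration from O = flag 0 to flag n, the lattice spanned by e. *)
Let flag (j : nat) : set F :=
  [set x | O x /\ forall i : 'I_n, (i < j)%N -> R (coord e i x)].

(** The j-th coordinate identifies flag j / flag (j + 1) with J j / R. *)
Let J (j : 'I_n) : set K := [set y | exists2 x, flag j x & y = coord e j x].

Lemma kconst_scale c (x : F) : kconst c * x = tofrac c%:P *: x.
Proof. by rewrite -[RHS]mulr_algl. Qed.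

Let O0 : O 0.
Proof. by apply: eO => i; rewrite linear0; apply: pid0. Qed.

Let ON x : O x -> O (- x).
Proof. by rewrite -scaleN1r; apply: OZ; apply: pidN; apply: (pid1 pidR). Qed.

Let flagD j x y : flag j x -> flag j y -> flag j (x + y).
Proof.
move=> [Ox xR] [Oy yR]; split=> [|i ij]; first exact: OD.
by rewrite linearD; apply: pidD; [apply: xR|apply: yR].
Qed.

Let flagZ j c x : R c -> flag j x -> flag j (c *: x).
Proof.
move=> Rc [Ox xR]; split=> [|i ij]; first exact: OZ.
by rewrite linearZ; apply: (pidM pidR Rc); apply: xR.
Qed.

Let flag_submodule j : submodule C (flag j).
Proof.
split; [by split=> // i _; rewrite linear0; apply: pid0|exact: flagD|].
move=> _ x [c _ <-] Fx; rewrite kconst_scale.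
exact: (flagZ (pid_const pidR c) Fx).
Qed.

Let flagS j : (flag j.+1 `<=` flag j)%classic.
Proof. by move=> x [Ox xR]; split=> // i ij; apply: xR; rewrite ltnW. Qed.

Let flag0 : flag 0 = O.
Proof. by apply/seteqP; split=> [x []//|x Ox]. Qed.

Let flagn : flag n = lat R e.
Proof.
apply/seteqP; split=> [x [_ xR] i|x xR]; first exact: xR.
by split=> //; apply: eO.
Qed.

Let flag_le i j : (i <= j)%N -> (flag j `<=` flag i)%classic.
Proof.
by move=> ij x [Ox xR]; split=> // l li; apply: xR; apply: leq_trans ij.
Qed.

Lemma flag_dim d j : has_dim C O (lat R e) d -> (j < n)%N ->
  exists dj, has_dim C (flag j) (flag j.+1) dj.
Proof.
move=> hd jn; have sl := flag_submodule n; rewrite flagn in sl.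
have [|dj hj _] := has_dim_bound (N := d) subC (flag_submodule j)
  (flag_submodule j.+1).
  move=> m b Fb fb; rewrite -[m]card_ord.
  apply: (has_dim_free_le subC sl hd (b := b)) => [i|c Cc Rc].
    by case: (Fb i).
  by apply: fb => //; apply: (flag_le jn); rewrite flagn.
by exists dj.
Qed.

(** The dimensions of the n steps of the filtration add up to d, and each [J j] is principal, with a
    generator whose degree is the dimension of its step up to the sign [sg]. *)
Lemma leading_generators d : has_dim C O (lat R e) d ->
  exists h : 'I_n -> K, [/\ forall j, h j != 0,
    forall j y, J j y <-> R (y / h j) & \sum_j degK (h j) = sg * d%:Z].
Proof.
move=> hd.
have /choice[dd ddP] j : exists dj, (j < n)%N ->
  has_dim C (flag j) (flag j.+1) dj.
  have [jn|nj] := boolP (j < n)%N; last by exists 0%N.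
  by have [dj hj] := flag_dim hd jn; exists dj.
have dsum m : (m <= n)%N -> has_dim C O (flag m) (\sum_(j < m) dd j)%N.
  elim: m => [_|m IH mn].
    rewrite big_ord0 flag0; exists (fun=> 0); split=> [[]//|c _ _ []//|x Ox].
    by exists (fun=> 0); [case|rewrite big_ord0 subr0].
  rewrite big_ord_recr /=; apply: (has_dim_add subC (@flagS m)
    _ (flag_submodule m) (IH (ltnW mn)) (ddP m mn)).
  by rewrite -flag0; apply: flag_le.
have dE : d = (\sum_(j < n) dd j)%N.
  have sl := flag_submodule n; rewrite flagn in sl.
  by apply: (has_dim_uniq subC sl hd); rewrite -flagn; apply: dsum.
have hJ (j : 'I_n) : has_dim C (emb (J j)) (emb R) (dd j).
  have lphi : linear_over C (fun x => in_alg F (coord e j x)).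
    split=> [x y|_ x [c _ <-]]; first by rewrite linearD rmorphD.
    by rewrite kconst_scale linearZ rmorphM.
  have sR : submodule C (emb R).
    apply: (emb_submodule (pid_const pidR) pid0); first exact: pidD.
    exact: (pidM pidR).
  apply: (has_dim_image subC (flag_submodule j)
    sR lphi _ _ _ _ (ddP j (ltn_ord j))).
  - by move=> x Fx; exists (coord e j x) => //; exists x.
  - move=> x [Ox xR] /embE Rx; split=> // i; rewrite ltnS leq_eqVlt.
    by case/orP=> [/eqP/val_inj->|/xR].
  - by move=> x Fx [_ xR]; exists (coord e j x) => //; apply: xR.
  - move=> _ [_ [x Fx ->] ->]; exists x => //; rewrite subrr.
    by exists 0; [exact: pid0|rewrite rmorph0].
have /choice[h hP] (j : 'I_n) : exists h, [/\ h != 0, forall x,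
  J j x <-> R (x / h) &
    degK h = sg * (dd j)%:Z].
  apply: (pid_principal pidR _ _ _ (hJ j))
    => [c Rc|_ _ [x Fx ->] [y Fy ->]|c _ Rc [x Fx ->]].
  - exists (c *: tnth e j); last by rewrite linearZ /= coord_gen // eqxx;
      apply/esym/mulr1.
    have ce : lat R e (c *: tnth e j).
      move=> i; rewrite linearZ /= coord_gen //.
      by apply: (pidM pidR Rc); case: (i == j);
        [apply: (pid1 pidR)|apply: pid0].
    by split=> [|i _]; [apply: eO|apply: ce].
  - by exists (x + y); [apply: flagD|rewrite linearD].
  - by exists (c *: x); [apply: flagZ|rewrite linearZ].
exists h; split=> [j|j|]; try by case: (hP j).
rewrite dE (big_morph Posz PoszD (erefl 0%:Z)) mulr_sumr.
by apply: eq_bigr => j _; case: (hP j).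
Qed.

(** As in the Hermite normal form, [b j] is an element of O whose coordinates before j vanish and
    whose j-th coordinate is [h j]. The matrix from e to b is triangular with the [h j] on the
    diagonal, and T is its inverse. *)
Lemma triangular_basis (h : 'I_n -> K) : (forall j, h j != 0) ->
  (forall j y, J j y <-> R (y / h j)) ->
  exists b T, [/\ lattice_basis R O b, base_change b e T, \det T != 0
    & degK (\det T) = - \sum_j degK (h j)].
Proof.
move=> h0 hJ.
have /choice[b bP] (j : 'I_n) : exists b, [/\ O b,
    forall i : 'I_n, (i < j)%N -> coord e i b = 0 & coord e j b = h j].
  have [x [Ox xR] xh] : J j (h j) by apply/hJ; rewrite mulfV //;
    apply: (pid1 pidR).
  (* The coordinates of x before j lie in R, so that subtracting an element of the lattice of e
     removes them. *)
  pose c (i : 'I_n) := if (i < j)%N then coord e i x else 0.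
  exists (x - \sum_i c i *: tnth e i); split.
  - apply: OD => //; apply: ON; apply: eO => i; rewrite coord_comb // /c.
    by case: ifP => [/xR//|_]; apply: pid0.
  - by move=> i ij; rewrite linearB /= coord_comb // /c ij subrr.
  - by rewrite linearB /= coord_comb // /c ltnn subr0.
pose B : 'M[K]_n := \matrix_(i, j) coord e i (b j).
have detB : \det B = \prod_j h j.
  rewrite det_trig; first by apply: eq_bigr => j _; rewrite mxE; case: (bP j).
  by apply/is_trig_mxP => i j ij; rewrite mxE; case: (bP j) => _ /(_ i ij).
have dB0 : \det B != 0 by rewrite detB; apply/prodf_neq0 => j _; apply: h0.
have uB : B \in unitmx by rewrite unitmxE unitfE.
pose bt := [tuple b j | j < n].
have bE j : tnth bt j = b j by rewrite tnth_mktuple.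
have eb : base_change e bt B.
  move=> j; rewrite bE [LHS](coord_sum _ be).
  by apply: eq_bigr => i _; rewrite mxE.
have be' : base_change bt e (invmx B).
  move=> j; have := base_change_id e j; rewrite -(mulmxV uB) => {1}->.
  under [RHS]eq_bigr => i _ do rewrite eb scaler_sumr.
  rewrite exchange_big; apply: eq_bigr => i _; rewrite mxE scaler_suml.
  by apply: eq_bigr => l _; rewrite scalerA mulrC.
have bb : basis_of {:F} bt.
  rewrite basisEdim size_tuple leqnn andbT.
  apply/subvP => x _; rewrite (coord_sum x be); apply: memv_suml => i _.
  apply: memvZ; rewrite be'; apply: memv_suml => j _; apply: memvZ.
  by apply: memv_span; apply: mem_tnth.
exists bt, (invmx B); split; [|exact: be'|by rewrite det_inv invr_eq0;
  exact: dB0|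
  by rewrite det_inv (degKV dB0) detB (degK_prod h0)].
apply/lattice_basisE; split; first exact: bb.
apply/seteqP; split; last first.
  move=> x xR; rewrite (coord_sum x bb).
  apply: big_ind => [||i _]; [exact: O0|exact: OD|].
  by apply: OZ; [apply: xR|rewrite bE; case: (bP i)].
(* m counts the last coordinates that may be nonzero; subtracting a multiple of [b j] clears the
   first of them. *)
suff H m : (m <= n)%N -> forall x, O x ->
    (forall i : 'I_n, (i < n - m)%N -> coord e i x = 0) -> lat R bt x.
  by move=> x Ox; apply: (H n (leqnn _) x Ox) => i; rewrite subnn.
elim: m => [_ x Ox x0|m IH mn x Ox x0].
  rewrite (coord_sum x be) big1 => [i|i _]; first by rewrite linear0;
    apply: pid0.
  by rewrite x0 ?scale0r // subn0.
have jn : (n - m.+1 < n)%N by lia.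
pose j := Ordinal jn.
have Rc : R (coord e j x / h j).
  apply/hJ; exists x => //; split=> // i ij; rewrite x0 //; exact: pid0.
set c := _ / _ in Rc.
have : lat R bt (x - c *: b j).
  have [Ob bi bj] := bP j.
  apply: (IH (ltnW mn)); first by apply: OD => //; apply: ON; apply: OZ.
  move=> i im; have : (i <= j)%N by rewrite /=; lia.
  rewrite leq_eqVlt => /orP[/eqP/val_inj->|ij]; rewrite linearB linearZ /=.
    by rewrite bj /c; apply/eqP; rewrite subr_eq0 eq_sym; apply/eqP/divfK/h0.
  by rewrite (bi i ij) (x0 i ij) mulr0 subr0.
move=> H i; have := H i; rewrite linearB linearZ /= -bE coord_gen // => Hi.
rewrite -[coord bt i x](subrK (c * (i == j)%:R)); apply: (pidD Hi).
by apply: (pidM pidR Rc); case: (i == j); [apply: (pid1 pidR)|apply: pid0].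
Qed.

(** With the two values of [sg], this is d over A and -d over A_oo. *)
Theorem lattice_index_dim d : has_dim C O (lat R e) d ->
  abs_lattice_index R O (lat R e) = - (sg * d%:Z).
Proof.
move=> /leading_generators[h [h0 hJ hs]].
have [b [T [hb bT dT degT]]] := triangular_basis h0 hJ.
have he : lattice_basis R (lat R e) e by apply/lattice_basisE.
by rewrite (abs_lattice_index_eq hb he bT dT) degT hs.
Qed.

End IndexDimension.

End LatticeIndex.

(** * Integral closures and places *)

Section IntegralClosures.
Context {k : fieldType} {F : fieldExtType (ratfun k)}.
Local Notation K := (ratfun k).
Local Notation kconst := (@kconst k F).
Local Notation polyF := (@polyF k F).
Local Notation tofrac := (@FracField.tofrac {poly k}).
Local Notation n := (\dim {:F}).
Implicit Types (P Q : place F).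

Definition tF : F := polyF 'X.

Lemma tF_neq0 : tF != 0. Proof. by rewrite polyF_eq0 polyX_eq0. Qed.

Lemma tF_alg : tF = in_alg F tK. Proof. by []. Qed.

Lemma integral_closureE (R : set K) z : R 0 ->
  integral_closure R z <-> integral_over (emb (F := F) R) z.
Proof.
move=> R0; split=> [[p [mp Rp pz]]|[p mp [Rp pz]]].
  exists (map_poly (in_alg F) p); first by rewrite map_monic.
  split; last exact/rootP.
  by move=> i; rewrite coef_map; exists p`_i.
have /choice[c cP] i : exists c, R c /\ p`_i = in_alg F c.
  by have [c Rc cE] := Rp i; exists c.
pose q := \poly_(i < size p) c i.
have qp : map_poly (in_alg F) q = p.
  apply/polyP => i; rewrite coef_map coef_poly; case: ltnP => [_|sp].
    by rewrite (cP i).2.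
  by rewrite nth_default //; apply: (rmorph0 (in_alg F)).
exists q; split; [by rewrite -(map_monic (in_alg F)) qp| |by apply/rootP;
  rewrite qp].
by move=> i; rewrite coef_poly; case: ifP => // _; apply: (cP i).1.
Qed.

Lemma vge_polyF P (a : {poly k}) : 0 <= P tF -> vge P 0 (polyF a).
Proof.
move=> Pt; rewrite polyF_sum; apply: (subring_sum (vge_subring P)) => i _.
rewrite -[0]addr0; apply: vgeM; first exact: vge_const.
by right; rewrite val_atX mulr_ge0.
Qed.

Lemma val_polyF_infinite P (a : {poly k}) : P tF < 0 -> a != 0 ->
  P (polyF a) = (size a).-1%:Z * P tF.
Proof.
move=> Pt a0; have la : lead_coef a != 0 by rewrite lead_coef_eq0.
have kla : kconst (lead_coef a) != 0 by rewrite -polyFC polyF_eq0 polyC_eq0.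
have t0 d : kconst (lead_coef a) * tF ^+ d != 0.
  by rewrite mulf_neq0 ?expf_neq0 ?tF_neq0.
have Pl d : P (kconst (lead_coef a) * tF ^+ d) = d%:Z * P tF.
  by rewrite val_atM ?expf_neq0 ?tF_neq0 // val_at_const // val_atX add0r mulrC.
rewrite polyF_sum; have := lead_coefE a; move: a0; rewrite -size_poly_gt0.
case: (size a) => //= d _ ld; rewrite big_ord_recr /= -ld addrC.
have [|_ ->] := @vge_strict _ _ P _ (\sum_(i < d) kconst a`_i * tF ^+ i)
  (t0 d); last exact: Pl.
rewrite Pl; apply: (submod_sum (vge_submodule P _)) => i _.
apply: (submodM (vge_submodule P _)); first exact: base_constant.
right; rewrite val_atX mulrC; have := ltn_ord i; nia.
Qed.

(** At a pole of t, the place restricts to a positive multiple of v_oo, the factor being - P t. *)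
Lemma val_alg_infinite P (x : K) : P tF < 0 -> x != 0 ->
  P (in_alg F x) = degK x * P tF.
Proof.
move=> Pt /ratfunP[a [b [a0 b0 ->]]]; rewrite (degK_frac a0 b0).
have -> : in_alg F (tofrac a / tofrac b) = polyF a / polyF b.
  by rewrite rmorphM fmorphV.
have pa0 : polyF a != 0 by rewrite polyF_eq0.
have pb0 : (polyF b)^-1 != 0 by rewrite invr_eq0 polyF_eq0.
rewrite (val_atM P pa0 pb0) val_atV (val_polyF_infinite Pt a0)
  (val_polyF_infinite Pt b0).
by rewrite mulrBl.
Qed.

Lemma emb_subring (R : set K) sg : pid_ring (F := F) R sg ->
  subring (emb (F := F) R).
Proof.
move=> pR; split.
- by exists 1; [exact: (pid1 pR)|rewrite rmorph1].
- move=> _ _ [x Rx ->] [y Ry ->]; exists (x - y); last by rewrite rmorphB.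
  exact: (pidB pR).
- move=> _ _ [x Rx ->] [y Ry ->]; exists (x * y); last by rewrite rmorphM.
  exact: (pidM pR).
Qed.

Lemma integral_closure_finite z :
  integral_closure ringA z <-> forall P, 0 <= P tF -> vge P 0 z.
Proof.
have pA := pid_ringA (F := F); rewrite (integral_closureE _ (pid0 pA)).
split=> [zi P Pt|H].
  apply: (integral_vge _ zi) => _ [_ [a _ <-] ->]; exact: vge_polyF.
apply: contrapT => /place_exists[|c|P [PR Pz]].
- exact: emb_subring pA.
- by exists (tofrac c%:P) => //; apply: ringA_mem.
have : vge P 0 tF by apply: PR; exists tK => //; apply: ringA_mem.
move=> /(vgeE _ _ tF_neq0)/H [z0|]; last by lia.
by rewrite z0 val_at0 in Pz.
Qed.

Lemma integral_closure_infinite z :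
  integral_closure ringAoo z <-> forall P, P tF < 0 -> vge P 0 z.
Proof.
have pA := pid_ringAoo (F := F); rewrite (integral_closureE _ (pid0 pA)).
have embP P : P tF < 0 -> forall y, emb (F := F) ringAoo y -> vge P 0 y.
  move=> Pt _ [x Rx ->]; have [->|x0] := eqVneq x 0; first by left;
    rewrite rmorph0.
  right; rewrite (val_alg_infinite Pt x0).
  by case: Rx => [/eqP|]; [rewrite (negPf x0)|nia].
split=> [zi P Pt|H]; first by apply: (integral_vge _ zi); apply: embP.
apply: contrapT => /place_exists[|c|P [PR Pz]].
- exact: emb_subring pA.
- by exists (tofrac c%:P) => //; apply: (pid_const pA).
have [Pt|Pt] := ltP (P tF) 0.
  by have [z0|] := H P Pt; [rewrite z0 val_at0 in Pz|lia].
(* A place nonnegative on A_oo cannot satisfy P t >= 0. As 1/t is in A_oo, P t would be 0; as t^(deg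
   a) / a is in A_oo, P a would be at most 0, hence 0, for every nonzero polynomial a. *)
have [a a0 /eqP] := nonconst_val P; apply.
have pa0 : polyF a != 0 by rewrite polyF_eq0.
have /(vgeE _ _ pa0) Pa := vge_polyF a Pt.
have : vge P 0 (tF ^+ (size a).-1 / polyF a).
  apply: PR; exists (tofrac ('X^((size a).-1)) / tofrac a); last first.
    by rewrite rmorphM fmorphV !rmorphXn.
  right; rewrite degK_frac ?expf_neq0 ?polyX_eq0 // size_polyXn.
  by rewrite /= subrr.
have q0 : tF ^+ (size a).-1 / polyF a != 0.
  by rewrite mulf_neq0 ?invr_eq0 ?expf_neq0 ?tF_neq0.
move=> /(vgeE _ _ q0);
  rewrite val_atM ?invr_eq0 ?expf_neq0 ?tF_neq0 // val_atV val_atX.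
have Rt : ringAoo (tK^-1 : K).
  by right; rewrite (degKV tK_neq0) -[degK _]/(degK (tK ^ 1%:Z)) degK_tKXz.
have : vge P 0 tF^-1.
  have <- : in_alg F tK^-1 = tF^-1 by rewrite tF_alg; apply: fmorphV.
  exact: (PR _ (ex_intro2 _ _ _ Rt (erefl (in_alg F tK^-1)))).
by rewrite vgeE ?invr_eq0 ?tF_neq0 // val_atV; nia.
Qed.

Definition pole_divisor P : int := if P tF < 0 then - P tF else 0.

Definition lspace (m : nat) : set F :=
  [set z | integral_closure ringA z /\ integral_closure ringAoo (z / tF ^+ m)].

Lemma lspaceE m : lspace m = rrspace (fun P => m%:Z * pole_divisor P).
Proof.
have tm P : P (tF ^+ m)^-1 = - (m%:Z * P tF) by rewrite val_atV val_atX mulrC.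
apply/seteqP; split=> [z [/integral_closure_finite z1 /integral_closure_infinite z2] P|z zL].
  rewrite /pole_divisor; case: ltP => [Pt|/z1]; last by rewrite mulr0 oppr0.
  rewrite -[z](@divfK _ (tF ^+ m)) ?expf_neq0 ?tF_neq0 //.
  rewrite -[X in vge P X]add0r; apply: vgeM; first exact: z2.
  by right; rewrite mulrN opprK val_atX mulrC.
split.
  apply/integral_closure_finite => P Pt; have := zL P.
  by rewrite /pole_divisor ltNge Pt mulr0 oppr0.
apply/integral_closure_infinite => P Pt; have := zL P.
rewrite /pole_divisor Pt mulrN opprK => Pz.
rewrite -[0](subrr (m%:Z * P tF)); apply: vgeM Pz _.
by right; rewrite tm.
Qed.

Lemma infinite_places : exists2 s, uniq s & forall P, P tF < 0 <-> P \in s.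
Proof.
have [s us sP] := zeros_finite (F := F) (oner_neq0 {poly k})
  (negbT (polyX_eq0 k)).
exists s => // P; rewrite -sP rmorph1 div1r val_atV oppr_gt0.
by [].
Qed.

(** Obtained from the zeros of 1/t. Equality has to wait for the growth of l(m D). *)
Lemma pole_divisor_degree s : uniq s -> (forall P, P tF < 0 <-> P \in s) ->
  \sum_(P <- s) pole_divisor P * (resdeg P)%:Z <= n%:Z.
Proof.
move=> us sP.
have := @sum_resdeg_leq _ F s 1 'X 1 us (oner_neq0 _) (negbT (polyX_eq0 k)).
rewrite size_poly1 size_polyX rmorph1 => /(_ isT isT); rewrite muln1.
have E P : P \in s -> P (1 / polyF 'X) = pole_divisor P.
  by move=> /sP Pt; rewrite /pole_divisor Pt div1r val_atV.
have pos P : P \in s -> 0 <= P (1 / polyF 'X).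
  by move=> Ps; rewrite E // /pole_divisor; case: ifP => // Pt; lia.
move=> /(_ pos); rewrite -lez_nat; apply: le_trans.
rewrite (big_morph Posz PoszD (erefl 0%:Z)) big_seq [X in _ <= X]big_seq.
apply: ler_sum => P Ps; rewrite PoszM -(E P Ps) ler_wpM2r //.
by rewrite gez0_abs // pos.
Qed.

End IntegralClosures.

(** * Splitting L(m D) along lattices given by coordinates *)

Section Boxes.
Context {k : fieldType} {F : fieldExtType (ratfun k)}.
Local Notation K := (ratfun k).
Local Notation kconst := (@kconst k F).
Local Notation C := (@base_constants k F).
Local Notation tF := (@tF k F).
Local Notation tofrac := (@FracField.tofrac {poly k}).
Local Notation n := (\dim {:F}).
Variables (e : n.-tuple F) (be : basis_of {:F} e) (r : 'I_n -> nat).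

Let subC := base_constants_subfield (F := F).
Local Notation M := (lat ringA e).

(** This is t^m N, where N is the lattice over A_oo with basis the e_i / t^(r i). *)
Definition box (m : int) : set F :=
  [set x | forall i, vle (m - (r i)%:Z) (coord e i x)].

Lemma lat_submodule (R : set K) sg : pid_ring (F := F) R sg ->
  submodule C (lat R e).
Proof.
move=> pR; split=> [i|x y xR yR i|_ x [c _ <-] xR i].
- by rewrite linear0; apply: (pid0 pR).
- by rewrite linearD; apply: (pidD pR (xR i) (yR i)).
- by rewrite kconst_scale linearZ; apply: (pidM pR (pid_const pR c) (xR i)).
Qed.

Lemma box_submodule m : submodule C (box m).
Proof.
split=> [i|x y xR yR i|_ x [c _ <-] xR i].
- by rewrite linear0; apply: vle0.
- by rewrite linearD; apply: (vleD (xR i) (yR i)).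
- rewrite kconst_scale linearZ -[X in vle X]add0r;
    apply: (fun H => vleM H (xR i)).
  by apply: (@vle_tofrac _ 1); rewrite size_polyC; case: eqP.
Qed.

Lemma box_scale (m j : int) x : box m (x * tF ^ j) <-> box (m - j) x.
Proof.
have tj0 : (tK : K) ^ j != 0 by rewrite expfz_neq0 ?tK_neq0.
have E i : coord e i (x * tF ^ j) = coord e i x * tK ^ j.
  by rewrite tF_alg -fmorphXz mulr_algr linearZ /= mulrC.
have bE i : m - (r i)%:Z - j = m - j - (r i)%:Z by lia.
split=> xR i.
  by have := xR i; rewrite E => /(vleMz _ _ tj0); rewrite degK_tKXz bE.
by rewrite E; apply/(vleMz _ _ tj0); rewrite degK_tKXz bE; apply: xR.
Qed.

(** Each coordinate is its polynomial part plus a remainder of degree at most -1, which is less than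
    m - r i. *)
Lemma lat_box_cover (m : nat) : (forall i, (r i <= m)%N) ->
  forall x, exists2 a, M a & box m (x - a).
Proof.
move=> rm x; have /choice[p pP] i := polynomial_part (coord e i x).
have E i : coord e i (\sum_i tofrac (p i) *: tnth e i) = tofrac (p i).
  exact: coord_comb.
exists (\sum_i tofrac (p i) *: tnth e i) => i; rewrite ?linearB /= E.
  exact: ringA_mem.
by apply: vle_le (pP i); have := rm i; lia.
Qed.

(** The t^j e_i with 0 <= j <= m - r i form a basis, whence the successor. *)
Lemma lat_box_dim (m : nat) : (forall i, (r i <= m)%N) ->
  has_dim C (M `&` box m)%classic [set 0] (\sum_i (m - r i).+1).
Proof.
move=> rm; pose d i := (m - r i).+1.
pose b (x : {i : 'I_n & 'I_(d i)}) := tF ^+ tagged x * tnth e (tag x).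
suff /basis_mod_has_dim : basis_mod C (M `&` box m)%classic [set 0] b.
  rewrite card_tagged sumnE big_map big_enum /=.
  by under eq_bigr => i _ do rewrite card_ord.
have bE i (j : 'I_(d i)) : b (Tagged (fun i => 'I_(d i)) j) = tofrac ('X^j)
  *: tnth e i.
  by rewrite /b /= tF_alg -rmorphXn -(rmorphXn tofrac) mulr_algl.
have sumE (a : forall i, 'I_(d i) -> k) :
    \sum_x kconst (a (tag x) (tagged x)) * b x =
    \sum_i tofrac (\sum_(j < d i) a i j *: 'X^j) *: tnth e i.
  rewrite -(@sig_big_dep _ _ _ _ (fun i => 'I_(d i)) xpredT (fun _ => xpredT)
    (fun i j => kconst (a i j) * b (Tagged (fun i => 'I_(d i)) j))) /=.
  apply: eq_bigr => i _; rewrite rmorph_sum scaler_suml; apply: eq_bigr => j _.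
  by rewrite bE kconst_scale scalerA -rmorphM mul_polyC.
have coefE i (a : 'I_(d i) -> k) (j : 'I_(d i)) : (\sum_(j < d i)
  a j *: 'X^j)`_j = a j.
  rewrite coef_sum (bigD1 j) //= coefZ coefXn eqxx mulr1 big1 ?addr0 // => l lj.
  by rewrite coefZ coefXn eq_sym (inj_eq val_inj) (negPf lj) mulr0.
split.
- case=> i j; rewrite -/(Tagged (fun i => 'I_(d i)) j) bE; split=> l;
    rewrite linearZ /= coord_gen //.
    have [_|_] := eqVneq l i; rewrite ?mulr1 ?mulr0; first exact: ringA_mem.
    exact: (pid0 (pid_ringA (F := F))).
  have [li|_] := eqVneq l i; rewrite ?mulr1 ?mulr0; last exact: vle0.
  rewrite li; apply: (@vle_le _ (j.+1%:Z - 1)); last by apply: vle_tofrac;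
    rewrite size_polyXn.
  by have := ltn_ord j; have := rm i; rewrite /d; lia.
- move=> c Cc; have /choice[a aE] x : exists a, c x = kconst a.
    by have [a _ <-] := Cc x; exists a.
  under eq_bigr => x _ do rewrite aE.
  rewrite (eq_bigr (fun x => kconst (a (Tagged (fun i => 'I_(d i)) (tagged x)))
    * b x)); last first.
    by case.
  rewrite (sumE (fun i j => a (Tagged (fun i => 'I_(d i)) j))) => s0 [i j];
    rewrite aE.
  have /(congr1 (coord e i)) := s0; rewrite coord_comb // linear0 => /eqP.
  rewrite tofrac_eq0 => /eqP p0; have := coefE i (fun j => a (Tagged (fun i =>
    'I_(d i)) j)) j.
  by rewrite p0 coef0 => <-; apply: (rmorph0 kconst).
- move=> x [xM xB]; have /choice[p pP] i : exists p, coord e i x = tofrac p.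
    by have [p _ <-] := xM i; exists p.
  exists (fun x : {i : 'I_n & 'I_(d i)} =>
    kconst (p (tag x))`_(nat_of_ord (tagged x : 'I_(d (tag x))))) => [y|];
      first exact: base_constant.
  rewrite (sumE (fun i (j : 'I_(d i)) => (p i)`_j)); apply/eqP;
    rewrite subr_eq0; apply/eqP.
  rewrite [LHS](coord_sum x be); apply: eq_bigr => i _; rewrite pP;
    congr (tofrac _ *: _).
  rewrite -[LHS]coefK (poly_def (size (p i))).
  have := xB i; rewrite pP => /vle_tofrac_size sp.
  rewrite (big_ord_widen (d i) (fun j => (p i)`_j *: 'X^j)); last first.
    by move: sp; have := rm i; rewrite /d; move: (size _); lia.
  rewrite big_mkcond; apply: eq_bigr => j _; case: ltnP => // pj.
  by rewrite nth_default // scale0r.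
Qed.

Section SumOfDimensions.
Variables (O Ooo : set F) (sO : submodule C O) (sOoo : submodule C Ooo).
Hypotheses (MO : (M `<=` O)%classic) (NOoo : (box 0 `<=` Ooo)%classic).

Let L (m : nat) : set F := [set z | O z /\ Ooo (z / tF ^+ m)].

Let tFX0 (m : nat) : tF ^+ m != 0. Proof. by rewrite expf_neq0 ?tF_neq0. Qed.

Let boxM (m : nat) : box m = [set z | box 0 (z / tF ^+ m)]%classic.
Proof.
apply/seteqP; split=> z /=; rewrite exprnN (box_scale 0 (- m%:Z)) sub0r opprK.
  by [].
by [].
Qed.

Let sL m : submodule C (L m).
Proof.
split=> [|x y [Ox Px] [Oy Py]|c x Cc [Ox Px]].
- by split; rewrite ?mul0r; [exact: submod0 sO|exact: submod0 sOoo].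
- by split; rewrite ?mulrDl; [exact: (submodD sO)|exact: (submodD sOoo)].
- by split; rewrite -?mulrA; [exact: (submodM sO)|exact: (submodM sOoo)].
Qed.

(* L m / (O cap t^m N) = Ooo / N and (O cap t^m N) / (M cap t^m N) = O / M,
   where N = box 0, since F = M + t^m N. *)
Theorem dim_split m l : (forall i, (r i <= m)%N) -> has_dim C (L m) [set 0] l ->
  exists d d', [/\ has_dim C O M d, has_dim C Ooo (box 0) d' &
    l = (d' + (d + \sum_i (m - r i).+1))%N].
Proof.
move=> rm hl; have sM := lat_submodule (pid_ringA (F := F)).
have subI (V W : set F) : submodule C V -> submodule C W ->
  submodule C (V `&` W)%classic.
  move=> sV sW; split=> [|x y [Vx Wx] [Vy Wy]|c x Cc [Vx Wx]].
  - by split; [exact: submod0 sV|exact: submod0 sW].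
  - by split; [exact: (submodD sV)|exact: (submodD sW)].
  - by split; [exact: (submodM sV)|exact: (submodM sW)].
have sOB := subI _ _ sO (box_submodule m); have sMB :=
  subI _ _ sM (box_submodule m).
have boxL : (box m `<=` [set z | Ooo (z / tF ^+ m)])%classic.
  by rewrite boxM => z; apply: NOoo.
have OBL : (O `&` box m `<=` L m)%classic by move=> z [Oz Bz]; split=> //;
  apply: boxL.
have MBOB : (M `&` box m `<=` O `&` box m)%classic by move=> z [Mz Bz];
  split=> //; apply: MO.
(* The two quotients of the filtration of L m have dimension at most l. The finiteness of O / M and
   Ooo / N originates here. *)
have [|d hd _] := has_dim_bound (N := l) subC sOB sMB.
  move=> a b Vb fb; rewrite -[a]card_ord.
  apply: (has_dim_free_le subC (submodule0 C) hl (b := b)) => [i|c Cc c0].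
    exact: OBL.
  by apply: fb => //; rewrite c0; apply: submod0 sMB.
have [|d' hd' _] := has_dim_bound (N := l) subC (sL m) sOB.
  move=> a b Vb fb; rewrite -[a]card_ord.
  apply: (has_dim_free_le subC (submodule0 C) hl (b := b)) => [//|c Cc c0].
  by apply: fb => //; rewrite c0; apply: submod0 sOB.
exists d, d'; split.
- apply: (has_dim_image (phi := idfun) subC sOB sM _ _ _ _ _ hd).
  + by split.
  + by move=> x [].
  + by move=> x [_ Bx] Mx; split.
  + by move=> x _ [].
  + move=> y Oy; have [a Ma Bya] := lat_box_cover rm y; exists (y - a).
      by split=> //; apply: (submodB subC sO) => //; apply: MO.
    by rewrite /= opprB addrC subrK.
- apply: (has_dim_image subC (sL m) (box_submodule 0)
    (linear_over_mul C (tF ^+ m)^-1)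
    _ _ _ _ hd').
  + by move=> x [].
  + by move=> x [Ox _] Bx; split=> //; rewrite boxM.
  + by move=> x _ [_]; rewrite boxM.
  + move=> y Py; have [a Ma Ba] := lat_box_cover rm (y * tF ^+ m).
    exists a; last by move: Ba; rewrite boxM /= mulrBl mulfK.
    split; first exact: MO.
    have -> : a / tF ^+ m = y - (y * tF ^+ m - a) / tF ^+ m.
      by rewrite mulrBl (mulfK (tFX0 m)) subKr.
    by apply: (submodB subC sOoo) => //; apply: boxL.
- apply: (has_dim_uniq subC (submodule0 C) hl).
  apply: (has_dim_add subC _ OBL sOB hd').
    by move=> _ ->; apply: submod0 sOB.
  apply: (has_dim_add subC _ MBOB sMB hd (lat_box_dim rm)).
  by move=> _ ->; apply: submod0 sMB.
Qed.

End SumOfDimensions.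
End Boxes.

(** * The power bases *)

Section PowerBasis.
Context {k : fieldType} {F : fieldExtType (ratfun k)}.
Local Notation K := (ratfun k).
Local Notation tofrac := (@FracField.tofrac {poly k}).
Local Notation n := (\dim {:F}).

Lemma clear_denominators (p : {poly K}) : exists c : {poly k},
  exists G : {poly {poly k}},
  c != 0 /\ map_poly tofrac G = tofrac c *: p.
Proof.
have [c c0 cP] := common_denominator (fun i : 'I_(size p) => p`_i).
have /choice[a aE] i : exists a, p`_i * tofrac c = tofrac a.
  have [ip|pi] := ltnP i (size p); first by have := cP (Ordinal ip).
  by exists 0; rewrite nth_default // mul0r rmorph0.
exists c, (\poly_(i < size p) a i); split=> //; apply/polyP => i.
rewrite coef_map coef_poly coefZ mulrC aE; case: ltnP => // pi.
rewrite -aE nth_default // mul0r; exact: (rmorph0 tofrac).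
Qed.

(** Divisibility in [{poly {poly k}}] is up to nonzero factors in k[t], so that clearing the
    denominators of a factor over k(t) yields a divisor of f of the same degree. *)
Lemma irreducible_fraction (f : {poly {poly k}}) (g : {poly K}) :
  irreducible_poly f -> g \is monic -> size g != 1 -> g %| map_poly tofrac f ->
  size g = size f.
Proof.
move=> [_ fI] mg sg /dvdpP[h fE].
have [c [G [c0 GE]]] := clear_denominators g.
have [c' [H [c0' HE]]] := clear_denominators h.
have tc0 : tofrac c != 0 by rewrite tofrac_eq0.
have sG : size G = size g.
  rewrite -(size_scale g tc0) -GE size_map_inj_poly ?rmorph0 //.
  by move=> x y /eqP; rewrite tofrac_eq => /eqP.
have Gf : G %| f.
  apply/Pdiv.Idomain.dvdpP; exists (c' * c, H); first by rewrite /= mulf_neq0.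
  apply: (map_inj_poly (f := tofrac)); [|exact: rmorph0|].
    by move=> x y /eqP; rewrite tofrac_eq => /eqP.
  rewrite rmorphM /= GE HE map_polyZ /= fE rmorphM -scalerAl -scalerAr scalerA.
  by rewrite mulrC.
by rewrite -sG; apply/eqp_size/fI => //; rewrite sG.
Qed.

Section Defining.
Variables (f : {poly {poly k}}) (theta : F).
Hypothesis df : defining_polynomial f theta.

Let fK := map_poly tofrac f.

Let mapE : map_poly (in_alg F \o tofrac) f = map_poly (in_alg F) fK.
Proof. by rewrite /fK -map_poly_comp. Qed.

Lemma defining_root : (map_poly (in_alg F) fK).[theta] = 0.
Proof. by case: df => _ _ _ /rootP rt _; rewrite -mapE. Qed.

Lemma defining_degree : adjoin_degree 1%VS theta = n.
Proof.
by case: df => _ _ _ _ th; rewrite adjoin_degreeE dimv1 divn1 th.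
Qed.

(** Over k(t), f is a multiple of the minimal polynomial of theta, which has degree n;
    irreducibility makes the degrees equal. *)
Lemma defining_size : size f = n.+1.
Proof.
case: df => mf irf _ rt th.
have [g gE] := polyOver1P (minPolyOver 1%VS theta).
have mg : g \is monic by rewrite -(map_monic (in_alg F)) -gE monic_minPoly.
have sg : size g = n.+1 by rewrite -(size_map_poly (in_alg F))
  -gE size_minPoly defining_degree.
rewrite -sg; apply/esym/irreducible_fraction => //.
  by rewrite sg -lt0n adim_gt0.
have : minPoly 1%VS theta %| map_poly (in_alg F) fK.
  apply: minPoly_dvdp; first by apply/polyOver1P; exists fK.
  exact/rootP/defining_root.
by rewrite gE dvdp_map.
Qed.

Definition power_tuple (z : F) : n.-tuple F := [tuple z ^+ i | i < n].

Lemma power_tupleE z i : tnth (power_tuple z) i = z ^+ i.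
Proof. by rewrite tnth_mktuple. Qed.

Lemma span_basis (e : n.-tuple F) :
  (forall x, exists c : 'I_n -> K, x = \sum_i c i *: tnth e i) ->
    basis_of {:F} e.
Proof.
move=> H; rewrite basisEdim size_tuple leqnn andbT; apply/subvP => x _.
have [c ->] := H x; apply: memv_suml => i _; apply: memvZ.
by apply: memv_span; apply: mem_tnth.
Qed.

Lemma power_basis : basis_of {:F} (power_tuple theta).
Proof.
apply: span_basis => x; case: df => _ _ _ _ th.
have xK : x \in <<1; theta>>%VS by rewrite th memvf.
have /choice[c cE] i : exists c, (Fadjoin_poly 1%VS theta x)`_i = in_alg F c.
  have /polyOverP/(_ i)/vlineP[c ->] := Fadjoin_polyOver 1%VS theta x.
  by exists c.
exists c; rewrite -[LHS](Fadjoin_poly_eq xK) (@horner_coef_wide _ n);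
  last first.
  by rewrite -defining_degree size_Fadjoin_poly.
by apply: eq_bigr => i _; rewrite cE power_tupleE mulr_algl.
Qed.

End Defining.

(** The monic equation expresses z^n by lower powers, so the R-span of 1, ..., z^(n-1) is stable
    under multiplication by z. *)
Lemma ring_adjoin_lat (R : set K) sg (z : F) (p : {poly K}) :
  pid_ring (F := F) R sg -> basis_of {:F} (power_tuple z) ->
  p \is monic -> size p = n.+1 -> (forall i, R p`_i) ->
  (map_poly (in_alg F) p).[z] = 0 -> ring_adjoin R z = lat R (power_tuple z).
Proof.
move=> pR bz mp sp Rp pz; have R0 := pid0 pR.
have latD x y : lat R (power_tuple z) x -> lat R (power_tuple z) y ->
  lat R (power_tuple z) (x + y).
  by move=> xR yR i; rewrite linearD; apply: (pidD pR (xR i) (yR i)).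
have latZ c x : R c -> lat R (power_tuple z) x ->
  lat R (power_tuple z) (c *: x).
  by move=> Rc xR i; rewrite linearZ; apply: (pidM pR Rc (xR i)).
have lat0 : lat R (power_tuple z) 0 by move=> i; rewrite linear0.
have latX m : (m < n)%N -> lat R (power_tuple z) (z ^+ m).
  move=> mn i; rewrite -(power_tupleE z (Ordinal mn)) coord_gen //.
  by case: (i == _); [apply: (pid1 pR)|].
have latS I (s : seq I) (c : I -> F) : (forall i,
  lat R (power_tuple z) (c i)) ->
    lat R (power_tuple z) (\sum_(i <- s) c i).
  by move=> cR; elim/big_ind: _ => //.
have zn : lat R (power_tuple z) (z ^+ n).
  have -> : z ^+ n = \sum_(i < n) (- p`_i) *: z ^+ i.
    move: pz; rewrite horner_coef size_map_poly sp big_ord_recr /= !coef_map /=.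
    have -> : p`_n = 1 by move: mp; rewrite monicE lead_coefE sp => /eqP.
    rewrite scale1r mul1r => /eqP; rewrite addrC addr_eq0 => /eqP->.
    rewrite -sumrN; apply: eq_bigr => i _.
    by rewrite coef_map /= scaleNr mulr_algl.
  by apply: latS => i; apply: latZ; [apply: (pidN pR)|apply: latX].
have latz x : lat R (power_tuple z) x -> lat R (power_tuple z) (z * x).
  move=> xR; rewrite (coord_sum x bz) mulr_sumr; apply: latS => i.
  rewrite -scalerAr power_tupleE -exprS; apply: latZ; first exact: xR.
  have := ltn_ord i; rewrite leq_eqVlt => /orP[/eqP->//|]; exact: latX.
apply/seteqP; split=> [_ [q Rq <-]|x xR].
  rewrite horner_coef; apply: latS => i; rewrite coef_map mulr_algl.
  apply: latZ => //; elim: (i : nat) => [|j IH]; last by rewrite exprS;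
    apply: latz.
  by apply: latX; rewrite adim_gt0.
exists (\sum_(i < n) coord (power_tuple z) i x *: 'X^i).
  move=> j; rewrite coef_sum; apply: (pid_sum pR) => i; rewrite coefZ coefXn.
  by apply: (pidM pR (xR i)); case: (_ == _); [apply: (pid1 pR)|].
rewrite rmorph_sum horner_sum [RHS](coord_sum x bz); apply: eq_bigr => i _.
by rewrite -mul_polyC rmorphM /= map_polyC map_polyXn hornerM hornerC hornerXn power_tupleE mulr_algl.
Qed.

(** * The power basis at infinity *)

Section InfinityBasis.
Variables (f : {poly {poly k}}) (theta : F).
Hypothesis df : defining_polynomial f theta.

Let c0 : nat := Cf f.
Let theta_oo : F := (tK ^- c0) *: theta.

(** These are the weights of the box equal to A_oo[theta_oo], whose basis consists of the theta^i /
    t^(C_f i). *)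
Definition pole_order (i : 'I_n) : nat := (c0 * i)%N.

Lemma Cf_bound i : (i < n)%N -> ((size (f`_i)%R).-1 <= c0 * (n - i))%N.
Proof.
move=> ni; rewrite /c0 /Cf (defining_size df) /=.
have : (((size (f`_(n - (n - i)))%R).-1 + (n - i).-1) %/ (n - i) <=
    \max_(1 <= j < n.+1) ((size (f`_(n - j))%R).-1 + j.-1) %/ j)%N.
  apply: (@leq_bigmax_seq _ _ _ (fun j => ((size (f`_(n - j))%R).-1 + j.-1)
    %/ j)%N) => //.
  by rewrite mem_index_iota subn_gt0 ni ltnS leq_subr.
rewrite subKn ?(ltnW ni) //; move: (\max_(_ <= _ < _) _)%N => M.
have : (0 < n - i)%N by rewrite subn_gt0.
case: (n - i)%N => // j _ H; rewrite -ltnS ltn_divLR // in H.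
by move: H; rewrite /= mulSn; move: (size _) (M * j.+1)%N; lia.
Qed.

(** This is f_oo(1/t, x) = t^(-n C_f) f(t, t^(C_f) x). *)
Let poo : {poly K} := \poly_(i < n.+1) (tofrac f`_i / tK ^+ (c0 * (n - i))).

Let f_lead : f`_n = 1.
Proof. by case: df => mf _ _ _ _; move: mf;
  rewrite monicE lead_coefE (defining_size df) => /eqP. Qed.

Lemma theta_oo_X i : theta_oo ^+ i = (tK ^- (c0 * i)) *: theta ^+ i.
Proof. by rewrite /theta_oo exprZn exprVn -exprM. Qed.

Lemma theta_oo_basis : basis_of {:F} (power_tuple theta_oo).
Proof.
apply: span_basis => x; exists (fun i => coord (power_tuple theta) i x *
  tK ^+ (c0 * i)).
rewrite {1}(coord_sum x (power_basis df)); apply: eq_bigr => i _.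
rewrite !power_tupleE theta_oo_X scalerA mulfK //;
  exact: (expf_neq0 _ (@tK_neq0 k)).
Qed.

Lemma ring_adjoin_finite : ring_adjoin ringA theta =
  lat ringA (power_tuple theta).
Proof.
apply: (ring_adjoin_lat (p := map_poly tofrac f) (pid_ringA (F := F))
  (power_basis df)).
- by apply: monic_map; case: df.
- rewrite size_map_inj_poly ?rmorph0 ?(defining_size df) //.
  by move=> x y /eqP; rewrite tofrac_eq => /eqP.
- by move=> i; rewrite coef_map; apply: ringA_mem.
- exact: (defining_root df).
Qed.

Lemma theta_oo_equation : exists p : {poly K}, [/\ p \is monic, size p = n.+1,
  forall i, ringAoo p`_i & (map_poly (in_alg F) p).[theta_oo] = 0].
Proof.
have tX0 j : (tK : K) ^+ j != 0 := expf_neq0 _ (@tK_neq0 k).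
have pn : poo`_n = 1 by
  rewrite coef_poly ltnSn subnn muln0 f_lead rmorph1 divr1.
have spoo : size poo = n.+1.
  by rewrite size_poly_eq // subnn muln0 f_lead rmorph1 divr1 oner_eq0.
exists poo; split; [|exact: spoo| |].
- by rewrite monicE lead_coefE spoo pn.
- move=> i; rewrite coef_poly ltnS; case: ifP => [|_]; last by left.
  rewrite leq_eqVlt => /orP[/eqP->|ni].
    by rewrite subnn muln0 f_lead rmorph1 divr1; right; rewrite degK1.
  have [->|fi0] := eqVneq (f`_i) 0; first by rewrite rmorph0 mul0r; left.
  have tfi0 : tofrac (f`_i) != 0 by rewrite tofrac_eq0.
  right; rewrite (degKM tfi0 (invr_neq0 (tX0 _))) (degKV (tX0 _))
    (degK_tofrac fi0).
  rewrite -[degK (_ ^+ _)]/(degK (tK ^ (c0 * (n - i))%N%:Z)) degK_tKXz.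
  by have := Cf_bound ni; lia.
have fn : (map_poly (in_alg F) (map_poly tofrac f)).[theta] =
    \sum_(i < n.+1) in_alg F (tofrac f`_i) * theta ^+ i.
  rewrite (@horner_coef_wide _ n.+1); last first.
    by rewrite size_map_poly (leq_trans (size_poly _ _)) // (defining_size df).
  by apply: eq_bigr => i _; rewrite !coef_map.
rewrite (@horner_coef_wide _ n.+1); last by rewrite size_map_poly spoo.
have E (i : 'I_n.+1) : (map_poly (in_alg F) poo)`_i * theta_oo ^+ i =
    in_alg F (tK ^- (c0 * n)) * (in_alg F (tofrac f`_i) * theta ^+ i).
  have tn : (tK : K) ^+ (c0 * n) = tK ^+ (c0 * (n - i)) * tK ^+ (c0 * i).
    by rewrite -exprD -mulnDr subnK // -ltnS.
  rewrite coef_map coef_poly ltn_ord theta_oo_X -[_ *: theta ^+ i]mulr_algl [LHS]mulrA.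
  rewrite [RHS]mulrA -!rmorphM /= tn invfM; congr (_ *: _ * _).
  by rewrite -mulrA mulrC.
rewrite (eq_bigr _ (fun i _ => E i)) -mulr_sumr -fn (defining_root df) mulr0 //.
Qed.

Lemma ring_adjoin_infinite : ring_adjoin ringAoo theta_oo =
  lat ringAoo (power_tuple theta_oo).
Proof.
have [p [mp sp Rp pz]] := theta_oo_equation.
exact: (ring_adjoin_lat (pid_ringAoo (F := F)) theta_oo_basis mp sp Rp pz).
Qed.

End InfinityBasis.
End PowerBasis.

(** * The genus *)

Section FullConstants.
Context {k : fieldType} {F : fieldExtType (ratfun k)}.
Local Notation kconst := (@kconst k F).
Local Notation C := (@base_constants k F).
Local Notation k0 := (@full_constants k F).
Local Notation d0 := (constant_degree F).

Let subC := base_constants_subfield (F := F).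

Lemma full_constants_subfield : subfield k0.
Proof.
split=> [|x y|x y|x].
- exact: (algebraic1 kconst).
- exact: (@algebraic_sub _ _ kconst).
- exact: (@algebraic_mul _ _ kconst).
- exact: (@algebraic_inv _ _ kconst).
Qed.

Lemma base_full_constants : (C `<=` k0)%classic.
Proof. by move=> _ [c _ <-]; apply: (algebraic_id kconst). Qed.

Lemma vge_full_submodule (P : place F) m : submodule k0 (vge P m).
Proof.
split=> [|x y|c x cA Px]; [exact: vge0|exact: vgeD|].
rewrite -[m]add0r; apply: vgeM => //.
by right; rewrite algebraic_val.
Qed.

Lemma rrspace_full_submodule beta : submodule k0 (rrspace (F := F) beta).
Proof.
split=> [P|x y Bx By P|c x Cc Bx P]; [exact: vge0|exact: vgeD|].
exact: (submodM (vge_full_submodule P _)).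
Qed.

(** Constants have value 0 at every place, so k_0 lies in the finite-dimensional space L(0). *)
Lemma constant_degreeP : has_dim C k0 [set 0] d0.
Proof.
have k0S : submodule C k0.
  split; [exact: (subfield0 full_constants_subfield)| |].
    by move=> x y; apply: (subfieldD full_constants_subfield).
  by move=> c x /base_full_constants;
    apply: (subfieldM full_constants_subfield).
have [l hl] := @rrspace_finite k F [::] (fun=> 0) (fun P _ => lexx 0).
have [|x k0x P|x _ //|d hd _] := has_dim_inj (V := k0) (W := [set 0]%classic)
    (phi := idfun) subC k0S (submodule0 C) (submodule0 C) _ _ _ hl.
- by split.
- by right; rewrite (algebraic_val P k0x) oppr0.
exact: has_dim_const subC (submodule0 C) hd.
Qed.

Lemma constant_degree_gt0 : (0 < d0)%N.
Proof.
rewrite lt0n; apply/eqP => d00; have := constant_degreeP; rewrite d00.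
move=> [b [_ _ /(_ 1 (subfield1 full_constants_subfield)) [c _]]].
by rewrite big_ord0 subr0 => /eqP; rewrite oner_eq0.
Qed.

Lemma constant_degree1 : d0 = 1%N -> C = k0.
Proof.
move=> d01; apply/seteqP; split; first exact: base_full_constants.
have := constant_degreeP; rewrite d01 => -[b [_ _ sb]] x k0x.
have [c Cc] := sb 1 (subfield1 full_constants_subfield).
have [e Ce] := sb x k0x; rewrite !big_ord1 => /eqP; rewrite subr_eq0 => /eqP->.
move=> /eqP; rewrite subr_eq0 => /eqP cb.
have c0 : c ord0 != 0.
  by apply: contra_eqN cb => /eqP->; rewrite mul0r oner_eq0.
have -> : b ord0 = (c ord0)^-1 by apply: (mulfI c0); rewrite -cb mulfV.
by apply: (subfieldM subC (Ce _)); apply: (subfieldV subC).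
Qed.

Lemma full_const_dim V W D : submodule k0 V -> submodule k0 W ->
  has_dim C V W D -> (const_dim k0 V W * d0)%N = D.
Proof.
move=> sV sW hD; have sWC := submodule_sub base_full_constants sW.
have [a b Vb fb|f hf _] := has_dim_bound (N := D) full_constants_subfield sV sW.
  rewrite -[a]card_ord; apply: (has_dim_free_le subC sWC hD Vb) => c Cc.
  by apply: fb => i; apply: base_full_constants.
rewrite (const_dimE full_constants_subfield sW hf).
apply: (has_dim_uniq subC sWC _ hD).
exact: (has_dim_tower subC full_constants_subfield base_full_constants sV sW
  constant_degreeP hf).
Qed.

Lemma place_degree_full P : (place_degree k0 P * d0)%N = resdeg P.
Proof.
rewrite /place_degree place_ringE place_idealE.
by apply: full_const_dim (resdegP P); apply: vge_full_submodule.
Qed.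

Lemma divisor_degreeE Cst (B : divisor F) s : uniq s ->
  (forall P, P \notin s -> B P = 0) ->
  divisor_degree Cst B = \sum_(P <- s) B P * (place_degree Cst P)%:Z.
Proof.
move=> us Bs; rewrite /divisor_degree.
rewrite (bigID (fun P => B P == 0)) /= big1 ?add0r; last first.
  by move=> P /eqP->; rewrite mul0r.
rewrite [RHS](bigID (fun P => B P == 0)) /= [X in _ = X + _]big1 ?add0r;
  last first.
  by move=> P /eqP->; rewrite mul0r.
rewrite -big_filter -[RHS]big_filter; apply: perm_big.
apply: uniq_perm; rewrite ?filter_uniq ?fset_uniq // => P.
rewrite !mem_filter mem_finsupp; case: eqP => //= /eqP B0.
by apply/esym; apply: contraNT B0 => /Bs->.
Qed.

Lemma genus_defect_full (B : divisor F) s : uniq s ->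
  (forall P, P \notin s -> B P = 0) ->
  genus_defect k0 B * d0%:Z =
  \sum_(P <- s) B P * (resdeg P)%:Z - (ell B)%:Z + d0%:Z.
Proof.
move=> us Bs; rewrite /genus_defect (divisor_degreeE _ us Bs) rrspaceE.
rewrite mulrDl mulrBl mul1r mulr_suml; congr (_ - _ + _).
  by apply: eq_bigr => P _; rewrite -mulrA -PoszM place_degree_full.
rewrite -PoszM; congr (_%:Z); apply: full_const_dim.
- exact: rrspace_full_submodule.
- exact: submodule0.
- by apply: (@ellP _ _ s) => P /Bs->.
Qed.

End FullConstants.

(** * Riemann's inequality *)

Section GenusFormula.
Context {k : fieldType} {F : fieldExtType (ratfun k)}.
Local Notation C := (@base_constants k F).
Local Notation k0 := (@full_constants k F).
Local Notation d0 := (constant_degree F).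
Local Notation polyF := (@polyF k F).
Local Notation tF := (@tF k F).
Local Notation n := (\dim {:F}).

Let subC := base_constants_subfield (F := F).

Lemma sum_support (T : eqType) (s s' : seq T) (g : T -> int) : uniq s ->
  uniq s' ->
  {subset s' <= s} -> (forall P, P \notin s' -> g P = 0) ->
  \sum_(P <- s) g P = \sum_(P <- s') g P.
Proof.
move=> us us' ss g0; rewrite (bigID (mem s')) /= [X in _ + X]big1 ?addr0 //.
rewrite -big_filter; apply: perm_big; apply: uniq_perm => //.
  exact: filter_uniq.
by move=> P; rewrite mem_filter; case Ps': (P \in s') => //=; rewrite ss.
Qed.

Definition zero_divisor (a : {poly k}) (P : place F) : int :=
  Num.max 0 (P (polyF a)).

Lemma zero_divisor_support (a : {poly k}) : a != 0 ->
  exists s, [/\ uniq s, forall P, P \notin s -> zero_divisor a P = 0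
    & \sum_(P <- s) zero_divisor a P * (resdeg P)%:Z <= n%:Z * (size a).-1%:Z].
Proof.
move=> a0; have [s us sP] := zeros_finite (F := F) (u := 1) a0 (oner_neq0 _).
have E (P : place F) : P (polyF a / polyF 1) = P (polyF a)
  by rewrite rmorph1 divr1.
exists s; split=> // [P Ps|].
  apply/max_idPl; rewrite leNgt; apply: contra Ps => Pa.
  by apply/sP; rewrite E.
have := @sum_resdeg_leq _ F s a 1 (size a).-1 us a0 (oner_neq0 _).
rewrite size_poly1 => /(_ (leqSpred _) isT).
have pos (P : place F) : P \in s -> 0 <= P (polyF a / polyF 1)
  by move=> /sP/ltW.
move=> /(_ pos); rewrite -lez_nat PoszM; apply: le_trans.
rewrite (big_morph Posz PoszD (erefl 0%:Z)) big_seq [X in _ <= X]big_seq.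
apply: ler_sum => P Ps; rewrite PoszM ler_wpM2r // gez0_abs ?pos // E.
by rewrite /zero_divisor ge_max lexx andbT -E pos.
Qed.

(** Where t is regular, all nonzero polynomials have nonnegative value, so one of nonzero value is
    positive there. The product of the m-th powers of such polynomials works. *)
Lemma dominate_finite (s : seq (place F)) (m : nat) : exists2 a : {poly k},
  a != 0 &
  forall P, P \in s -> 0 <= P tF -> m%:Z <= P (polyF a).
Proof.
have pos (P : place F) (a : {poly k}) : 0 <= P tF -> a != 0 -> 0 <= P (polyF a).
  move=> Pt a0; have pa0 : polyF a != 0 by rewrite polyF_eq0.
  by have /(vgeE _ _ pa0) := vge_polyF a Pt.
elim: s => [|Q s [a a0 IH]]; first by exists 1; rewrite ?oner_eq0.
have [b b0 Qb] := nonconst_val Q.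
exists (a * b ^+ m); first by rewrite mulf_neq0 ?expf_neq0.
have pa0 : polyF a != 0 by rewrite polyF_eq0.
have pb0 : polyF b ^+ m != 0 by rewrite expf_neq0 ?polyF_eq0.
move=> P; rewrite inE rmorphM rmorphXn (val_atM P pa0 pb0) val_atX.
case/predU1P=> [->|Ps] Pt.
  have := pos Q a Pt a0; have := pos Q b Pt b0; move: Qb.
  by rewrite neq_lt => /orP[]; nia.
by have := IH P Ps Pt; have := pos P b Pt b0; nia.
Qed.

Lemma ell_zero_divisor (a : {poly k}) (m : nat) : a != 0 ->
  ell (fun P => m%:Z * pole_divisor P + zero_divisor a P) =
  ell (fun P : place F => (m + (size a).-1)%N%:Z * pole_divisor P).
Proof.
move=> a0; have pa0 : polyF a != 0 by rewrite polyF_eq0.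
(* The principal divisor of a is (a)_0 - (deg a) D. *)
have shift (P : place F) : P (polyF a) = zero_divisor a P - (size a).-1%:Z *
  pole_divisor P.
  rewrite /zero_divisor /pole_divisor; case: ltP => Pt.
    by rewrite (val_polyF_infinite Pt a0); nia.
  have /(vgeE _ _ pa0) := vge_polyF a Pt; lia.
have [s us sP] := infinite_places (F := F).
have [sa [usa saP _]] := zero_divisor_support a0.
have pd0 (P : place F) : P \notin s -> pole_divisor P = 0.
  by move=> Ps; rewrite /pole_divisor; case: ifP => // /sP; rewrite (negPf Ps).
set beta := fun P => _ + _.
have hl : has_dim C (rrspace beta) [set 0] (ell beta).
  apply: (@ellP _ _ (s ++ sa)) => P; rewrite mem_cat negb_or =>
    /andP[/pd0 E1 /saP E2].
  by rewrite /beta E1 E2 mulr0.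
apply/esym/(const_dimE subC (submodule0 C)).
apply: (has_dim_image subC (rrspace_submodule beta) (submodule0 C)
  (linear_over_mul C (polyF a)) _ _ _ _ hl).
- move=> z zb P; apply: (@vge_le _ _ _ (- beta P + P (polyF a))).
    by rewrite shift /beta PoszD; lia.
  by apply: vgeM (zb P) _; right.
- by move=> z _ /eqP; rewrite mulf_eq0 (negPf pa0) orbF => /eqP.
- by move=> z _ ->; rewrite /= mul0r.
move=> y yb; exists (y / polyF a); last by rewrite divfK ?subrr.
move=> P; apply: (@vge_le _ _ _ (- ((m + (size a).-1)%N%:Z * pole_divisor P)
  - P (polyF a))).
  by rewrite shift /beta PoszD; lia.
by apply: vgeM (yb P) _; right; rewrite val_atV.
Qed.

(* When l(m D) grows like n m + x for the pole divisor D of t, Riemann's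
   inequality holds with the constant - x and is sharp for the multiples of D.
     *)
Section Riemann.
Variables (m0 : nat) (x : int).
Hypothesis ellE : forall m, (m0 <= m)%N ->
  (ell (fun P : place F => m%:Z * pole_divisor P))%:Z = n%:Z * m%:Z + x.

Let pd0 (s : seq (place F)) : (forall P : place F, P tF < 0 <-> P \in s) ->
  forall P, P \notin s -> pole_divisor P = 0.
Proof. by move=> sP P Ps; rewrite /pole_divisor; case: ifP => // /sP;
  rewrite (negPf Ps). Qed.

Let pd_ge0 (P : place F) : 0 <= pole_divisor P.
Proof. by rewrite /pole_divisor; case: ifP => // Pt; lia. Qed.

Lemma pole_divisor_degreeE (s : seq (place F)) : uniq s -> (forall P : place F,
  P tF < 0 <-> P \in s) ->
  \sum_(P <- s) pole_divisor P * (resdeg P)%:Z = n%:Z.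
Proof.
move=> us sP; apply/eqP; rewrite eq_le pole_divisor_degree //=.
set D := \sum_(P <- s) _; rewrite leNgt; apply/negP => Dn.
pose l0 := ell (fun=> 0 : int) (k := k) (F := F).
(* Comparison with L(0) gives m (n - deg D) <= l(0) - x; this m violates it if deg D < n. *)
pose m := (m0 + l0 + absz x).+1.
have m0m : (m0 <= m)%N by rewrite /m; lia.
have [|||_] := @ell_mono k F s (fun=> 0) (fun P => m%:Z * pole_divisor P) us.
- by move=> P; rewrite mulr_ge0.
- by [].
- by move=> P /(pd0 sP)->; rewrite mulr0.
rewrite big1 ?sub0r; last by move=> P _; rewrite mul0r.
rewrite (ellE m0m) (eq_bigr (fun P => m%:Z * (pole_divisor P *
  (resdeg P)%:Z))); last first.
  by move=> P _; rewrite mulrA.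
rewrite -mulr_sumr -/D -/l0 /m; move: D Dn => D Dn; nia.
Qed.

Lemma riemann_bound (B : divisor F) : genus_defect k0 B * d0%:Z <= d0%:Z - x.
Proof.
have [soo uoo sP] := infinite_places (F := F).
have [mB HmB] : exists mB : nat, forall P, B P <= mB%:Z.
  have [mB H] := seq_bound (finsupp B) (fun P => B P).
  exists mB => P; have [Ps|Ps] := boolP (P \in finsupp B);
    first by have := H P Ps; lia.
  by rewrite fsfun_dflt.
have [a a0 Ha] := dominate_finite (finsupp B) mB.
have [sa [usa saP sad]] := zero_divisor_support a0.
(* The part mB makes m D dominate B at the poles of t, while (a)_0 does so at the other places; the
   part m0 makes [ellE] applicable. *)
pose m := (m0 + mB)%N; pose s := undup (finsupp B ++ soo ++ sa).
have us : uniq s by apply: undup_uniq.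
have in_s P : P \notin s -> [/\ B P = 0, pole_divisor P =
  0 & zero_divisor a P = 0].
  rewrite mem_undup !mem_cat !negb_or => /and3P[PB Poo Pa].
  by rewrite fsfun_dflt // (pd0 sP) // saP.
pose beta P := m%:Z * pole_divisor P + zero_divisor a P.
have Bbeta P : B P <= beta P.
  have za : 0 <= zero_divisor a P by rewrite /zero_divisor le_max lexx.
  rewrite /beta; have := HmB P; have [Pt|Pt] := ltP (P tF) 0.
    by rewrite /pole_divisor Pt /m; nia.
  rewrite /pole_divisor ltNge Pt mulr0 add0r => BP.
  have [Ps|Ps] := boolP (P \in finsupp B); last by rewrite fsfun_dflt.
  by have := Ha P Ps Pt; rewrite /zero_divisor; lia.
rewrite (genus_defect_full us); last by move=> P /in_s[].
have [||_] := ell_mono us Bbeta.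
- by move=> P /in_s[].
- by move=> P /in_s[_ E1 E2]; rewrite /beta E1 E2 mulr0.
rewrite ell_zero_divisor // ellE; last by rewrite /m; lia.
have -> : \sum_(P <- s) beta P * (resdeg P)%:Z =
    m%:Z * n%:Z + \sum_(P <- sa) zero_divisor a P * (resdeg P)%:Z.
  rewrite -(pole_divisor_degreeE uoo sP) mulr_sumr.
  rewrite -(@sum_support _ s soo) //; last first.
  - by move=> P /(pd0 sP)->; rewrite mul0r mulr0.
  - by move=> P Ps; rewrite mem_undup !mem_cat Ps orbT.
  rewrite -(@sum_support _ s sa) //; last first.
  - by move=> P /saP->; rewrite mul0r.
  - by move=> P Ps; rewrite mem_undup !mem_cat Ps !orbT.
  by rewrite -big_split; apply: eq_bigr => P _; rewrite /beta /= mulrDl mulrA.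
(* deg beta - l(beta) equals m n + deg (a)_0 - n (m + deg a) - x, which is at most - x. *)
move: sad; rewrite PoszD mulrDr (mulrC m%:Z).
move: (\sum_(P <- sa) _) (\sum_(P <- s) _) (n%:Z * m%:Z) (n%:Z * _)
  => S1 S2 u v.
by move: (ell _); clear; lia.
Qed.

Lemma riemann_sharp : exists B : divisor F, genus_defect k0 B * d0%:Z =
  d0%:Z - x.
Proof.
have [s us sP] := infinite_places (F := F).
pose B : divisor F := [fsfun P in [fset Q | Q in s]%fset => m0%:Z *
  pole_divisor P | 0].
have BE : B = (fun P => m0%:Z * pole_divisor P) :> (place F -> int).
  apply/funext => P; rewrite fsfunE inE; case: ifP => // /negbT Ps.
  by rewrite (pd0 sP Ps) mulr0.
have BP P : B P = m0%:Z * pole_divisor P by rewrite BE.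
exists B; rewrite (genus_defect_full us); last first.
  by move=> P Ps; rewrite BP (pd0 sP Ps) mulr0.
rewrite BE ellE //.
rewrite (eq_bigr (fun P => m0%:Z * (pole_divisor P * (resdeg P)%:Z)));
  last first.
  by move=> P _; rewrite -mulrA.
by rewrite -mulr_sumr (pole_divisor_degreeE us sP); lia.
Qed.

Lemma genus_exists : exists2 g : int, is_genus k0 g & g * d0%:Z = d0%:Z - x.
Proof.
have [B HB] := riemann_sharp; exists (genus_defect k0 B) => //.
split; first by exists B.
move=> B'; have := riemann_bound B'; rewrite -HB ler_pM2r //.
by rewrite ltz_nat constant_degree_gt0.
Qed.

End Riemann.
End GenusFormula.

(** * The dimension of L(m D) in terms of the two indices *)

Section EllFormula.
Context {k : fieldType} {F : fieldExtType (ratfun k)}.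
Local Notation C := (@base_constants k F).
Local Notation tF := (@tF k F).
Local Notation n := (\dim {:F}).

Lemma alg_scale (c : ratfun k) (x : F) : c *: x = in_alg F c * x.
Proof. by rewrite mulr_algl. Qed.

Lemma emb_mem (R : set (ratfun k)) c : R c -> emb (F := F) R (in_alg F c).
Proof. by move=> Rc; exists c. Qed.

Lemma integral_closureD_finite (x y : F) : integral_closure ringA x ->
  integral_closure ringA y -> integral_closure ringA (x + y).
Proof.
move=> /integral_closure_finite Ox /integral_closure_finite Oy.
by apply/integral_closure_finite => P Pt; apply: vgeD; [apply: Ox|apply: Oy].
Qed.

Lemma integral_closureZ_finite c (x : F) : ringA c ->
  integral_closure ringA x ->
  integral_closure ringA (c *: x).
Proof.
move=> [a _ <-] /integral_closure_finite Ox; apply/integral_closure_finite =>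
  P Pt.
rewrite alg_scale -[0]addr0; apply: vgeM; last exact: Ox.
exact: (vge_polyF a Pt).
Qed.

Lemma integral_closureD_infinite (x y : F) : integral_closure ringAoo x ->
  integral_closure ringAoo y -> integral_closure ringAoo (x + y).
Proof.
move=> /integral_closure_infinite Ox /integral_closure_infinite Oy.
by apply/integral_closure_infinite => P Pt; apply: vgeD; [apply: Ox|apply: Oy].
Qed.

Lemma vge_ringAoo (P : place F) c : P tF < 0 -> ringAoo c ->
  vge P 0 (in_alg F c).
Proof.
move=> Pt Rc; have [->|c0] := eqVneq c 0; first by left; rewrite rmorph0.
right; rewrite (val_alg_infinite Pt c0).
by case: Rc => [/eqP|]; [rewrite (negPf c0)|nia].
Qed.

Lemma integral_closureZ_infinite c (x : F) : ringAoo c ->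
  integral_closure ringAoo x ->
  integral_closure ringAoo (c *: x).
Proof.
move=> Rc /integral_closure_infinite Ox; apply/integral_closure_infinite =>
  P Pt.
rewrite alg_scale -[0]addr0; apply: vgeM; last exact: Ox.
exact: vge_ringAoo.
Qed.

Variables (f : {poly {poly k}}) (theta : F).
Hypothesis df : defining_polynomial f theta.

Let theta_oo : F := (tK ^- Cf f) *: theta.
Let e := power_tuple theta.
Let e_oo := power_tuple theta_oo.
Let O : set F := integral_closure ringA.
Let Ooo : set F := integral_closure ringAoo.

Lemma lat_closure (R : set (ratfun k)) (z : F) (M : set F) :
  (forall x y, M x -> M y -> M (x + y)) -> (forall c x, R c -> M x ->
    M (c *: x)) ->
  basis_of {:F} (power_tuple z) -> M 0 -> (forall i : nat, M (z ^+ i)) ->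
  (lat R (power_tuple z) `<=` M)%classic.
Proof.
move=> MD MZ bz M0 MX x xR; rewrite (coord_sum x bz).
elim/big_ind: _ => [//|//|i _]; apply: MZ; first exact: xR.
by rewrite power_tupleE.
Qed.

Lemma finite_lat_closure : (lat ringA e `<=` O)%classic.
Proof.
have th : integral_over (emb (F := F) ringA) theta.
  exists (map_poly (in_alg F) (map_poly (@FracField.tofrac {poly k}) f)).
    by rewrite map_monic; apply: monic_map; case: df.
  split=> [i|]; last exact: defining_root.
  by rewrite !coef_map; apply/emb_mem/ringA_mem.
apply: lat_closure (power_basis df) _ _.
- exact: integral_closureD_finite.
- exact: integral_closureZ_finite.
- by apply/integral_closure_finite => P _; apply: vge0.
move=> i; apply/integral_closure_finite => P Pt;
  apply: (subringX (vge_subring P)).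
by apply: (integral_vge _ th) => _ [_ [a _ <-] ->]; apply: (vge_polyF a Pt).
Qed.

Lemma infinite_lat_closure : (lat ringAoo e_oo `<=` Ooo)%classic.
Proof.
have [p [mp sp Rp pz]] := theta_oo_equation df.
have th : integral_over (emb (F := F) ringAoo) theta_oo.
  exists (map_poly (in_alg F) p); first by rewrite map_monic.
  by split=> // i; rewrite coef_map; apply/emb_mem/Rp.
apply: lat_closure (theta_oo_basis df) _ _.
- exact: integral_closureD_infinite.
- exact: integral_closureZ_infinite.
- by apply/integral_closure_infinite => P _; apply: vge0.
move=> i; apply/integral_closure_infinite => P Pt;
  apply: (subringX (vge_subring P)).
by apply: (integral_vge _ th) => _ [c Rc ->]; apply: vge_ringAoo.
Qed.

(** The i-th coordinate in the powers of theta_oo is t^(C_f i) times that in the powers of theta, so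
    that lying in A_oo becomes a degree bound on the latter. *)
Lemma infinite_lat_box : lat ringAoo e_oo = box e (pole_order f) 0.
Proof.
have tX0 j : (tK : ratfun k) ^+ j != 0 := expf_neq0 _ (@tK_neq0 k).
have be_oo := theta_oo_basis df.
have coordE i x : coord e_oo i x = coord e i x * tK ^+ (Cf f * i).
  have xE : x = \sum_i (coord e i x * tK ^+ (Cf f * i)) *: tnth e_oo i.
    rewrite {1}(coord_sum x (power_basis df)); apply: eq_bigr => j _.
    by rewrite !power_tupleE theta_oo_X scalerA (mulfK (tX0 _)).
  by rewrite {1}xE (coord_comb _ _ be_oo).
have degX (j : nat) : degK ((tK : ratfun k) ^+ j) = j.
  by rewrite -[LHS]/(degK (tK ^ j%:Z)) degK_tKXz.
apply/seteqP; split=> x xR i; have := xR i.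
  by rewrite ringAooE coordE => /(vleMz _ _ (tX0 _)); rewrite degX.
by rewrite ringAooE coordE -[X in _ - X]degX => /(vleMz _ _ (tX0 _)).
Qed.

Lemma sum_pole_order (m : nat) : (forall i, @pole_order k F f i <= m)%N ->
  ((\sum_i (m - @pole_order k F f i).+1)%N%:Z = n%:Z * (m%:Z + 1)
    - (Cf f)%:Z * (\sum_(i < n) i)%N%:Z).
Proof.
move=> rm; rewrite !(big_morph Posz PoszD (erefl 0%:Z)) mulr_sumr.
have -> : n%:Z * (m%:Z + 1) = \sum_(i < n) (m%:Z + 1).
  by rewrite sumr_const card_ord -mulr_natl natz.
rewrite -sumrB; apply: eq_bigr => i _.
by have := rm i; rewrite /pole_order; nia.
Qed.

(** Both quotient dimensions contribute positively; the second index enters with a minus sign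
    because it is minus the dimension. *)
Lemma ell_formula (m : nat) : (forall i, @pole_order k F f i <= m)%N ->
  (ell (fun P : place F => m%:Z * pole_divisor P))%:Z = n%:Z * m%:Z +
    (n%:Z - (Cf f)%:Z * (\sum_(i < n) i)%N%:Z
     + abs_lattice_index ringA O (ring_adjoin ringA theta)
     - abs_lattice_index ringAoo Ooo (ring_adjoin ringAoo theta_oo)).
Proof.
move=> rm; have pA := pid_ringA (F := F); have pO := pid_ringAoo (F := F).
have O0 : O 0 by apply/integral_closure_finite => P _; apply: vge0.
have Ooo0 : Ooo 0 by apply/integral_closure_infinite => P _; apply: vge0.
have sO : submodule C O.
  split=> [//||_ x [c _ <-] Ox]; first exact: integral_closureD_finite.
  rewrite kconst_scale; apply: integral_closureZ_finite => //.
  exact: (pid_const pA).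
have sOoo : submodule C Ooo.
  split=> [//||_ x [c _ <-] Ox]; first exact: integral_closureD_infinite.
  rewrite kconst_scale; apply: integral_closureZ_infinite => //.
  exact: (pid_const pO).
have boxO : (box e (pole_order f) 0 `<=` Ooo)%classic.
  by rewrite -infinite_lat_box; apply: infinite_lat_closure.
have [s us sP] := infinite_places (F := F).
have hl : has_dim C (lspace m) [set 0] (ell (fun P : place F => m%:Z *
  pole_divisor P)).
  rewrite lspaceE; apply: (@ellP _ _ s) => P Ps; rewrite /pole_divisor.
  by case: ifP => [/sP|_]; [rewrite (negPf Ps)|rewrite mulr0].
have [d [d' [hd hd' ->]]] :=
  dim_split (power_basis df) sO sOoo finite_lat_closure boxO rm hl.
rewrite (ring_adjoin_finite df) (ring_adjoin_infinite df).
rewrite (lattice_index_dim pA (power_basis df) (@integral_closureD_finite)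
  (@integral_closureZ_finite) finite_lat_closure hd).
rewrite -infinite_lat_box in hd'.
rewrite (lattice_index_dim pO (theta_oo_basis df) (@integral_closureD_infinite)
  (@integral_closureZ_infinite) infinite_lat_closure hd').
rewrite !PoszD (sum_pole_order rm); ring.
Qed.

End EllFormula.

Theorem corollary3p5 (k : fieldType) (F : fieldExtType (ratfun k))
    (f : {poly {poly k}}) (theta : F) (n : nat) :
  separable 1%VS {:F}%VS ->
  defining_polynomial f theta ->
  size f = n.+1 ->
  let theta_oo := (tK ^- Cf f) *: theta in
  let ind := abs_lattice_index ringA (integral_closure ringA)
               (ring_adjoin ringA theta) in
  let ind_oo := abs_lattice_index ringAoo (integral_closure ringAoo)
                  (ring_adjoin ringAoo theta_oo) in
  let d0 := constant_degree F in
  exists g : int,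
  [/\ @is_genus k F full_constants g,
      g%:~R = (d0%:R - n%:R - ind%:~R + ind_oo%:~R
               + (Cf f)%:R * n%:R * (n%:R - 1) / 2) / d0%:R :> rat
    & d0 = 1%N ->
      @is_genus k F base_constants g /\
      g%:~R = 1 - n%:R - ind%:~R + ind_oo%:~R
              + (Cf f)%:R * n%:R * (n%:R - 1) / 2 :> rat].
Proof.
move=> _ df sf theta_oo ind ind_oo d0.
have nE : n = \dim {:F} by apply: succn_inj; rewrite -sf (defining_size df).
(* From C_f n on, m bounds all weights C_f i with i < n. *)
have ellE m : (Cf f * n <= m)%N ->
    (ell (fun P : place F => m%:Z * pole_divisor P))%:Z = (\dim {:F})%:Z *
      m%:Z +
    ((\dim {:F})%:Z - (Cf f)%:Z * (\sum_(i < \dim {:F}) i)%N%:Z + ind - ind_oo).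
  move=> Cm; apply: (ell_formula df) => i; rewrite /pole_order.
  by apply: leq_trans Cm; rewrite leq_mul2l nE (ltnW (ltn_ord i)) orbT.
have [g gg gE] := genus_exists ellE.
have d00 : (d0%:R : rat) != 0.
  by rewrite pnatr_eq0 -lt0n /d0 constant_degree_gt0.
(* This sum of the weights i is the source of the term C_f n (n - 1) / 2. *)
have S2 : (\sum_(i < n) i)%N%:R = n%:R * (n%:R - 1) / 2 :> rat.
  elim: (n) => [|m IH]; first by rewrite big_ord0 !mul0r.
  by rewrite big_ord_recr natrD IH -natr1 /=; field.
have key : g%:~R * d0%:R = d0%:R - n%:R - ind%:~R + ind_oo%:~R
    + (Cf f)%:R * n%:R * (n%:R - 1) / 2 :> rat.
  have := congr1 (fun z : int => z%:~R : rat) gE.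
  rewrite !(rmorphB, rmorphD, rmorphM) /= -nE -!pmulrn S2 => ->.
  by ring.
exists g; split=> //.
  by rewrite -key mulfK.
move=> d01; rewrite (constant_degree1 d01); split=> //.
by move: key; rewrite d01 mulr1.
Qed.
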